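(* The homology group $H_1(\mathsf B(\mathcal G))$ is generated by the classes $[\Gamma_J]$, where $J$ ranges over all $(\ell+1)$-element subsets of $[n+1]$.
   Context: Fix $n\ge\ell\ge1$, $[n+1]=\{1,\dots,n+1\}$. A point $\mathbf x\in(\mathbb{CP}^\ell)^n$ is viewed as an $(n+1)\times(\ell+1)$ matrix whose $i$-th row, $i\le n$, is $(x_{i,0},\dots,x_{i,\ell})$ (homogeneous coordinates) and whose last row is $(1,0,\dots,0)$. For $J\subset[n+1]$ with $|J|=\ell+1$, $\Delta_J(\mathbf x)$ is the determinant of the submatrix with rows $J$, and $\mathsf D_J=\{\mathbf x\in(\mathbb{CP}^\ell)^n:\Delta_J(\mathbf x)=0\}$, an irreducible hypersurface. $\mathsf B(\mathcal G)=(\mathbb{CP}^\ell)^n\setminus\bigcup_J\mathsf D_J$ is the moduli space of general position arrangements of $n$ ordered hyperplanes in $\mathbb C^\ell$. Fix $\mathbf y\in\mathsf B(\mathcal G)$; $\Gamma_J$ is a meridian loop in $\mathsf B(\mathcal G)$, based at $\mathbf y$, about a generic point $\mathbf z_J\in\mathsf D_J$. Homology is with integer coefficients. *)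

(* Defs.v *)
From HB Require Import structures.
From mathcomp Require Import freeg.
From mathcomp Require Import all_boot all_order all_algebra.
From mathcomp Require Import generic_quotient ring_quotient.
From mathcomp Require Import all_classical reals topology normedtype derive trigo.
From mathcomp Require Import continuous_path.
From mathcomp Require Import complex.

Set Implicit Arguments.
Unset Strict Implicit.
Unset Printing Implicit Defensive.

Import Order.TTheory GRing.Theory Num.Theory numFieldNormedType.Exports.

Local Open Scope classical_set_scope.
Local Open Scope ring_scope.
Local Open Scope quotient_scope.

Section SingularHomology.
Variable R : realType.

Definition std_simplex (k : nat) : set 'rV[R]_k.+1 :=
  [set t | (forall i, 0 <= t 0 i) /\ \sum_i t 0 i = 1].
Arguments std_simplex : clear implicits.

(* The face map omits the vertex i: it inserts the barycentric coordinate 0 at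
   position i. *)
Definition face_vec (k : nat) (i : 'I_k.+2) (t : 'rV[R]_k.+1) : 'rV[R]_k.+2 :=
  \row_j (if unlift i j is Some j' then t 0 j' else 0).

Lemma face_vec_simplex k i (t : std_simplex k) :
  face_vec i (set_val t) \in std_simplex k.+1.
Proof.
have [t0 t1] := set_valP t; apply/mem_set; split.
  by move=> j; rewrite mxE; case: (unlift i j).
rewrite (bigD1 i) //= mxE unlift_none add0r -t1.
rewrite (reindex_omap (lift i) (unlift i)) /=; last first.
  by move=> j ij; case: unliftP ij => [j' -> //|->]; rewrite eqxx.
apply: eq_big => j; first by rewrite liftK eqxx eq_sym neq_lift.
by move=> _; rewrite mxE liftK.
Qed.

Definition face k (i : 'I_k.+2) (t : std_simplex k) : std_simplex k.+1 :=
  exist _ (face_vec i (set_val t)) (face_vec_simplex i t).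

Lemma face_continuous k (i : 'I_k.+2) : continuous (@face k i).
Proof.
apply/continuous_comp_initial => t U [P /= nP PU].
pose Q (a : 'I_1) (j' : 'I_k.+1) : set R :=
  if a == 0 then P 0 (lift i j') else setT.
suff : nbhs t (set_val @^-1` [set s : 'rV[R]_k.+1 | forall a j, Q a j (s a j)]).
  apply: filterS => s Qs; apply: PU => a j; rewrite /= ord1 mxE.
  case: unliftP => [j' ej|->].
    by have := Qs 0 j'; rewrite /Q eqxx -ej.
  by have /nbhs_singleton := nP 0 i; rewrite mxE unlift_none.
have : nbhs (set_val t) [set s : 'rV[R]_k.+1 | forall a j, Q a j (s a j)].
  exists Q => // a j; rewrite ord1 /Q eqxx.
  by have := nP 0 (lift i j); rewrite /= mxE liftK.
exact: (@initial_continuous _ _ (set_val : std_simplex k -> _) t).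
Qed.

HB.instance Definition _ k (i : 'I_k.+2) :=
  @isContinuous.Build (std_simplex k) (std_simplex k.+1) (@face k i)
    (@face_continuous k i).

Variable X : topologicalType.

Definition singular_simplex (k : nat) := continuousType (std_simplex k) X.
HB.instance Definition _ k := Choice.on (singular_simplex k).

Definition chain (k : nat) := {freeg (singular_simplex k) / int}.
HB.instance Definition _ k := GRing.Lmodule.on (chain k).

Definition simplex_face k (s : singular_simplex k.+1) (i : 'I_k.+2) :
  singular_simplex k := s \o @face k i.

Definition boundary (k : nat) (c : chain k.+1) : chain k :=
  fglift (fun s : singular_simplex k.+1 =>
    (\sum_(i < k.+2) << (-1) ^+ i *g simplex_face s i >> : chain k)) c.

Definition cycles (k : nat) : chain k -> bool :=
  match k with
  | 0 => fun=> true
  | k'.+1 => fun c => boundary c == 0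
  end.

Lemma boundaryB k (b c : chain k.+1) :
  boundary (b - c) = boundary b - boundary c.
Proof. exact: lift_is_additive. Qed.

Lemma cycles_zmod_closed k : zmod_closed (@cycles k : {pred _}).
Proof.
case: k => [//|k]; split=> [|b c].
  by rewrite unfold_in /= -[0](subrr 0) boundaryB subrr.
by rewrite !unfold_in /= boundaryB => /eqP -> /eqP ->; rewrite subrr.
Qed.

HB.instance Definition _ k :=
  GRing.isZmodClosed.Build (chain k) (@cycles k) (@cycles_zmod_closed k).

Record cycle (k : nat) : Type :=
  Cycle { cycle_chain :> chain k; cycleP : cycles cycle_chain }.
HB.instance Definition _ k := [isSub for @cycle_chain k].
HB.instance Definition _ k := [Choice of cycle k by <:].
HB.instance Definition _ k := [SubChoice_isSubZmodule of cycle k by <:].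

Definition boundaries (k : nat) (z : cycle k) : bool :=
  `[< exists b : chain k.+1, boundary b = z >].

Lemma boundaries_zmod_closed k : zmod_closed (@boundaries k : {pred _}).
Proof.
split=> [|y z].
  by apply/asboolP; exists 0; rewrite -[0](subrr 0) boundaryB subrr.
move=> /asboolP [a ay] /asboolP [b bz]; apply/asboolP; exists (a - b).
by rewrite boundaryB ay bz.
Qed.

HB.instance Definition _ k :=
  GRing.isZmodClosed.Build (cycle k) (@boundaries k) (@boundaries_zmod_closed k).


Definition homology (k : nat) : zmodType :=
  Quotient.quot (GRing.ZmodClosed.clone (cycle k) (@boundaries k) _).

Definition homology_class (k : nat) (z : cycle k) : homology k :=
  \pi z.

End SingularHomology.

Arguments std_simplex : clear implicits.
Arguments singular_simplex : clear implicits.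
Arguments chain : clear implicits.
Arguments cycle : clear implicits.
Arguments homology : clear implicits.

Section Loops.
Variable R : realType.

Definition unit_interval : Type := [set` `[0%R : R, 1%R]].
HB.instance Definition _ := Topological.on unit_interval.

Fact zero_in_unit_interval : (0 : R) \in [set` `[0%R : R, 1%R]].
Proof. by apply/mem_set; rewrite /= in_itv /= lexx ler01. Qed.

Fact one_in_unit_interval : (1 : R) \in [set` `[0%R : R, 1%R]].
Proof. by apply/mem_set; rewrite /= in_itv /= lexx ler01. Qed.

Definition unit_interval0 : unit_interval := exist _ 0 zero_in_unit_interval.
Definition unit_interval1 : unit_interval := exist _ 1 one_in_unit_interval.

Fact unit_interval0_neq1 : unit_interval0 != unit_interval1.
Proof. by apply/eqP => /(congr1 set_val) /eqP; rewrite eq_sym oner_eq0. Qed.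

HB.instance Definition _ :=
  isBiPointed.Build unit_interval unit_interval0_neq1.

Lemma simplex1_coord (t : std_simplex R 1) :
  set_val t 0 ord_max \in [set` `[0%R : R, 1%R]].
Proof.
have [t0] := set_valP t; rewrite !big_ord_recl big_ord0 addr0 => t1.
apply/mem_set; rewrite /= in_itv /= t0 /= -t1.
rewrite (_ : lift ord0 ord0 = ord_max); last exact/val_inj.
by rewrite lerDr.
Qed.

Definition simplex1_to_interval (t : std_simplex R 1) : unit_interval :=
  exist _ (set_val t 0 ord_max) (simplex1_coord t).

Lemma simplex1_to_interval_continuous : continuous simplex1_to_interval.
Proof.
apply/continuous_comp_initial => t.
apply: (@continuous_comp _ _ _ (set_val : std_simplex R 1 -> _)
  (fun v : 'rV[R]_2 => v 0 ord_max)); last exact: coord_continuous.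
exact: (@initial_continuous _ _ (set_val : std_simplex R 1 -> _) t).
Qed.

HB.instance Definition _ :=
  @isContinuous.Build (std_simplex R 1) unit_interval simplex1_to_interval
    simplex1_to_interval_continuous.

Variables (X : topologicalType) (x : X).

Definition loop_simplex (g : {path unit_interval from x to x}) :
  singular_simplex R X 1 := g \o simplex1_to_interval.

Definition loop_chain (g : {path unit_interval from x to x}) : chain R X 1 :=
  << loop_simplex g >>.

Lemma loop_chain_cycle (g : {path unit_interval from x to x}) :
  cycles (loop_chain g).
Proof.
rewrite /= /boundary liftU scale1r 2!big_ord_recl big_ord0 /= addr0.
rewrite expr0 expr1 -freegUN.
suff -> : simplex_face (loop_simplex g) (lift ord0 ord0) =
          simplex_face (loop_simplex g) ord0 by rewrite subrr.
apply/continuousEP => t /=; have [_] := set_valP t.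
rewrite big_ord_recl big_ord0 addr0 => t1.
have -> : simplex1_to_interval (face (lift ord0 ord0) t) = zero.
  apply/val_inj; rewrite /= mxE [ord_max](_ : _ = lift ord0 ord0).
    by rewrite unlift_none.
  exact/val_inj.
have -> : simplex1_to_interval (face ord0 t) = one.
  apply/val_inj; rewrite /= mxE [ord_max](_ : _ = lift ord0 ord0) ?liftK //.
  exact/val_inj.
by rewrite path_zero path_one.
Qed.

Definition loop_class (g : {path unit_interval from x to x}) :
  homology R X 1 :=
  homology_class (Cycle (loop_chain_cycle g)).

End Loops.

(* The same field as R[i], packaged so that the norm topology and the
   differentiability notions of numFieldType apply to it. *)
Definition Cplx (R : realType) : numFieldType := R[i].

Section ProjectiveSpace.
Variables (R : realType) (l : nat).
Local Notation C := (Cplx R).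

Definition nonzero_vectors : set 'rV[C]_l.+1 := [set v | v != 0].

Definition proportional (u v : nonzero_vectors) : bool :=
  `[< exists2 c : C, c != 0 & set_val u = c *: set_val v >].

Lemma proportional_equiv : equiv_class_of proportional.
Proof.
have sym u v : proportional u v -> proportional v u.
  move=> /asboolP [c c0 e]; apply/asboolP; exists c^-1; first by rewrite invr_eq0.
  by rewrite e scalerA mulVf ?scale1r.
split=> [u|u v|v u w].
  by apply/asboolP; exists 1; rewrite ?oner_eq0 ?scale1r.
  by apply/idP/idP => /sym.
move=> /asboolP [c c0 e] /asboolP [d d0 e']; apply/asboolP.
by exists (c * d); rewrite ?mulf_neq0 // -scalerA -e' -e.
Qed.

Canonical proportional_equivRel := EquivRelPack proportional_equiv.
Canonical proportional_encModRel := defaultEncModRel proportional.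

Definition CP : Type := quotient_topology {eq_quot proportional}.
HB.instance Definition _ := Topological.on CP.

Definition homogeneous_coordinates (p : CP) (v : 'rV[C]_l.+1) : Prop :=
  exists u : nonzero_vectors, set_val u = v /\ \pi_CP u = p.

End ProjectiveSpace.

Arguments CP : clear implicits.

Section Arrangements.
Variables (R : realType) (n l : nat).
Local Notation C := (Cplx R).

Definition CPn : topologicalType := {ptws 'I_n -> CP R l}.

Definition represents (A : 'M[C]_(n, l.+1)) (x : CPn) : Prop :=
  forall i, homogeneous_coordinates (x i) (row i A).

(* A with the extra last row (1, 0, ..., 0), at index ord_max. *)
Definition arrangement_matrix (A : 'M[C]_(n, l.+1)) : 'M[C]_(n.+1, l.+1) :=
  \matrix_(i, j)
    (if unlift ord_max i is Some i' then A i' j else (j == ord0)%:R).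

(* enum J lists J in increasing order; Delta is used only when #|J| = l.+1. *)
Definition Delta (J : {set 'I_n.+1}) (A : 'M[C]_(n, l.+1)) : C :=
  \det (rowsub (fun k : 'I_l.+1 => nth ord0 (enum J) k) (arrangement_matrix A)).

(* Delta is homogeneous in each row of A, so its vanishing does not depend on
   the choice of A. *)
Definition hypersurface (J : {set 'I_n.+1}) : set CPn :=
  [set x | exists2 A, represents A x & Delta J A = 0].

Definition general_position : set CPn :=
  ~` \bigcup_(J in [set J : {set 'I_n.+1} | #|J| = l.+1]) hypersurface J.

(* z lies on the hypersurface of J and on no other. Smoothness at z is part of
   transverse_disc. *)
Definition generic_point (J : {set 'I_n.+1}) (z : CPn) : Prop :=
  hypersurface J z /\
  forall I : {set 'I_n.+1}, #|I| = l.+1 -> I <> J -> ~ hypersurface I z.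

(* A closed disc centred at z, holomorphic in its interior, which meets the
   union of the hypersurfaces only at its centre. Since Delta J is a reduced
   equation of the hypersurface of J, the condition on the derivative at 0 says
   that z is a smooth point of that hypersurface and that the disc is transverse
   to it there. *)
Definition transverse_disc (J : {set 'I_n.+1}) (z : CPn)
    (disc : C -> CPn) : Prop :=
  [/\ disc 0 = z,
      forall t, 0 < `|t| <= 1 -> general_position (disc t) &
      exists A : C -> 'M[C]_(n, l.+1),
        [/\ forall t, `|t| <= 1 -> represents (A t) (disc t),
            forall i j,
              {within [set t : C | `|t| <= 1], continuous (fun t => A t i j)},
            forall i j t, `|t| < 1 ->
              derivable (fun t : C => A t i j : C^o) t 1 &
            derive1 (fun t : C => Delta J (A t) : C^o) 0 != 0]].

Definition circle (u : R) : C := (cos (2 * pi * u) +i* sin (2 * pi * u))%C.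

(* The loop g follows, each at triple speed, a path p from y to the boundary of
   a transverse disc at z, the positively oriented boundary of the disc, and the
   reverse of p. *)
Definition meridian (y : general_position) (J : {set 'I_n.+1}) (z : CPn)
    (g : {path (unit_interval R) from y to y in general_position}) : Prop :=
  generic_point J z /\
  exists (disc : C -> CPn) (q : general_position)
    (p : {path (unit_interval R) from y to q in general_position}),
    [/\ transverse_disc J z disc,
        set_val q = disc 1 &
        forall s u : unit_interval R,
          [/\ 3 * set_val s = set_val u -> g s = p u,
              3 * set_val s = 1 + set_val u ->
                set_val (g s) = disc (circle (set_val u)) &
              3 * set_val s = 3 - set_val u -> g s = p u]].

End Arrangements.

Arguments CPn : clear implicits.
Arguments general_position : clear implicits.
Arguments meridian {R n l}.

Definition generated_by (G : zmodType) (I : finType) (P : pred I) (g : I -> G) :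
  Prop :=
  forall h : G, exists m : I -> int, h = \sum_(i | P i) g i *~ m i.

(* Main.v *)
From HB Require Import structures.
Require Import Defs.
From mathcomp Require Import freeg.
From mathcomp Require Import all_boot all_order all_algebra perm.
From mathcomp Require Import generic_quotient ring_quotient.
From mathcomp Require Import all_classical reals topology normedtype derive trigo.
From mathcomp Require Import continuous_path.
From mathcomp Require Import complex ring lra.

(** Let Q be the group of singular 1-chains of the configuration space B modulo
    boundaries and modulo the loops [Gamma J], and let q be the projection. It
    suffices that q vanishes on cycles. This is shown by finding a potential h
    from B to Q such that q of any path is h (end) - h (start): then q c depends
    only on the boundary of c ([cycle_potential]).

    The potential is built upstairs, on the open set U of matrices whose minors
    are all nonzero, from the class in Q of the projected path. The main
    geometric input is that the minors are affine functions of each single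
    entry. So a line on which one entry e varies meets the complement of U in a
    finite set, and it carries a potential as soon as the class of a small circle
    about each of these punctures vanishes ([pot_line]); potentials on small
    rectangles are glued, which works because a rectangle minus finitely many
    points is connected.

    - A puncture where only the minor J vanishes, with nonzero slope in e, is
      called regular. For fixed J and e the regular points form a graph, over the
      other entries, above the complement of a polynomial hypersurface; this
      complement is connected because a complex line minus finitely many points
      is. Hence the classes of small circles agree at all of them ([transport]).
      At a point regular for two entries, the two circles are homotopic
      ([triv_direction]), and such points exist ([minor_link]). So it is enough to
      treat one point per J, and this is what the meridian provides: its
      tail cancels in Q, and the boundary of its transverse disc is
      homotopic to a circle in a coordinate direction ([transverse_circ],
      [meridian_triv]).
    - At a puncture where several minors vanish, the line is moved slightly to a
      parallel line with only regular punctures ([linepot_ex]); that nearby lines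
      have this property means that the resultants of two minors do not vanish
      identically ([minor_rslt]). A contour around the puncture has the same class
      on both lines, and it is zero on the generic one.

    Line potentials are then assembled into one function on U. Two matrices are
    joined by changing their entries one at a time, which stays in U if the target
    is generic; changes of two distinct entries commute ([trans_square]), whence
    the total along such a chain is a potential ([global_potential]).

    Finally this function is constant along rescalings of rows, since these
    project to constant paths ([H_scale]); it descends to B, and it computes q of
    every path because paths in B lift locally to U ([pcl_potential]). *)

Set Implicit Arguments.
Unset Strict Implicit.
Unset Printing Implicit Defensive.

Import Order.TTheory GRing.Theory Num.Theory numFieldNormedType.Exports.

Local Open Scope classical_set_scope.
Local Open Scope ring_scope.

(** * Identities in abelian groups *)

(** A reflexive decision procedure: both sides of an equation are reified as
    formal sums of atoms and compared by their integer coefficients. It closes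
    the many goals where classes of paths in the group Q are rearranged. *)
Inductive zexp := ZVar of nat | ZZero | ZAdd of zexp & zexp | ZOpp of zexp.

Fixpoint zeval (Q : zmodType) (env : seq Q) (t : zexp) : Q :=
  match t with
  | ZVar n => env`_n
  | ZZero => 0
  | ZAdd a b => zeval env a + zeval env b
  | ZOpp a => - zeval env a
  end.

Fixpoint zcoef (t : zexp) (i : nat) : int :=
  match t with
  | ZVar n => (n == i)%:Z
  | ZZero => 0
  | ZAdd a b => zcoef a i + zcoef b i
  | ZOpp a => - zcoef a i
  end.

Lemma zeval_coef (Q : zmodType) (env : seq Q) t :
  zeval env t = \sum_(i < size env) env`_i *~ zcoef t i.
Proof.
elim: t => [n||a IHa b IHb|a IHa] /=.
- have [ns|ns] := ltnP n (size env).
    rewrite (bigD1 (Ordinal ns)) //= eqxx mulr1z big1 ?addr0 // => i.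
    by rewrite -val_eqE eq_sym => /negbTE /= ->.
  rewrite nth_default // big1 // => i _.
  by rewrite (gtn_eqF (leq_trans (ltn_ord i) ns)) mulr0z.
- by rewrite big1 // => i _; rewrite mulr0z.
- by rewrite IHa IHb -big_split; apply: eq_bigr => i _; rewrite mulrzDr.
- by rewrite IHa -sumrN; apply: eq_bigr => i _; rewrite mulrNz.
Qed.

Lemma zeval_eq (Q : zmodType) (env : seq Q) a b :
  all (fun i => zcoef a i == zcoef b i) (iota 0 (size env)) ->
  zeval env a = zeval env b.
Proof.
move=> /allP E; rewrite !zeval_coef; apply: eq_bigr => i _; congr (_ *~ _).
by apply/eqP/E; rewrite mem_iota add0n ltn_ord.
Qed.

Ltac zindex x env :=
  lazymatch env with
  | x :: _ => constr:(O)
  | _ :: ?env' => let n := zindex x env' in constr:(S n)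
  end.
Ltac zmem x env :=
  lazymatch env with
  | nil => constr:(false)
  | x :: _ => constr:(true)
  | _ :: ?env' => zmem x env'
  end.
Ltac zatoms t env :=
  lazymatch t with
  | (?a + ?b)%R => let env := zatoms a env in zatoms b env
  | (- ?a)%R => zatoms a env
  | 0%R => env
  | _ => let m := zmem t env in
         lazymatch m with true => env | false => constr:(t :: env) end
  end.
Ltac zreify t env :=
  lazymatch t with
  | (?a + ?b)%R => let a := zreify a env in let b := zreify b env in constr:(ZAdd a b)
  | (- ?a)%R => let a := zreify a env in constr:(ZOpp a)
  | 0%R => constr:(ZZero)
  | _ => let n := zindex t env in constr:(ZVar n)
  end.
Ltac zmod :=
  lazymatch goal with
  | |- @eq ?Q ?a ?b =>
    let env := zatoms a (@nil Q) in let env := zatoms b env in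
    let ra := zreify a env in let rb := zreify b env in
    apply: (@zeval_eq _ env ra rb); vm_compute; reflexivity
  end.

(** [zmod_from H] proves an equation that is a consequence of H up to
    rearrangement; [zmod_from2] uses the sum of two equations. *)
Lemma eq_from (Q : zmodType) (a b c d : Q) : a = b -> c - d = a - b -> c = d.
Proof. by move=> ->; rewrite subrr => /eqP; rewrite subr_eq0 => /eqP. Qed.
Lemma eq_from2 (Q : zmodType) (a b a' b' c d : Q) : a = b -> a' = b' ->
  c - d = (a - b) + (a' - b') -> c = d.
Proof. by move=> -> ->; rewrite !subrr addr0 => /eqP; rewrite subr_eq0 => /eqP. Qed.

Ltac zmod_from H := apply: (eq_from H); zmod.
Ltac zmod_from2 H H' := apply: (eq_from2 H H'); zmod.

(** * Real induction and the complex plane *)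
Section RealInduction.
Variable R : realType.

(** Compactness of intervals without subdivisions: a property of open intervals
    which is local and passes to overlapping unions holds for all intervals, since
    the supremum of the reachable end points can be passed. *)
Lemma interval_induction (P : R -> R -> Prop) :
  (forall a a' b b', a <= a' -> b' <= b -> P a b -> P a' b') ->
  (forall a b c d, a < c -> c < b -> b < d -> P a b -> P c d -> P a d) ->
  (forall x, exists2 e, 0 < e & P (x - e) (x + e)) ->
  forall a b, P a b.
Proof.
move=> mono glue loc a b.
have [ea ea0 Pa] := loc a.
have [ba|ab] := leP b a.
  by apply: mono Pa; lra.
pose E := [set t : R | t <= b /\ P a t]%classic.
have Ea : E a by split; [exact: ltW|apply: mono Pa; lra].
have Eb : ubound E b by move=> t [].
have supE : has_sup E by split; [exists a|exists b].
have sb : sup E <= b by apply: ge_sup => //; exists a.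
have as_ : a <= sup E by apply: ub_le_sup => //; exists b.
have [e e0 Pe] := loc (sup E).
have Pae : P a (sup E + e).
  have [lea|lta] := leP (sup E - e) a; first exact: mono Pe.
  have [t [tb Pt] te] := sup_adherent e0 supE.
  have ts : t <= sup E by apply: ub_le_sup => //; exists b.
  by apply: glue lta te _ Pt Pe; lra.
have bs : b <= sup E + e.
  rewrite leNgt; apply/negP => sb'.
  have : sup E + e <= sup E by apply: ub_le_sup; [exists b|split=> //; apply: ltW].
  by lra.
by apply: mono Pae.
Qed.

Lemma loc_const (T : Type) (F : R -> T) :
  (forall t : R, 0 <= t <= 1 -> exists2 e : R, 0 < e &
     forall t' : R, 0 <= t' <= 1 -> `|t' - t| < e -> F t' = F t) ->
  F 1 = F 0.
Proof.
move=> loc.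
pose P (a b : R) := forall t t' : R, 0 <= t <= 1 -> 0 <= t' <= 1 ->
   a < t < b -> a < t' < b -> F t = F t'.
have H : P (-1) 2; last by apply: H; lra.
apply: (interval_induction (P := P)) => [a a' b b' aa bb Pab t t' t0 t1 tab t'ab|a b c d ac cb bd Pab Pcd t t' t0 t1|x].
- by apply: Pab => //; lra.
- move=> tad t'ad.
  have [cc|cc] := boolP ((0 < b) && (c < 1)); last first.
    have [bc|bc] : b <= 0 \/ 1 <= c.
      by move: cc; rewrite negb_and -!leNgt => /orP[]; [left|right].
    + by apply: Pcd => //; lra.
    + by apply: Pab => //; lra.
  have [m [m0 mc]] : exists m, 0 <= m <= 1 /\ c < m < b.
    have [b1|b1] := leP b 1.
      have [c0|c0] := leP c 0; first by exists (b / 2); lra.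
      by exists ((b + c) / 2); lra.
    have [c0|c0] := leP c 0; first by exists (1 / 2); lra.
    by exists ((1 + c) / 2); lra.
  have Fm s : 0 <= s <= 1 -> a < s < d -> F s = F m.
    move=> s0 sad; have [sb|sb] := ltP s b.
      by apply: Pab => //; lra.
    by apply: Pcd => //; lra.
  by rewrite !Fm.
- have [x01|x01] := boolP (0 <= x <= 1).
    have [e e0 He] := loc x x01; exists e => // t t' t0 t1 te t'e.
    by rewrite (He t) ?(He t') // ltr_distlC; lra.
  have [x0|x0] := ltP x 0.
    by exists (- x); [lra|move=> t t' ? ? ? ?; exfalso; lra].
  have x1 : 1 < x by move: x01; rewrite x0 /= -ltNge.
  by exists (x - 1) => [|t t' ? ? ? ?]; [lra|exfalso; lra].
Qed.

Lemma avoid_small (L : seq R) (e : R) : 0 < e -> exists2 s, 0 < s < e & s \notin L.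
Proof.
elim: L e => [|x L IH] e e0; first by exists (e / 2) => //; lra.
have [x0|x0] := ltP 0 x.
  have [|s s0 sL] := IH (Num.min x e); first by rewrite lt_min x0.
  move: s0; rewrite lt_min => s0; exists s; first lra.
  by rewrite inE (negbTE sL) orbF; apply/eqP; lra.
have [s s0 sL] := IH e e0; exists s => //.
by rewrite inE (negbTE sL) orbF; apply/eqP; lra.
Qed.

End RealInduction.

Section ComplexPlane.
Variable R : realType.
Local Notation C := (Cplx R).

(** The norm of C takes its values in C; [nrm] is the same number as a real,
    which keeps all estimates within linear real arithmetic. *)
Definition re (z : C) : R := complex.Re z.
Definition im (z : C) : R := complex.Im z.
Definition rc (t : R) : C := (t%:C)%C.
Definition ii : C := (0 +i* 1)%C.
Definition nrm (z : C) : R := Normc.normc z.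

Lemma nrmE (z : C) : `|z| = rc (nrm z).
Proof. by []. Qed.
Lemma nrm_ltE (z : C) (e : R) : (`|z| < rc e) = (nrm z < e).
Proof. by rewrite nrmE [LHS]ltcR. Qed.
Lemma nrm_leE (z : C) (e : R) : (`|z| <= rc e) = (nrm z <= e).
Proof. by rewrite nrmE [LHS]lecR. Qed.
Lemma rc_inj : injective rc. Proof. by move=> x y []. Qed.
Lemma rcD x y : rc (x + y) = rc x + rc y. Proof. exact: rmorphD. Qed.
Lemma rcB x y : rc (x - y) = rc x - rc y. Proof. exact: rmorphB. Qed.
Lemma rcM x y : rc (x * y) = rc x * rc y. Proof. exact: rmorphM. Qed.
Lemma rc0 : rc 0 = 0. Proof. by []. Qed.
Lemma rc1 : rc 1 = 1. Proof. by []. Qed.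
Lemma rc_eq0 x : (rc x == 0) = (x == 0). Proof. exact: fmorph_eq0. Qed.
Lemma reD x y : re (x + y) = re x + re y. Proof. by case: x; case: y. Qed.
Lemma imD x y : im (x + y) = im x + im y. Proof. by case: x; case: y. Qed.
Lemma reN x : re (- x) = - re x. Proof. by case: x. Qed.
Lemma imN x : im (- x) = - im x. Proof. by case: x. Qed.
Lemma reM x y : re (x * y) = re x * re y - im x * im y.
Proof. by case: x; case: y. Qed.
Lemma imM x y : im (x * y) = re x * im y + im x * re y.
Proof. by case: x; case: y. Qed.
Lemma re_rc t : re (rc t) = t. Proof. by []. Qed.
Lemma im_rc t : im (rc t) = 0. Proof. by []. Qed.
Lemma re_i : re ii = 0. Proof. by []. Qed.
Lemma im_i : im ii = 1. Proof. by []. Qed.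
Lemma re1 : re 1 = 1. Proof. by []. Qed.
Lemma im1 : im 1 = 0. Proof. by []. Qed.
Lemma re0 : re 0 = 0. Proof. by []. Qed.
Lemma im0 : im 0 = 0. Proof. by []. Qed.
Definition reimE := (reD, imD, reN, imN, reM, imM, re_rc, im_rc, re_i, im_i,
  re1, im1, re0, im0).
Lemma C_eq (x y : C) : re x = re y -> im x = im y -> x = y.
Proof. by case: x => a b; case: y => c d; rewrite /re /im /= => -> ->. Qed.
Lemma ii2 : ii * ii = -1.
Proof. by apply: C_eq; rewrite !reimE; ring. Qed.

Lemma nrm0 : nrm 0 = 0. Proof. exact: Normc.normc0. Qed.
Lemma nrm1 : nrm 1 = 1. Proof. exact: Normc.normc1. Qed.
Lemma nrmM x y : nrm (x * y) = nrm x * nrm y. Proof. exact: Normc.normcM. Qed.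
Lemma nrmD x y : nrm (x + y) <= nrm x + nrm y. Proof. exact: le_normcD. Qed.
Lemma nrmN x : nrm (- x) = nrm x. Proof. exact: normcN. Qed.
Lemma nrm_ge0 x : 0 <= nrm x.
Proof. by rewrite -[_ <= _]lecR; apply: (normr_ge0 (x : C)). Qed.
Lemma nrm_eq0 x : (nrm x == 0) = (x == 0).
Proof. by rewrite -rc_eq0 -nrmE normr_eq0. Qed.
Lemma nrm_gt0 x : (0 < nrm x) = (x != 0).
Proof. by rewrite lt_neqAle nrm_ge0 andbT eq_sym nrm_eq0. Qed.
Lemma nrmV x : nrm x^-1 = (nrm x)^-1.
Proof. exact: Normc.normcV. Qed.
Lemma nrm_rc t : nrm (rc t) = `|t|.
Proof. by rewrite /nrm /= expr0n addr0 sqrtr_sqr. Qed.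
Lemma nrm_re z : `|re z| <= nrm z.
Proof.
case: z => a b; rewrite /nrm /re /= -sqrtr_sqr ler_sqrt ?lerDl ?sqr_ge0 //.
by rewrite addr_ge0 ?sqr_ge0.
Qed.
Lemma nrm_im z : `|im z| <= nrm z.
Proof.
case: z => a b; rewrite /nrm /im /= -sqrtr_sqr ler_sqrt ?lerDr ?sqr_ge0 //.
by rewrite addr_ge0 ?sqr_ge0.
Qed.
Lemma nrm_ii : nrm ii = 1.
Proof. by rewrite /nrm /= expr0n add0r expr1n sqrtr1. Qed.
Lemma nrm_le_reim z : nrm z <= `|re z| + `|im z|.
Proof.
rewrite {1}(_ : z = rc (re z) + ii * rc (im z)); last first.
  by apply: C_eq; rewrite !reimE; ring.
by rewrite (le_trans (nrmD _ _)) // nrmM !nrm_rc nrm_ii mul1r.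
Qed.
Lemma nrm_distr x y z : nrm (x - z) <= nrm (x - y) + nrm (y - z).
Proof. by rewrite (le_trans _ (nrmD _ _)) // subrKA. Qed.
Lemma nrmBC x y : nrm (x - y) = nrm (y - x).
Proof. by rewrite -nrmN opprB. Qed.

Definition lin (v v' : C) (t : R) : C := v + rc t * (v' - v).
Lemma lin0 v v' : lin v v' 0 = v. Proof. by rewrite /lin rc0 mul0r addr0. Qed.
Lemma lin1 v v' : lin v v' 1 = v'. Proof. by rewrite /lin rc1 mul1r addrC subrK. Qed.

Lemma nrm_convex (c v1 v2 v3 : C) (s t d : R) :
  0 <= s -> 0 <= t -> s + t <= 1 ->
  nrm (v1 - c) < d -> nrm (v2 - c) < d -> nrm (v3 - c) < d ->
  nrm (v1 + rc s * (v2 - v1) + rc t * (v3 - v1) - c) < d.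
Proof.
move=> s0 t0 st h1 h2 h3.
have -> : v1 + rc s * (v2 - v1) + rc t * (v3 - v1) - c =
   rc (1 - s - t) * (v1 - c) + rc s * (v2 - c) + rc t * (v3 - c).
  by rewrite !rcB rc1; ring.
apply: le_lt_trans (nrmD _ _) _; rewrite nrmM nrm_rc ger0_norm //.
have : nrm (rc (1 - s - t) * (v1 - c) + rc s * (v2 - c)) <=
   (1 - s - t) * nrm (v1 - c) + s * nrm (v2 - c).
  rewrite (le_trans (nrmD _ _)) // !nrmM !nrm_rc !ger0_norm //; lra.
have [->|t0'] := eqVneq t 0.
  have [->|s0'] := eqVneq s 0.
    by rewrite !mul0r; lra.
  have : s * nrm (v2 - c) < s * d by rewrite ltr_pM2l // lt_neqAle eq_sym s0'.
  have : (1 - s) * nrm (v1 - c) <= (1 - s) * d by rewrite ler_wpM2l //; lra.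
  lra.
have : t * nrm (v3 - c) < t * d by rewrite ltr_pM2l // lt_neqAle eq_sym t0'.
have : s * nrm (v2 - c) <= s * d by rewrite ler_wpM2l //; lra.
have : (1 - s - t) * nrm (v1 - c) <= (1 - s - t) * d by rewrite ler_wpM2l //; lra.
lra.
Qed.

Lemma away (S : seq C) v : v \notin S ->
  exists2 d : R, 0 < d & forall v', nrm (v' - v) < d -> v' \notin S.
Proof.
elim: S => [|a S IH]; first by exists 1.
rewrite inE negb_or => /andP[va /IH [d d0 Hd]].
exists (Num.min d (nrm (a - v))).
  by rewrite lt_min d0 nrm_gt0 subr_eq0 eq_sym.
move=> v'; rewrite lt_min => /andP[h1 h2]; rewrite inE negb_or Hd // andbT.
by apply: contraTneq h2 => ->; rewrite ltxx.
Qed.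

(** A complex line minus a finite set is connected by broken lines with one
    corner p: leave the middle of the segment orthogonally, by an amount that
    avoids the finitely many values for which one of the two sides meets S. *)
Lemma detour (S : seq C) (v v' : C) (e : R) : v \notin S -> v' \notin S -> 0 < e ->
  exists p, [/\ nrm (p - (v + rc 2^-1 * (v' - v))) < e,
    forall t, 0 <= t <= 1 -> lin v p t \notin S &
    forall t, 0 <= t <= 1 -> lin p v' t \notin S].
Proof.
move=> vS v'S e0.
have [<-|vv'] := eqVneq v v'.
  exists v; split; first by rewrite subrr mulr0 addr0 subrr nrm0.
    by move=> t _; rewrite /lin subrr mulr0 addr0.
  by move=> t _; rewrite /lin subrr mulr0 addr0.
have d0 : v' - v != 0 by rewrite subr_eq0 eq_sym.
set d := v' - v in d0 *.
(* in the coordinate where v is 0 and v' is 1, the corner is 1/2 + i s; a point r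
   lies on a side of the path only if s is one of the following numbers *)
pose bad1 r := let q := (r - v) / d in im q / (2 * re q).
pose bad2 r := let q := (r - v) / d in im q / (2 * (1 - re q)).
have [|s se sL] := @avoid_small R (map bad1 S ++ map bad2 S) (e / nrm d).
  by rewrite divr_gt0 // nrm_gt0.
rewrite mem_cat negb_or in sL; case/andP: sL => sL1 sL2.
have k0 : rc 2^-1 + ii * rc s = rc 2^-1 + ii * rc s by [].
exists (v + (rc 2^-1 + ii * rc s) * d); split.
- rewrite (_ : _ - _ = ii * rc s * d); last by ring.
  rewrite !nrmM nrm_ii nrm_rc mul1r ger0_norm; last by lra.
  by rewrite -ltr_pdivlMr ?nrm_gt0 //; lra.
- move=> t t01; apply/negP => tS.
  have [t0|t0] := eqVneq t 0; first by move: tS; rewrite t0 lin0 (negbTE vS).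
  move/negP: sL1; apply; apply/mapP; eexists; first exact: tS.
  have E : (lin v (v + (rc 2^-1 + ii * rc s) * d) t - v) / d =
     rc t * (rc 2^-1 + ii * rc s) by rewrite /lin; field.
  by rewrite /bad1 E !reimE; field; rewrite t0.
- move=> t t01; apply/negP => tS.
  have [t0|t0] := eqVneq t 1; first by move: tS; rewrite t0 lin1 (negbTE v'S).
  move/negP: sL2; apply; apply/mapP; eexists; first exact: tS.
  have E : (lin (v + (rc 2^-1 + ii * rc s) * d) v' t - v) / d =
     (1 - rc t) * (rc 2^-1 + ii * rc s) + rc t.
    have -> : v' = v + d by rewrite addrC subrK.
    by rewrite /lin; field.
  rewrite /bad2 E !reimE; field.
rewrite (_ : _ - _ = 1 - t); last by ring.
by rewrite subr_eq0 eq_sym.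
Qed.

End ComplexPlane.

(** * Potentials on a punctured line *)
Section LinePotential.
Variables (R : realType) (Q : zmodType).
Local Notation C := (Cplx R).
Variables (S : seq C) (g : C -> C -> Q).
Implicit Types (v : C) (h : C -> Q).

Definition tri_pt v1 v2 v3 (s t : R) : C := v1 + rc s * (v2 - v1) + rc t * (v3 - v1).

(** g v v' stands for the class of the segment from v to v'; it is additive on
    triangles that avoid the punctures. *)
Hypothesis tri : forall v1 v2 v3,
  (forall s t : R, 0 <= s -> 0 <= t -> s + t <= 1 -> tri_pt v1 v2 v3 s t \notin S) ->
  g v1 v2 + g v2 v3 = g v1 v3.

Definition locpot h (O : C -> Prop) := forall v, O v -> v \notin S ->
  exists2 d : R, 0 < d & forall v', nrm (v' - v) < d -> h v' - h v = g v v'.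

(** Along a segment, h minus the class of the initial piece is locally
    constant. *)
Lemma locpot_seg h O v v' : locpot h O ->
  (forall t : R, 0 <= t <= 1 -> O (lin v v' t) /\ lin v v' t \notin S) ->
  h v' - h v = g v v'.
Proof.
move=> hO vO.
have gvv : g v v = 0.
  apply: (@addrI _ (g v v)); rewrite addr0; apply: tri => s t _ _ _.
  rewrite /tri_pt subrr !mulr0 !addr0 -[v](lin0 _ v').
  by apply: (vO _ _).2; rewrite lexx ler01.
suff : h (lin v v' 1) - g v (lin v v' 1) = h (lin v v' 0) - g v (lin v v' 0).
  by rewrite lin0 lin1 gvv => H; zmod_from H.
apply: (@loc_const _ _ (fun t => h (lin v v' t) - g v (lin v v' t))) => t t01.
have [d d0 Hd] := hO _ (vO t t01).1 (vO t t01).2.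
exists (d / (nrm (v' - v) + 1)).
  by rewrite divr_gt0 // ltr_wpDl ?nrm_ge0.
move=> t' t'01; rewrite ltr_pdivlMr ?ltr_wpDl ?nrm_ge0 // => tt.
have E : g v (lin v v' t) + g (lin v v' t) (lin v v' t') = g v (lin v v' t').
  apply: tri => a b a0 b0 ab.
  have -> : tri_pt v (lin v v' t) (lin v v' t') a b = lin v v' (a * t + b * t').
    by rewrite /tri_pt /lin rcD !rcM; ring.
  apply: (vO _ _).2.
  have : 0 <= a * t <= a by rewrite mulr_ge0 ?ler_piMr //; lra.
  have : 0 <= b * t' <= b by rewrite mulr_ge0 ?ler_piMr //; lra.
  lra.
suff H : h (lin v v' t') - h (lin v v' t) = g (lin v v' t) (lin v v' t').
  zmod_from2 H E.
apply: Hd.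
rewrite /lin (_ : _ - _ = rc (t' - t) * (v' - v)); last by rewrite rcB; ring.
rewrite nrmM nrm_rc; apply: le_lt_trans tt.
by rewrite ler_wpM2l // lerDl.
Qed.

Definition rect (x0 x1 y0 y1 : R) (v : C) : Prop :=
  (x0 < re v < x1) /\ (y0 < im v < y1).

Lemma conv_between (x a b t : R) : 0 <= t <= 1 -> x < a -> x < b -> x < a + t * (b - a).
Proof.
move=> t01 xa xb; have [ab|ba] := leP a b.
  have : 0 <= t * (b - a) by rewrite mulr_ge0; lra.
  lra.
have : 0 <= (1 - t) * (a - b) by rewrite mulr_ge0; lra.
lra.
Qed.

Lemma conv_between' (x a b t : R) : 0 <= t <= 1 -> a < x -> b < x -> a + t * (b - a) < x.
Proof.
move=> t01 ax bx.
have := @conv_between (- x) (- a) (- b) t t01.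
rewrite !ltrN2 => /(_ ax bx).
rewrite (_ : _ + _ = - (a + t * (b - a))) ?ltrN2 //; ring.
Qed.

Lemma rect_convex x0 x1 y0 y1 v v' t : 0 <= t <= 1 ->
  rect x0 x1 y0 y1 v -> rect x0 x1 y0 y1 v' -> rect x0 x1 y0 y1 (lin v v' t).
Proof.
move=> t01 [/andP[a b] /andP[c d]] [/andP[a' b'] /andP[c' d']].
by rewrite /rect /lin !reimE !mul0r subr0 addr0 !conv_between ?conv_between'.
Qed.

Lemma rect_open x0 x1 y0 y1 v : rect x0 x1 y0 y1 v ->
  exists2 e : R, 0 < e & forall p, nrm (p - v) < e -> rect x0 x1 y0 y1 p.
Proof.
move=> [/andP[a b] /andP[c d]].
exists (Num.min (Num.min (re v - x0) (x1 - re v)) (Num.min (im v - y0) (y1 - im v))).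
  by rewrite !lt_min !subr_gt0 a b c d.
move=> p; rewrite !lt_min => /andP[/andP[h1 h2] /andP[h3 h4]].
have := nrm_re (p - v); have := nrm_im (p - v); rewrite !reimE.
rewrite !ler_norml => /andP[h5 h6] /andP[h7 h8].
by split; lra.
Qed.

(** Two potentials on a rectangle differ by a constant, because the rectangle
    minus S is connected. *)
Lemma const_diff h1 h2 x0 x1 y0 y1 v v' :
  locpot h1 (rect x0 x1 y0 y1) -> locpot h2 (rect x0 x1 y0 y1) ->
  rect x0 x1 y0 y1 v -> rect x0 x1 y0 y1 v' -> v \notin S -> v' \notin S ->
  h1 v - h2 v = h1 v' - h2 v'.
Proof.
move=> H1 H2 vO v'O vS v'S.
have mO : rect x0 x1 y0 y1 (lin v v' 2^-1) by apply: rect_convex => //; lra.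
have [e e0 He] := rect_open mO.
have [p [pm vp pv']] := detour vS v'S e0.
have pO := He _ pm.
have E w w' : rect x0 x1 y0 y1 w -> rect x0 x1 y0 y1 w' ->
    (forall t, 0 <= t <= 1 -> lin w w' t \notin S) -> h1 w - h2 w = h1 w' - h2 w'.
  move=> wO w'O ww'.
  have ww t : 0 <= t <= 1 -> rect x0 x1 y0 y1 (lin w w' t) /\ lin w w' t \notin S.
    by move=> t01; split; [apply: rect_convex|apply: ww'].
  have K1 := locpot_seg H1 ww; have K2 := locpot_seg H2 ww.
  by zmod_from2 K2 (esym K1).
by rewrite (E v p) // (E p v').
Qed.

Definition pot_rect x0 x1 y0 y1 := exists h, locpot h (rect x0 x1 y0 y1).

Lemma locpot_sub h (O O' : C -> Prop) : (forall v, O' v -> O v) -> locpot h O -> locpot h O'.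
Proof. by move=> OO H v /OO vO; apply: H. Qed.

Lemma exists_notS x0 x1 y0 y1 : x0 < x1 -> y0 < y1 -> exists2 v, rect x0 x1 y0 y1 v & v \notin S.
Proof.
move=> x01 y01.
have [s s0 sS] := @avoid_small R (map (fun v : C => re v - x0) S) (x1 - x0) ltac:(lra).
exists (rc (x0 + s) + ii R * rc ((y0 + y1) / 2)).
  by split; rewrite !reimE; lra.
apply: contra sS => vS; apply/mapP; eexists; first exact: vS.
by rewrite !reimE; ring.
Qed.

(** Two potentials are glued after shifting one by the constant difference on the
    overlap; this is where the overlap has to be a rectangle. *)
Lemma pot_glue (O O1 O2 : C -> Prop) x0 x1 y0 y1 : x0 < x1 -> y0 < y1 ->
  (forall v, O v -> O1 v \/ O2 v) ->
  (forall v, O1 v -> O2 v -> rect x0 x1 y0 y1 v) ->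
  (forall v, rect x0 x1 y0 y1 v -> O1 v /\ O2 v) ->
  (forall v, O1 v -> exists2 e : R, 0 < e & forall p, nrm (p - v) < e -> O1 p) ->
  (forall v, O2 v -> exists2 e : R, 0 < e & forall p, nrm (p - v) < e -> O2 p) ->
  (exists h, locpot h O1) -> (exists h, locpot h O2) -> exists h, locpot h O.
Proof.
move=> x01 y01 cover sub1 sub2 open1 open2 [h1 H1] [h2 H2].
have [m mO mS] := exists_notS x01 y01.
pose k := h1 m - h2 m.
pose h v := if `[< O1 v >] then h1 v else h2 v + k.
have hE1 v : O1 v -> h v = h1 v by move=> v1; rewrite /h asboolT.
have hE2 v : O2 v -> v \notin S -> h v = h2 v + k.
  move=> v2 vS; rewrite /h; case: asboolP => // v1.
  have E := @const_diff h1 h2 x0 x1 y0 y1 v m.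
  rewrite /k -E //; [zmod| | |exact: sub1].
    by apply: locpot_sub H1 => w /sub2 [].
  by apply: locpot_sub H2 => w /sub2 [].
exists h => v vO vS; have [v1|v2] := cover v vO.
  have [d d0 Hd] := H1 v v1 vS; have [e e0 He] := open1 v v1.
  exists (Num.min d e); first by rewrite lt_min d0.
  by move=> v'; rewrite lt_min => /andP[/Hd <- /He v'1]; rewrite !hE1.
have [d d0 Hd] := H2 v v2 vS; have [e e0 He] := open2 v v2.
have [f f0 Hf] := away vS.
exists (Num.min d (Num.min e f)); first by rewrite !lt_min d0 e0 f0.
move=> v'; rewrite !lt_min => /andP[/Hd <- /andP[/He v'2 /Hf v'S]].
by rewrite !hE2 //; zmod.
Qed.

Lemma pot_rect_sub x0 x1 y0 y1 x0' x1' y0' y1' :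
  x0 <= x0' -> x1' <= x1 -> y0 <= y0' -> y1' <= y1 ->
  pot_rect x0 x1 y0 y1 -> pot_rect x0' x1' y0' y1'.
Proof.
move=> a b c d [h H]; exists h; apply: locpot_sub H => v [? ?].
by split; lra.
Qed.

(** The sum of g around a square with centre a and corners a + d i^k, small
    enough to contain no other puncture. *)
Hypothesis diam : forall a, a \in S -> exists (d : C) (r : R),
  [/\ 0 < nrm d < r, forall v, nrm (v - a) < r -> v != a -> v \notin S &
   g (a + d) (a + d * ii R) + g (a + d * ii R) (a - d) + g (a - d) (a - d * ii R)
    + g (a - d * ii R) (a + d) = 0].

Lemma pot_regular a : a \notin S -> exists2 e, 0 < e &
  exists h, locpot h (fun v => nrm (v - a) < e).
Proof.
move=> /away [e e0 He]; exists e => //; exists (g a) => v va vS.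
exists (e - nrm (v - a)); first by rewrite subr_gt0.
move=> v' v'v; have v'a : nrm (v' - a) < e.
  by apply: le_lt_trans (nrm_distr _ v _) _; rewrite -ltrBrDr.
rewrite -(tri (v2 := v) (v3 := v')); first by rewrite addrAC subrr add0r.
move=> s t s0 t0 st; apply: He; apply: nrm_convex => //.
by rewrite subrr nrm0.
Qed.

(** The disc around a puncture is covered by four half planes, one for each side of
    the square with corners v0, v1, v2, v3. On the half plane k, the potential is
    the class of the way along the square to the corner k, followed by a segment.
    Consecutive choices agree on the overlap by additivity on triangles; the last
    and the first one agree because the sum around the square is zero. *)
Lemma pot_puncture a : a \in S -> exists2 e, 0 < e &
  exists h, locpot h (fun v => nrm (v - a) < e).
Proof.
move=> aS; have [d [r [/andP[d0 dr] Hr D]]] := diam aS.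
have dn0 : d != 0 by rewrite -nrm_gt0.
pose O v := nrm (v - a) < r.
pose la (w : C) v := re (w / d * (v - a)).
have laE w v1 v2 v3 s t : la w (tri_pt v1 v2 v3 s t) =
   (1 - s - t) * la w v1 + s * la w v2 + t * la w v3.
  by rewrite /la /tri_pt !reimE; ring.
have tri_half w v1 v2 v3 : O v1 -> O v2 -> O v3 ->
  0 < la w v1 -> 0 < la w v2 -> 0 < la w v3 -> g v1 v2 + g v2 v3 = g v1 v3.
  move=> O1 O2 O3 l1 l2 l3; apply: tri => s t s0 t0 st; apply: Hr.
    exact: nrm_convex.
  have : 0 < la w (tri_pt v1 v2 v3 s t).
    rewrite laE.
    have h1 : 0 <= (1 - s - t) * la w v1 by rewrite mulr_ge0 ?(ltW l1) //; lra.
    have h2 : 0 <= s * la w v2 by rewrite mulr_ge0 ?(ltW l2).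
    have h3 : 0 <= t * la w v3 by rewrite mulr_ge0 ?(ltW l3).
    have [s1|s1] := eqVneq s 0.
      have [t1|t1] := eqVneq t 0.
        by rewrite s1 t1 !mul0r !addr0 !subr0 mul1r.
      have : 0 < t * la w v3 by rewrite mulr_gt0 // lt_neqAle eq_sym t1.
      lra.
    have : 0 < s * la w v2 by rewrite mulr_gt0 // lt_neqAle eq_sym s1.
    lra.
  apply: contraTneq => ->.
  by rewrite /la subrr mulr0 re0 ltxx.
(* the half plane k is where the real-linear form la wk is positive; it contains
   the corners k and k + 1 *)
pose w0 : C := 1 - ii R; pose w1 : C := -1 - ii R.
pose w2 : C := -1 + ii R; pose w3 : C := 1 + ii R.
pose v0 := a + d; pose v1 := a + d * ii R; pose v2 := a - d; pose v3 := a - d * ii R.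
have laa w u : la w (a + d * u) = re (w * u).
  by rewrite /la addrAC subrr add0r; congr re; field.
have e0 : v0 = a + d * 1 by rewrite mulr1.
have e2 : v2 = a + d * (-1) by rewrite mulrN1.
have e3 : v3 = a + d * (- ii R) by rewrite mulrN.
have O0 : O v0 by rewrite /O /v0 addrAC subrr add0r.
have O1 : O v1 by rewrite /O /v1 addrAC subrr add0r nrmM nrm_ii mulr1.
have O2 : O v2 by rewrite /O /v2 addrAC subrr add0r nrmN.
have O3 : O v3 by rewrite /O /v3 addrAC subrr add0r nrmN nrmM nrm_ii mulr1.
have l00 : 0 < la w0 v0 by rewrite e0 laa /w0 !reimE; lra.
have l01 : 0 < la w0 v1 by rewrite laa /w0 !reimE; lra.
have l11 : 0 < la w1 v1 by rewrite laa /w1 !reimE; lra.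
have l12 : 0 < la w1 v2 by rewrite e2 laa /w1 !reimE; lra.
have l22 : 0 < la w2 v2 by rewrite e2 laa /w2 !reimE; lra.
have l23 : 0 < la w2 v3 by rewrite e3 laa /w2 !reimE; lra.
have l33 : 0 < la w3 v3 by rewrite e3 laa /w3 !reimE; lra.
have l30 : 0 < la w3 v0 by rewrite e0 laa /w3 !reimE; lra.
have la20 v : la w2 v = - la w0 v by rewrite /la /w2 /w0 !reimE; ring.
have la31 v : la w3 v = - la w1 v by rewrite /la /w3 /w1 !reimE; ring.
pose G1 := g v0 v1; pose G2 := G1 + g v1 v2; pose G3 := G2 + g v2 v3.
have G4 : G3 + g v3 v0 = 0 by rewrite /G3 /G2 /G1 D.
pose h v := if 0 < la w0 v then g v0 v else if 0 < la w1 v then G1 + g v1 v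
  else if 0 < la w2 v then G2 + g v2 v else G3 + g v3 v.
have h0 v : 0 < la w0 v -> h v = g v0 v by rewrite /h => ->.
have h1 v : O v -> 0 < la w1 v -> h v = G1 + g v1 v.
  by move=> Ov l; rewrite /h l; case: ltP => // l0; rewrite /G1 (tri_half w0).
have h2 v : O v -> 0 < la w2 v -> h v = G2 + g v2 v.
  move=> Ov l; rewrite /h l; have:= l; rewrite la20 oppr_gt0 => l'.
  rewrite ltNge (ltW l') /=; case: ltP => // l1.
  by rewrite /G2 -addrA (tri_half w1 v1 v2 v).
have h3 v : O v -> 0 < la w3 v -> h v = G3 + g v3 v.
  move=> Ov l; rewrite /h; have:= l; rewrite la31 oppr_gt0 => l'.
  case: ltP => [l0|_].
    by rewrite -(tri_half w3 v3 v0 v) // addrA G4 add0r.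
  rewrite ltNge (ltW l') /=; case: ltP => // l2.
  by rewrite /G3 -(tri_half w2 v2 v3 v) // addrA.
exists r; first exact: lt_trans dr.
exists h => v vO vS.
have key w u G : O u -> 0 < la w u -> 0 < la w v ->
    (forall v', O v' -> 0 < la w v' -> h v' = G + g u v') ->
    exists2 d : R, 0 < d & forall v', nrm (v' - v) < d -> h v' - h v = g v v'.
  move=> uO lu lv H.
  have n0 : 0 < nrm (w / d) + 1 by rewrite ltr_wpDl ?nrm_ge0.
  exists (Num.min (r - nrm (v - a)) (la w v / (nrm (w / d) + 1))).
    by rewrite lt_min subr_gt0 vO divr_gt0.
  move=> v'; rewrite lt_min ltr_pdivlMr // => /andP[n1 n2].
  have v'O : O v'.
    by apply: le_lt_trans (nrm_distr _ v _) _; rewrite -ltrBrDr.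
  have lv' : 0 < la w v'.
    have : `|la w v - la w v'| <= nrm (w / d) * nrm (v' - v).
      rewrite -nrmM (le_trans _ (nrm_re _)) // -normrN /la -!(reD, reN).
      rewrite (_ : - _ = w / d * (v' - v)) //; ring.
    rewrite ler_norml => /andP[_ n3].
    have := nrm_ge0 (v' - v); nra.
  rewrite !H // opprD addrACA subrr add0r -(tri_half w u v v') //.
  by rewrite addrAC subrr add0r.
have [l0|l0] := ltP 0 (la w0 v).
  by apply: (key w0 v0 0) => // v' _ l; rewrite h0 // add0r.
have [l1|l1] := ltP 0 (la w1 v); first exact: (key w1 v1 G1).
have [l2|l2] := ltP 0 (la w2 v); first exact: (key w2 v2 G2).
have [l3|l3] := ltP 0 (la w3 v); first exact: (key w3 v3 G3).
have va : v - a = 0.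
  have : (v - a) / d = 0.
    move: l0 l1 l2 l3; rewrite /la /w0 /w1 /w2 /w3.
    have E (w : C) : w / d * (v - a) = w * ((v - a) / d) by rewrite mulrAC mulrA.
    rewrite !E; set z := (v - a) / d; rewrite !reimE => l0 l1 l2 l3.
    by apply: C_eq; rewrite !reimE; lra.
  by move/eqP; rewrite mulf_eq0 invr_eq0 (negbTE dn0) orbF => /eqP.
by case/negP: vS; move/eqP: va; rewrite subr_eq0 => /eqP ->.
Qed.

Lemma pot_local (x y : R) : exists2 e, 0 < e & pot_rect (x - e) (x + e) (y - e) (y + e).
Proof.
pose a : C := rc x + ii R * rc y.
have [e e0 [h H]] : exists2 e : R, 0 < e & exists h, locpot h (fun v => nrm (v - a) < e).
  have [aS|aS] := boolP (a \in S); [exact: pot_puncture|exact: pot_regular].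
exists (e / 2); first lra.
exists h; apply: locpot_sub H => v [vx vy].
apply: le_lt_trans (nrm_le_reim _) _; rewrite /a !reimE.
have : `|re v + - (x + (0 * y - 1 * 0))| < e / 2 by rewrite ltr_norml; lra.
have : `|im v + - (0 + (0 * 0 + 1 * y))| < e / 2 by rewrite ltr_norml; lra.
lra.
Qed.

(** Local potentials are glued vertically into narrow strips, and the strips
    horizontally in [pot_all_rect]. *)
Lemma pot_strip (x c d : R) : exists2 e, 0 < e & pot_rect (x - e) (x + e) c d.
Proof.
pose P (c d : R) := exists2 e, 0 < e & pot_rect (x - e) (x + e) c d.
have : P c d; last by [].
apply: (interval_induction (P := P)) => [a a' b b' aa bb [e e0 H]|a b c' d' ac cb bd [e e0 H] [e' e'0 H']|y].
- by exists e => //; apply: pot_rect_sub H.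
- exists (Num.min e e'); first by rewrite lt_min e0.
  set f := Num.min e e'; have f0 : 0 < f by rewrite lt_min e0.
  have fe : f <= e by rewrite ge_min lexx.
  have fe' : f <= e' by rewrite ge_min lexx orbT.
  apply: (@pot_glue _ (rect (x - f) (x + f) a b) (rect (x - f) (x + f) c' d')
     (x - f) (x + f) c' b) => //; rewrite ?/rect.
  + lra.
  + by move=> v [h1 h2]; have [h3|h3] := ltP (im v) b; [left|right]; split; lra.
  + by move=> v [h1 h2] [h3 h4]; split; lra.
  + by move=> v [h1 h2]; split; split; lra.
  + by move=> v; apply: rect_open.
  + by move=> v; apply: rect_open.
  + by apply: pot_rect_sub H; lra.
  + by apply: pot_rect_sub H'; lra.
- have [e e0 H] := pot_local x y; exists e => //; exists e => //.
Qed.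

Lemma pot_all_rect (x0 x1 y0 y1 : R) : pot_rect x0 x1 y0 y1.
Proof.
pose P (a b : R) := pot_rect a b y0 y1.
have : P x0 x1; last by [].
apply: (interval_induction (P := P)) => [a a' b b' aa bb H|a b c d ac cb bd H H'|x].
- exact: pot_rect_sub H.
- have [y01|y01] := ltP y0 y1; last first.
    by exists (fun=> 0) => v [h1 h2]; exfalso; lra.
  apply: (@pot_glue _ (rect a b y0 y1) (rect c d y0 y1) c b y0 y1) => //; rewrite ?/rect.
  + by move=> v [h1 h2]; have [h3|h3] := ltP (re v) b; [left|right]; split; lra.
  + by move=> v [h1 h2] [h3 h4]; split; lra.
  + by move=> v [h1 h2]; split; split; lra.
  + by move=> v; apply: rect_open.
  + by move=> v; apply: rect_open.
- exact: pot_strip.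
Qed.

(** The potentials on growing squares, normalized to vanish at a base point,
    extend each other. *)
Lemma pot_line : exists h, forall v v',
  (forall t : R, 0 <= t <= 1 -> lin v v' t \notin S) -> h v' - h v = g v v'.
Proof.
have [v0 _ v0S] := @exists_notS 0 1 0 1 ltr01 ltr01.
pose sq (M : R) := rect (- M) M (- M) M.
pose H M := sval (cid (pot_all_rect (- M) M (- M) M)).
have HP M : locpot (H M) (sq M) by rewrite /H; case: cid.
pose M0 := nrm v0 + 1.
have sqn M v : nrm v < M -> sq M v.
  move=> vM; have := nrm_re v; have := nrm_im v; rewrite !ler_norml => h1 h2.
  by split; lra.
pose h v := let M := nrm v + M0 in H M v - H M v0.
have hE M v : nrm v < M -> nrm v0 < M -> v \notin S -> h v = H M v - H M v0.
  move=> vM v0M vS; rewrite /h; set M1 := nrm v + M0.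
  have v0M1 : nrm v0 < M1 by rewrite /M1 /M0; have := nrm_ge0 v; lra.
  have vM1 : nrm v < M1 by rewrite /M1 /M0; have := nrm_ge0 v0; lra.
  pose m := Num.min M M1.
  have sub N : m <= N -> locpot (H N) (sq m).
    by move=> mN; apply: locpot_sub (HP N) => w [? ?]; split; lra.
  have E := @const_diff (H M1) (H M) (- m) m (- m) m v v0.
  have E' : H M1 v - H M v = H M1 v0 - H M v0.
    apply: E => //; try (by apply: sub; rewrite ge_min lexx ?orbT);
    by apply: sqn; rewrite lt_min ?v0M ?v0M1 ?vM ?vM1.
  by zmod_from E'.
exists h => v v' vv'.
pose M := nrm v0 + nrm v + nrm v' + 1.
have n0 := nrm_ge0 v0; have n1 := nrm_ge0 v; have n2 := nrm_ge0 v'.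
have vS : v \notin S by rewrite -[v](lin0 _ v') vv' ?lexx ?ler01.
have v'S : v' \notin S by rewrite -[v'](lin1 v) vv' ?lexx ?ler01.
have [m0 m1 m2] : [/\ nrm v0 < M, nrm v < M & nrm v' < M] by rewrite /M; split; lra.
rewrite !(hE M) //.
have HM := HP M.
have K : H M v' - H M v = g v v'; last by zmod_from K.
apply: (locpot_seg HM).
move=> t t01; split; last exact: vv'.
by apply: rect_convex => //; apply: sqn.
Qed.

End LinePotential.

(** * Matrices: changing single entries, and polynomial functions *)
Lemma fin_min (R : realType) (K : finType) (P : K -> R -> Prop) :
  (forall J (d d' : R), d' <= d -> P J d -> P J d') ->
  (forall J, exists2 d : R, 0 < d & P J d) -> exists2 d : R, 0 < d & forall J, P J d.
Proof.
move=> mono ex.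
suff [d d0 Hd] : exists2 d : R, 0 < d & forall J, J \in enum K -> P J d.
  by exists d => // J; apply: Hd; rewrite mem_enum.
elim: (enum K) => [|J s [d d0 Hd]]; first by exists 1.
have [e e0 He] := ex J; exists (Num.min d e); first by rewrite lt_min d0.
move=> I; rewrite inE => /orP[/eqP ->|Is].
  by apply: mono He; rewrite ge_min lexx orbT.
by apply: mono (Hd I Is); rewrite ge_min lexx.
Qed.

Section MatrixSpace.
Variables (R : realType) (n m : nat).
Local Notation C := (Cplx R).
Local Notation V := 'M[C]_(n, m).
Local Notation E := ('I_n * 'I_m)%type.
Implicit Types (x y z a b c : V) (e : E).

Definition near_mx (x y : V) (d : R) : Prop := forall i j, nrm (x i j - y i j) < d.

Definition crd x e : C := x e.1 e.2.
Definition upd x e (v : C) : V := \matrix_(i, j) (if (i, j) == e then v else x i j).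

Lemma near_refl x d : 0 < d -> near_mx x x d.
Proof. by move=> d0 i j; rewrite subrr nrm0. Qed.
Lemma near_le x y d d' : d <= d' -> near_mx x y d -> near_mx x y d'.
Proof. by move=> dd H i j; apply: lt_le_trans (H i j) dd. Qed.
Lemma near_trans y x z d d' : near_mx x y d -> near_mx y z d' -> near_mx x z (d + d').
Proof.
by move=> H H' i j; apply: le_lt_trans (nrm_distr _ (y i j) _) _; rewrite ltrD.
Qed.

Lemma crd_upd x e v : crd (upd x e v) e = v.
Proof. by rewrite /crd mxE -surjective_pairing eqxx. Qed.
Lemma crd_upd' x e e' v : e' != e -> crd (upd x e v) e' = crd x e'.
Proof. by move=> ee; rewrite /crd mxE -surjective_pairing (negbTE ee). Qed.
Lemma upd_crd x e : upd x e (crd x e) = x.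
Proof. by apply/matrixP => i j; rewrite mxE; case: eqP => // <-. Qed.
Lemma upd_upd x e v v' : upd (upd x e v) e v' = upd x e v'.
Proof. by apply/matrixP => i j; rewrite !mxE; case: eqP. Qed.
Lemma updC x e e' v v' : e != e' -> upd (upd x e v) e' v' = upd (upd x e' v') e v.
Proof.
move=> ee; apply/matrixP => i j; rewrite !mxE.
by case: eqP => // ->; rewrite eq_sym (negbTE ee).
Qed.
Lemma upd_near x y e v v' d : near_mx x y d -> nrm (v - v') < d ->
  near_mx (upd x e v) (upd y e v') d.
Proof. by move=> H h i j; rewrite !mxE; case: ifP. Qed.
Lemma upd_near_v x y e v d : 0 < d -> near_mx x y d -> near_mx (upd x e v) (upd y e v) d.
Proof. by move=> d0 H; apply: upd_near => //; rewrite subrr nrm0. Qed.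

(** Locking keeps unification from unfolding matrix expressions over the complex
    numbers. *)
Fact segment_key : unit. Proof. by []. Qed.
Fact triangle_key : unit. Proof. by []. Qed.
Definition linM x y (t : R) : V := locked_with segment_key (x + rc t *: (y - x)).
Definition triM x y z (s t : R) : V :=
  locked_with triangle_key (x + rc s *: (y - x) + rc t *: (z - x)).

Lemma linME x y t i j : linM x y t i j = lin (x i j) (y i j) t.
Proof. by rewrite /linM unlock !mxE. Qed.
Lemma triME x y z s t i j : triM x y z s t i j = tri_pt (x i j) (y i j) (z i j) s t.
Proof. by rewrite /triM unlock !mxE. Qed.
Lemma updE x e v i j : upd x e v i j = if (i, j) == e then v else x i j.
Proof. by rewrite mxE. Qed.
Lemma linM0 x y : linM x y 0 = x. Proof. by rewrite /linM unlock rc0 scale0r addr0. Qed.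
Lemma linM1 x y : linM x y 1 = y.
Proof. by rewrite /linM unlock rc1 scale1r addrC subrK. Qed.
Lemma linM_upd x e v v' t : linM (upd x e v) (upd x e v') t = upd x e (lin v v' t).
Proof.
by apply/matrixP => i j; rewrite linME !updE; case: eqP => // _; rewrite /lin subrr mulr0 addr0.
Qed.
Lemma triM_upd x e v v' v'' s t :
  triM (upd x e v) (upd x e v') (upd x e v'') s t = upd x e (tri_pt v v' v'' s t).
Proof.
apply/matrixP => i j; rewrite triME !updE; case: eqP => // _.
by rewrite /tri_pt subrr !mulr0 !addr0.
Qed.
Lemma upd_lin x y e v w t : upd (x + t *: y) e (v + t * w) = upd x e v + t *: upd y e w.
Proof. by apply/matrixP => i j; rewrite !mxE; case: eqP. Qed.

Lemma near_tri x a b c d s t : 0 <= s -> 0 <= t -> s + t <= 1 ->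
  near_mx a x d -> near_mx b x d -> near_mx c x d -> near_mx (triM a b c s t) x d.
Proof.
by move=> s0 t0 st h1 h2 h3 i j; rewrite triME; apply: nrm_convex.
Qed.

Lemma near_lin x a b (d t : R) : 0 <= t <= 1 ->
  near_mx a x d -> near_mx b x d -> near_mx (linM a b t) x d.
Proof.
move=> /andP[t0 t1] ax bx.
have -> : linM a b t = triM a b a t 0.
  by apply/matrixP => i j; rewrite linME triME /tri_pt rc0 mul0r addr0.
by apply: near_tri => //; rewrite addr0.
Qed.

Definition open_mx (O : V -> Prop) := forall x, O x ->
  exists2 d : R, 0 < d & forall y, near_mx y x d -> O y.

Definition cont01 (g : R -> V) := forall t : R, 0 <= t <= 1 -> forall e : R, 0 < e ->
  exists2 d : R, 0 < d & forall t' : R, 0 <= t' <= 1 -> `|t' - t| < d -> near_mx (g t') (g t) e.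

(** Compactness of the unit interval, in the form of a uniform neighbourhood of a
    path in an open set. *)
Lemma tube (O : V -> Prop) (g : R -> V) : open_mx O -> cont01 g ->
  (forall t : R, 0 <= t <= 1 -> O (g t)) ->
  exists2 d : R, 0 < d & forall t : R, 0 <= t <= 1 -> forall x, near_mx x (g t) d -> O x.
Proof.
move=> Oo gc gO.
pose P (a b : R) := exists2 d : R, 0 < d &
  forall t : R, 0 <= t <= 1 -> a < t < b -> forall x, near_mx x (g t) d -> O x.
have : P (-1) 2.
  apply: (interval_induction (P := P)) => [a a' b b' aa bb [d d0 H]|a b c d ac cb bd [e e0 He] [f f0 Hf]|t].
  - by exists d => // t t01 tab; apply: H => //; lra.
  - exists (Num.min e f); first by rewrite lt_min e0.
    move=> t t01 tad x xt; have [tb|bt] := ltP t b.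
      by apply: (He t t01); [lra|apply: near_le xt; rewrite ge_min lexx].
    by apply: (Hf t t01); [lra|apply: near_le xt; rewrite ge_min lexx orbT].
  - have [t01|t01] := boolP (0 <= t <= 1); last first.
      have [t0|t0] := ltP t 0.
        exists (- t); first lra.
        by exists 1 => // u u0 u1; exfalso; lra.
      have t1 : 1 < t by move: t01; rewrite t0 /= -ltNge.
      exists (t - 1); first lra.
      by exists 1 => // u u0 u1; exfalso; lra.
    have [d d0 Hd] := Oo _ (gO _ t01).
    have [f f0 Hf] := gc t t01 (d / 2) ltac:(lra).
    exists f => //; exists (d / 2); first lra.
    move=> u u01 utf x xu; apply: Hd.
    rewrite (_ : d = d / 2 + d / 2); last by field.
    by apply: near_trans xu _; apply: Hf => //; rewrite ltr_norml; lra.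
by case=> d d0 H; exists d => // t t01; apply: H => //; lra.
Qed.

Lemma cont01_lin x y : cont01 (linM x y).
Proof.
move=> t t01 e e0.
pose N := \sum_(k : E) nrm (crd y k - crd x k).
have N0 : 0 <= N by apply: sumr_ge0 => k _; apply: nrm_ge0.
exists (e / (N + 1)); first by rewrite divr_gt0 //; lra.
move=> t' t'01; rewrite ltr_pdivlMr; last lra.
move=> tt i j; rewrite !linME /lin.
rewrite (_ : _ - _ = rc (t' - t) * (y i j - x i j)); last by rewrite rcB; ring.
rewrite nrmM nrm_rc; apply: le_lt_trans tt; rewrite ler_wpM2l //.
have : nrm (y i j - x i j) <= N.
  rewrite /N (bigD1 (i, j)) //= /crd /= lerDl.
  by apply: sumr_ge0 => k _; apply: nrm_ge0.
lra.
Qed.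

(** Polynomiality on complex lines only: this is all that density arguments use,
    and it is stable under the operations below without any multivariate algebra. *)
Definition pol (g : V -> C) := forall a b, exists q : {poly C}, forall t, g (a + t *: b) = q.[t].

Lemma pol_mul g h : pol g -> pol h -> pol (fun x => g x * h x).
Proof.
move=> G H a b; have [q Hq] := G a b; have [r Hr] := H a b.
by exists (q * r) => t; rewrite hornerM Hq Hr.
Qed.
Lemma pol_sub g h : pol g -> pol h -> pol (fun x => g x - h x).
Proof.
move=> G H a b; have [q Hq] := G a b; have [r Hr] := H a b.
by exists (q - r) => t; rewrite hornerD hornerN Hq Hr.
Qed.
Lemma pol_upd g e v : pol g -> pol (fun x => g (upd x e v)).
Proof.
move=> G a b; have [q Hq] := G (upd a e v) (upd b e 0).
by exists q => t; rewrite -Hq -upd_lin mulr0 addr0.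
Qed.

Lemma poly_small_nonroot (q : {poly C}) (e : R) : q != 0 -> 0 < e ->
  exists2 t : C, nrm t < e & q.[t] != 0.
Proof.
move=> q0 e0; pose N := size q.
pose ts := [seq (rc (e / k.+2%:R) : C) | k <- iota 0 N].
have tsu : uniq ts.
  rewrite map_inj_uniq ?iota_uniq // => k l /rc_inj.
  move=> /(mulfI (lt0r_neq0 e0)) /invr_inj /eqP.
  by rewrite eqr_nat => /eqP [].
have [rts|] := boolP (all (root q) ts).
  by have := max_poly_roots q0 rts tsu; rewrite size_map size_iota ltnn.
move=> /allPn[t /mapP [k _ ->] rt]; exists (rc (e / k.+2%:R)) => //.
rewrite nrm_rc ger0_norm ?divr_ge0 ?(ltW e0) //.
by rewrite ltr_pdivrMr ?ltr0n // ltr_pMr // ltr1n.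
Qed.

(** On the line from x to a point y with g y != 0, the function g is a nonzero
    polynomial, so it is nonzero at points arbitrarily close to x. *)
Lemma pol_dense1 g x y (d : R) : pol g -> g y != 0 -> 0 < d ->
  exists2 x', near_mx x' x d & g x' != 0.
Proof.
move=> G gy d0.
have [r r0 Hr] : exists2 r : R, 0 < r & forall k : E, r * nrm (crd y k - crd x k) < d.
  apply: fin_min => [k a b ba H'|k].
    by apply: le_lt_trans H'; rewrite ler_wpM2r ?nrm_ge0.
  exists (d / (nrm (crd y k - crd x k) + 1)).
    by rewrite divr_gt0 // ltr_wpDl ?nrm_ge0.
  by rewrite mulrAC ltr_pdivrMr ?ltr_wpDl ?nrm_ge0 // ltr_pM2l // ltrDl.
have [q Hq] := G x (y - x).
have q0 : q != 0.
  apply: contraNneq gy => q0.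
  by rewrite -[y](subrK x) addrC -[y - x]scale1r Hq q0 horner0.
have [t tr qt] := poly_small_nonroot q0 r0.
exists (x + t *: (y - x)); last by rewrite Hq.
move=> i j; rewrite !mxE addrAC subrr add0r nrmM.
by apply: le_lt_trans (Hr (i, j)); rewrite ler_wpM2r ?nrm_ge0 // ltW.
Qed.

Lemma pol_mul_neq0 g h x y : pol g -> pol h -> g x != 0 -> h y != 0 ->
  exists z, g z * h z != 0.
Proof.
move=> G H gx hy; have [q Hq] := G x (y - x); have [r Hr] := H x (y - x).
have q0 : q != 0.
  by apply: contraNneq gx => q0; rewrite -[x]addr0 -(scale0r (y - x)) Hq q0 horner0.
have r0 : r != 0.
  apply: contraNneq hy => r0.
  by rewrite -[y](subrK x) addrC -[y - x]scale1r Hr r0 horner0.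
have [t _] := poly_small_nonroot (mulf_neq0 q0 r0) ltr01.
by rewrite hornerM => qrt; exists (x + t *: (y - x)); rewrite Hq Hr.
Qed.

(** Finitely many open conditions given by polynomials can be met simultaneously:
    multiply those that do not vanish identically. *)
Lemma pol_common (I : finType) (g : I -> V -> C) : (forall i, pol (g i)) ->
  exists h, [/\ pol h, exists y, h y != 0 &
    forall x, h x != 0 -> forall i, (exists y, g i y != 0) -> g i x != 0].
Proof.
move=> G.
suff [h [H1 H2 H3]] : exists h, [/\ pol h, exists y, h y != 0 &
    forall x, h x != 0 -> forall i, i \in enum I -> (exists y, g i y != 0) -> g i x != 0].
  by exists h; split=> // x hx i; apply: H3; rewrite ?mem_enum.
elim: (enum I) => [|i s [h [H1 [z hz] H3]]].
  exists (fun=> 1); split=> //; last by exists 0; apply: oner_neq0.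
  by move=> a b; exists 1 => t; rewrite hornerC.
have [[y gy]|ny] := pselect (exists y, g i y != 0); last first.
  exists h; split=> //; first by exists z.
  move=> x hx k; rewrite inE => /orP[/eqP -> //|]; exact: H3.
exists (fun x => g i x * h x); split; first exact: pol_mul.
  exact: pol_mul_neq0 gy hz.
move=> x; rewrite mulf_eq0 negb_or => /andP[gx hx] k.
by rewrite inE => /orP[/eqP -> //|]; apply: H3.
Qed.

Lemma pol_dense (I : finType) (g : I -> V -> C) x (d : R) : 0 < d -> (forall i, pol (g i)) ->
  exists2 x', near_mx x' x d & forall i, (exists y, g i y != 0) -> g i x' != 0.
Proof.
move=> d0 /pol_common [h [H1 [y hy] H3]].
have [x' x'x hx'] := pol_dense1 x H1 hy d0.
by exists x' => //; apply: H3.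
Qed.

End MatrixSpace.

(** * From line potentials to a global potential *)
Section Potential.
Variables (R : realType) (Q : zmodType) (n m : nat) (K : finType).
Local Notation C := (Cplx R).
Local Notation V := 'M[C]_(n, m).
Local Notation E := ('I_n * 'I_m)%type.
Variable f : K -> V -> C.
Implicit Types (x y z c : V) (e : E) (J I : K).

Definition Ucomp x : Prop := forall J, f J x != 0.
Local Notation U := Ucomp.
Definition icept J e x := f J (upd x e 0).
Definition slope J e x := f J (upd x e 1) - f J (upd x e 0).
(** The resultant of f J and f I as affine functions of the entry e: it vanishes
    at x if they have a common zero on the line through x. *)
Definition rslt J I e x := slope J e x * icept I e x - slope I e x * icept J e x.

Hypothesis f_cont : forall J x (eps : R), 0 < eps ->
  exists2 d : R, 0 < d & forall y, near_mx y x d -> nrm (f J y - f J x) < eps.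
Hypothesis f_aff : forall J x e v, f J (upd x e v) = icept J e x + v * slope J e x.
Hypothesis f_pol : forall J, pol (f J).

Lemma slope_upd J e x v : slope J e (upd x e v) = slope J e x.
Proof. by rewrite /slope !upd_upd. Qed.
Lemma f_crd J e x : f J x = icept J e x + crd x e * slope J e x.
Proof. by rewrite -f_aff upd_crd. Qed.
Lemma pol_slope J e : pol (slope J e).
Proof. by apply: pol_sub; apply: pol_upd. Qed.
Lemma pol_icept J e : pol (icept J e).
Proof. exact: pol_upd. Qed.
Lemma pol_rslt J I e : pol (rslt J I e).
Proof. by apply: pol_sub; apply: pol_mul; (apply: pol_slope || apply: pol_icept). Qed.

Lemma open_nz J : open_mx (fun x => f J x != 0).
Proof.
move=> x fx; have [|d d0 Hd] := @f_cont J x (nrm (f J x)); first by rewrite nrm_gt0.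
exists d => // y /Hd; apply: contraTneq => ->.
by rewrite sub0r nrmN ltxx.
Qed.

Lemma open_fam (P : pred K) : open_mx (fun x => forall J, P J -> f J x != 0).
Proof.
move=> x Ux.
suff [d d0 H] : exists2 d : R, 0 < d &
    forall J, forall y, near_mx y x d -> P J -> f J y != 0.
  by exists d => // y yx J; apply: H.
apply: fin_min => [J a b ba H y yx|J]; first by apply: H; apply: near_le yx.
have [PJ|PJ] := boolP (P J); last by exists 1.
by have [d d0 H] := open_nz (Ux J PJ); exists d => // y /H.
Qed.

Lemma open_U : open_mx U.
Proof.
move=> x Ux; have [|d d0 H] := @open_fam predT x; first by move=> J _; apply: Ux.
by exists d => // y /H {}H J; apply: H.
Qed.

(** w x y stands for the class of the segment from x to y. *)
Variable w : V -> V -> Q.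
Hypothesis w_tri : forall x y z,
  (forall s t : R, 0 <= s -> 0 <= t -> s + t <= 1 -> U (triM x y z s t)) ->
  w x y + w y z = w x z.

Lemma tube_seg x y : (forall t : R, 0 <= t <= 1 -> U (linM x y t)) ->
  exists2 d : R, 0 < d & forall t : R, 0 <= t <= 1 -> forall z, near_mx z (linM x y t) d -> U z.
Proof. by apply: tube; [exact: open_U|exact: cont01_lin]. Qed.

(** Moving both ends of a segment slightly adds the classes of the two short
    connecting segments: cut the quadrangle into two triangles. *)
Lemma quad x y : (forall t : R, 0 <= t <= 1 -> U (linM x y t)) ->
  exists2 d : R, 0 < d & forall x' y', near_mx x' x d -> near_mx y' y d ->
    w x y + w y y' = w x x' + w x' y' /\
    (forall t : R, 0 <= t <= 1 -> U (linM x' y' t)).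
Proof.
move=> /tube_seg [d d0 Hd]; exists d => // x' y' xx yy; split; last first.
  move=> t t01; refine (Hd t t01 _ _) => i j; rewrite !linME /lin.
  have := @nrm_convex R 0 (x' i j - x i j) (y' i j - y i j) 0 t 0 d.
  rewrite !subr0 rc0 mul0r addr0 => /(_ ltac:(lra) ltac:(lra) ltac:(lra)).
  rewrite nrm0 => /(_ (xx i j) (yy i j) d0).
  by congr (nrm _ < _); ring.
have T1 : w x y + w y y' = w x y'.
  apply: w_tri => s t s0 t0 st.
  have st1 : 0 <= s + t <= 1 by rewrite addr_ge0.
  refine (Hd _ st1 _ _) => i j; rewrite triME linME /lin /tri_pt.
  have := @nrm_convex R 0 0 0 (y' i j - y i j) s t d s0 t0 st.
  rewrite !subr0 nrm0 => /(_ d0 d0 (yy i j)).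
  by congr (nrm _ < _); rewrite rcD; ring.
have T2 : w x x' + w x' y' = w x y'.
  apply: w_tri => s t s0 t0 st.
  have t1 : 0 <= t <= 1 by rewrite t0; lra.
  refine (Hd _ t1 _ _) => i j; rewrite triME linME /lin /tri_pt.
  have := @nrm_convex R 0 0 (x' i j - x i j) (y' i j - y i j) s t d s0 t0 st.
  rewrite !subr0 nrm0 => /(_ d0 (xx i j) (yy i j)).
  by congr (nrm _ < _); ring.
by rewrite T1 T2.
Qed.

Lemma line_punctures x e : U x -> exists S : seq C, forall v, (v \notin S) <-> U (upd x e v).
Proof.
move=> Ux; exists [seq - icept J e x / slope J e x | J <- enum K & slope J e x != 0] => v.
split=> [vS J|Uv].
  rewrite f_aff; have [p0|p0] := eqVneq (slope J e x) 0.
    by rewrite p0 mulr0 addr0; have := Ux J; rewrite (f_crd J e) p0 mulr0 addr0.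
  apply: contra vS => /eqP E; apply/mapP; exists J; first by rewrite mem_filter p0 mem_enum.
  by rewrite -(mulfK p0 v); congr (_ / _); apply/eqP; rewrite -addr_eq0 addrC E.
apply/negP => /mapP[J]; rewrite mem_filter => /andP[p0 _] vE.
by have := Uv J; rewrite f_aff vE divfK // subrr eqxx.
Qed.

(** The sum of w around the square with corners d i^k on the line of the entry e
    through z: a polygonal substitute for a small circle. *)
Definition diamond z e (d : C) : Q :=
  let p (u : C) := upd z e (crd z e + u) in
  w (p d) (p (d * ii R)) + w (p (d * ii R)) (p (- d)) + w (p (- d)) (p (- (d * ii R)))
  + w (p (- (d * ii R))) (p d).

Hypothesis mer : forall J e z, f J z = 0 -> slope J e z != 0 ->
  (forall I, I != J -> f I z != 0) -> forall eps : R, 0 < eps ->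
  exists2 d : C, 0 < nrm d < eps & diamond z e d = 0.
(** Two distinct hypersurfaces meet a generic line in different points. *)
Hypothesis gen_rslt : forall J I e, J != I -> (exists x, slope J e x != 0) ->
  exists x, rslt J I e x != 0.

Definition linepot (l : C -> V) (h : C -> Q) := forall v v',
  (forall t : R, 0 <= t <= 1 -> U (l (lin v v' t))) -> h v' - h v = w (l v) (l v').

Lemma away_puncture (S : seq C) (a : C) : exists2 r : R, 0 < r &
  forall v, nrm (v - a) < r -> v != a -> v \notin S.
Proof.
have [|r r0 H] := @away R [seq v <- S | v != a] a; first by rewrite mem_filter eqxx.
exists r => // v /H + va; apply: contra => vS.
by rewrite mem_filter va.
Qed.

Lemma linepot_of_diam x e (S : seq C) : (forall v, (v \notin S) <-> U (upd x e v)) ->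
  (forall a, a \in S -> forall r : R, 0 < r ->
     (forall v, nrm (v - a) < r -> v != a -> v \notin S) ->
     exists2 d : C, 0 < nrm d < r & diamond (upd x e a) e d = 0) ->
  exists h, linepot (upd x e) h.
Proof.
move=> HS D.
have [||h H] := @pot_line R Q S (fun v v' => w (upd x e v) (upd x e v')).
- move=> v1 v2 v3 H; apply: w_tri => s t s0 t0 st.
  by rewrite triM_upd; apply/HS/H.
- move=> a aS; have [r r0 Hr] := away_puncture S a.
  have [d dr Dd] := D a aS r r0 Hr.
  exists d, r; split=> //; move: Dd.
  by rewrite /diamond crd_upd !upd_upd.
exists h => v v' vv'; apply: H => t t01; exact/HS/vv'.
Qed.

Lemma linepot_generic x e : U x ->
  (forall J I, J != I -> slope J e x != 0 -> rslt J I e x != 0) ->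
  exists h, linepot (upd x e) h.
Proof.
move=> Ux G; have [S HS] := line_punctures e Ux.
apply: linepot_of_diam (HS) _ => a aS r r0 Hr.
have [J fJ] : exists J, f J (upd x e a) = 0.
  apply: contrapT => nJ; move/negP: aS; apply; apply/negP; apply/HS => J.
  by apply/eqP => fJ; apply: nJ; exists J.
have pJ : slope J e x != 0.
  apply: contraPneq fJ => pJ; rewrite f_aff pJ mulr0 addr0.
  by apply/eqP; have := Ux J; rewrite (f_crd J e) pJ mulr0 addr0.
apply: (mer (J := J)) => //; first by rewrite slope_upd.
move=> I IJ; apply: contraNneq (G J I _ pJ) => [fI|]; last by rewrite eq_sym.
have qJ : icept J e x = - (a * slope J e x) by apply/eqP; rewrite -addr_eq0 -f_aff fJ.
have qI : icept I e x = - (a * slope I e x) by apply/eqP; rewrite -addr_eq0 -f_aff fI.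
by rewrite /rslt qJ qI; apply/eqP; ring.
Qed.

Lemma generic_near x e (d : R) : 0 < d -> exists2 x', near_mx x' x d &
  forall J I, J != I -> slope J e x' != 0 -> rslt J I e x' != 0.
Proof.
move=> d0.
have [x' x'x H] := @pol_dense R n m (K * K)%type
  (fun JI => rslt JI.1 JI.2 e) x d d0 (fun JI => pol_rslt JI.1 JI.2 e).
exists x' => // J I JI pJ; apply: (H (J, I)); apply: gen_rslt => //.
by exists x'.
Qed.

(** On a special line several hypersurfaces may pass through one puncture. The
    square around it is then compared, side by side ([quad]), with its translate on
    a nearby generic line, where a potential exists and the sum is zero. *)
Lemma linepot_ex x e : U x -> exists h, linepot (upd x e) h.
Proof.
move=> Ux; have [S HS] := line_punctures e Ux.
apply: linepot_of_diam (HS) _ => a aS r r0 Hr.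
pose d : C := rc (r / 2).
have nd : nrm d = r / 2 by rewrite nrm_rc ger0_norm //; lra.
exists d; first by rewrite nd; lra.
have d_neq0 : d != 0 by rewrite -nrm_gt0 nd; lra.
pose p x' (u : C) := upd x' e (a + u).
(* the sides of the diamond stay in the punctured disc *)
have side (u : C) : nrm u = 1 -> exists2 k : R, 0 < k & forall x', near_mx x' x k ->
    w (p x (d * u)) (p x (d * (u * ii R))) + w (p x (d * (u * ii R))) (p x' (d * (u * ii R)))
    = w (p x (d * u)) (p x' (d * u)) + w (p x' (d * u)) (p x' (d * (u * ii R))) /\
    forall t : R, 0 <= t <= 1 -> U (upd x' e (lin (a + d * u) (a + d * (u * ii R)) t)).
  move=> u1.
  have u0 : u != 0 by rewrite -nrm_gt0 u1.
  have [|k k0 Hk] := @quad (p x (d * u)) (p x (d * (u * ii R))).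
    move=> t t01; rewrite /p linM_upd; apply/HS/Hr.
      have := @nrm_convex R a (a + d * u) (a + d * (u * ii R)) a t 0 r.
      rewrite rc0 mul0r !addr0 => H; refine (H _ _ _ _ _ _); rewrite ?subrr ?nrm0 //; try lra.
      - by rewrite addrAC subrr add0r nrmM u1 nd; lra.
      - by rewrite addrAC subrr add0r !nrmM u1 nd nrm_ii; lra.
    rewrite /lin -subr_eq0.
    have -> : a + d * u + rc t * (a + d * (u * ii R) - (a + d * u)) - a =
      d * u * ((1 - rc t) + rc t * ii R) by ring.
    rewrite !mulf_neq0 //; apply/eqP => E.
    have := congr1 (@re R) E; have := congr1 (@im R) E; rewrite !reimE; lra.
  exists k => // x' xx'.
  have [||E1 E2] := Hk (p x' (d * u)) (p x' (d * (u * ii R))).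
  - exact: upd_near_v.
  - exact: upd_near_v.
  by split=> // t /E2; rewrite /p linM_upd.
have ni : nrm (-1 : C) = 1 by rewrite nrmN nrm1.
have nii : nrm (- ii R) = 1 by rewrite nrmN nrm_ii.
have [k0 k00 K0] := side 1 (@nrm1 R).
have [k1 k10 K1] := side (ii R) (@nrm_ii R).
have [k2 k20 K2] := side (-1) ni.
have [k3 k30 K3] := side (- ii R) nii.
have [k4 k40 K4] := open_U Ux.
pose k := Num.min k0 (Num.min k1 (Num.min k2 (Num.min k3 k4))).
have kp : 0 < k by rewrite !lt_min k00 k10 k20 k30.
have [km0 km1 km2 km3 km4] : [/\ k <= k0, k <= k1, k <= k2, k <= k3 & k <= k4].
  by split; rewrite /k !ge_min lexx ?orbT.
have [x' x'x Gx'] := generic_near x e kp.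
have Ux' : U x' := K4 _ (near_le km4 x'x).
have [h H] := linepot_generic Ux' Gx'.
have [{}K0 K0'] := K0 x' (near_le km0 x'x).
have [{}K1 K1'] := K1 x' (near_le km1 x'x).
have [{}K2 K2'] := K2 x' (near_le km2 x'x).
have [{}K3 K3'] := K3 x' (near_le km3 x'x).
have e0 : d * 1 = d by rewrite mulr1.
have e1 : d * (1 * ii R) = d * ii R by rewrite mul1r.
have e2 : d * (ii R * ii R) = - d by rewrite ii2 mulrN1.
have e2' : d * -1 = - d by rewrite mulrN1.
have e3 : d * (-1 * ii R) = - (d * ii R) by rewrite mulN1r mulrN.
have e3' : d * - ii R = - (d * ii R) by rewrite mulrN.
have e4 : d * (- ii R * ii R) = d by rewrite mulNr ii2 opprK mulr1.
rewrite ?e0 ?e1 ?e2 ?e2' ?e3 ?e3' ?e4 in K0 K0' K1 K1' K2 K2' K3 K3'.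
move/H: K0' => K0'; move/H: K1' => K1'; move/H: K2' => K2'; move/H: K3' => K3'.
rewrite /diamond crd_upd !upd_upd -/(p x _).
rewrite /p in K0 K1 K2 K3 *.
have F1 := f_equal2 +%R (f_equal2 +%R K0 K1) (f_equal2 +%R K2 K3).
have F2 := f_equal2 +%R (f_equal2 +%R K0' K1') (f_equal2 +%R K2' K3').
zmod_from2 F1 (esym F2).
Qed.

Definition lpot (l : C -> V) : C -> Q :=
  if pselect (exists h, linepot l h) is left ex then sval (cid ex) else fun=> 0.

Lemma lpotP x e : U x -> linepot (upd x e) (lpot (upd x e)).
Proof.
move=> Ux; rewrite /lpot; case: pselect => [ex|[]]; last exact: linepot_ex.
by case: cid.
Qed.

(** The class of any path from x to [upd x e v] within the line of the entry e. *)
Definition trans x e v : Q := lpot (upd x e) v - lpot (upd x e) (crd x e).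

Lemma trans_same x e v v' : trans (upd x e v) e v' = trans x e v' - trans x e v.
Proof.
rewrite /trans crd_upd (_ : upd (upd x e v) e = upd x e); first by zmod.
by apply/funext => u; rewrite upd_upd.
Qed.

Lemma trans_self x e : trans x e (crd x e) = 0.
Proof. by rewrite /trans subrr. Qed.

Lemma trans_seg x e v v' : U x ->
  (forall t : R, 0 <= t <= 1 -> U (upd x e (lin v v' t))) ->
  trans x e v' - trans x e v = w (upd x e v) (upd x e v').
Proof. by move=> Ux H; rewrite -(lpotP Ux) // /trans; zmod. Qed.

(** Follow the path of [trans] x e v, which has two straight pieces, and shift it
    to x': each piece contributes a quadrangle. *)
Lemma trans_cont x e v : U x -> U (upd x e v) ->
  exists2 d : R, 0 < d & forall x', near_mx x' x d ->
    trans x' e v - trans x e v = w (upd x e v) (upd x' e v) - w x x'.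
Proof.
move=> Ux Uv; have [S HS] := line_punctures e Ux.
have xS : crd x e \notin S by apply/HS; rewrite upd_crd.
have vS : v \notin S by apply/HS.
have [p [_ s1 s2]] := detour xS vS ltr01.
have h1 (t : R) : 0 <= t <= 1 -> U (upd x e (lin (crd x e) p t)) by move=> t01; apply/HS/s1.
have h2 (t : R) : 0 <= t <= 1 -> U (upd x e (lin p v t)) by move=> t01; apply/HS/s2.
have [|d1 d10 H1] := @quad (upd x e (crd x e)) (upd x e p).
  by move=> t t01; rewrite linM_upd; apply: h1.
have [|d2 d20 H2] := @quad (upd x e p) (upd x e v).
  by move=> t t01; rewrite linM_upd; apply: h2.
have [d3 d30 H3] := open_U Ux.
exists (Num.min d1 (Num.min d2 d3)); first by rewrite !lt_min d10 d20.
move=> x' xx.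
have [n1 n2 n3] : [/\ near_mx x' x d1, near_mx x' x d2 & near_mx x' x d3].
  by split; apply: near_le xx; rewrite !ge_min lexx ?orbT.
have Ux' := H3 _ n3.
have [||E1 g1] := H1 (upd x' e (crd x' e)) (upd x' e p).
- by rewrite !upd_crd.
- exact: upd_near_v.
have [||E2 g2] := H2 (upd x' e p) (upd x' e v); try exact: upd_near_v.
have k1 := trans_seg Ux h1; have k2 := trans_seg Ux h2.
have k1' : trans x' e p - trans x' e (crd x' e) = w (upd x' e (crd x' e)) (upd x' e p).
  by apply: trans_seg => // t t01; rewrite -linM_upd; apply: g1.
have k2' : trans x' e v - trans x' e p = w (upd x' e p) (upd x' e v).
  by apply: trans_seg => // t t01; rewrite -linM_upd; apply: g2.
rewrite !trans_self !upd_crd in k1 k1' E1.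
have F1 := f_equal2 +%R (esym E1) (esym E2).
have F2 := f_equal2 +%R (f_equal2 +%R k1' k2') (f_equal2 +%R (esym k1) (esym k2)).
zmod_from2 F1 F2.
Qed.

(** Transporting along e and e' commutes. The difference of the two ways round
    the rectangle, as a function of the value u of the entry e', is locally
    constant by [trans_cont] and vanishes for the initial value; the set of
    admissible u, a line minus finitely many points, is connected. *)
Lemma trans_square x e e' v v' : e != e' -> U x -> U (upd x e v) -> U (upd x e' v') ->
  U (upd (upd x e v) e' v') ->
  trans x e v + trans (upd x e v) e' v' = trans x e' v' + trans (upd x e' v') e v.
Proof.
move=> ee Ux U1 U2 U12; set x1 := upd x e v in U1 U12 *.
have [S1 HS1] := line_punctures e' Ux; have [S2 HS2] := line_punctures e' U1.
pose S := S1 ++ S2.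
have HS u : u \notin S <-> U (upd x e' u) /\ U (upd x1 e' u).
  by rewrite mem_cat negb_or; split=> [/andP[/HS1 ? /HS2 ?]//|[/HS1 -> /HS2]].
pose Th u := trans x e' u - trans x1 e' u + trans (upd x e' u) e v.
have step a b : (forall t : R, 0 <= t <= 1 -> lin a b t \notin S) -> Th b = Th a.
  move=> ab; rewrite -[in LHS](lin1 a b) -[in RHS](lin0 a b).
  apply: (@loc_const _ _ (fun t => Th (lin a b t))) => t t01.
  set u := lin a b t; have uS : u \notin S := ab t t01.
  have [Uu Uu1] := (HS u).1 uS.
  have [|d d0 Hd] := @trans_cont (upd x e' u) e v Uu; first by rewrite updC // eq_sym.
  have [r r0 Hr] := away uS.
  have m0 : 0 < Num.min d r by rewrite lt_min d0.
  have n0 : 0 < nrm (b - a) + 1 by rewrite ltr_wpDl ?nrm_ge0.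
  exists (Num.min d r / (nrm (b - a) + 1)); first by rewrite divr_gt0.
  move=> t' t'01; rewrite ltr_pdivlMr // => tt; set u' := lin a b t'.
  have uu : nrm (u' - u) < Num.min d r.
    rewrite /u /u' /lin (_ : _ - _ = rc (t' - t) * (b - a)); last by rewrite rcB; ring.
    rewrite nrmM nrm_rc; apply: le_lt_trans tt.
    by rewrite ler_wpM2l // lerDl.
  move: uu; rewrite lt_min => /andP[ud ur].
  have seg (s : R) : 0 <= s <= 1 -> lin u u' s \notin S.
    move=> s01; apply: Hr; rewrite /lin addrAC subrr add0r nrmM nrm_rc.
    apply: le_lt_trans ur; rewrite ler_piMl ?nrm_ge0 // ger0_norm; lra.
  have k1 := trans_seg Ux (fun s s01 => ((HS _).1 (seg s s01)).1).
  have k2 := trans_seg U1 (fun s s01 => ((HS _).1 (seg s s01)).2).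
  have k3 := Hd (upd x e' u') (upd_near _ (near_refl _ d0) ud).
  rewrite ![upd (upd x e' _) e v]updC 1?eq_sym // -/x1 in k3.
  have F := f_equal2 +%R k1 k3.
  change (Th u' = Th u); rewrite /Th.
  by zmod_from2 F (esym k2).
have aS : crd x e' \notin S.
  apply/HS; rewrite upd_crd; split=> //.
  by rewrite -(@crd_upd' _ _ _ x e e' v) ?upd_crd // eq_sym.
have bS : v' \notin S by apply/HS.
have [p [_ s1 s2]] := detour aS bS ltr01.
have E : Th v' = Th (crd x e') by rewrite (step p) // (step (crd x e')).
have E0 : trans x1 e' (crd x e') = 0.
  by rewrite -(@crd_upd' _ _ _ x e e' v) ?trans_self // eq_sym.
rewrite /Th upd_crd trans_self E0 in E.
by zmod_from (esym E).
Qed.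

(* e0 is only a default value for nth *)
Variable e0 : E.
Local Notation es := (enum {: E}).
Local Notation N := (size (enum {: E})).
Definition ek (k : nat) : E := nth e0 es k.
(** The intermediate steps of the passage from x to c, one entry at a time in a
    fixed order of the entries. *)
Definition mix (k : nat) x c : V :=
  \matrix_(i, j) (if (index (i, j) es < k)%N then c i j else x i j).

Lemma mixE k x c i j : mix k x c i j = if (index (i, j) es < k)%N then c i j else x i j.
Proof. by rewrite mxE. Qed.
Lemma mix0 x c : mix 0 x c = x.
Proof. by apply/matrixP => i j; rewrite mixE. Qed.
Lemma mixN x c : mix N x c = c.
Proof. by apply/matrixP => i j; rewrite mixE index_mem mem_enum. Qed.
Lemma mix_id k x : mix k x x = x.
Proof. by apply/matrixP => i j; rewrite mixE if_same. Qed.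
Lemma mixS k x c : (k < N)%N -> mix k.+1 x c = upd (mix k x c) (ek k) (crd c (ek k)).
Proof.
move=> kN; apply/matrixP => i j; rewrite updE !mixE ltnS leq_eqVlt.
have -> : (index (i, j) es == k) = ((i, j) == ek k).
  apply/eqP/eqP => [<-|->]; first by rewrite /ek nth_index // mem_enum.
  by rewrite /ek index_uniq // enum_uniq.
by case: eqP => //= E; rewrite -E.
Qed.
Lemma mix_upd k x c e v : mix k (upd x e v) c =
  if (k <= index e es)%N then upd (mix k x c) e v else mix k x c.
Proof.
apply/matrixP => i j; case: leqP => ke; rewrite ?updE !mixE updE.
  by case: eqP => // ->; rewrite ltnNge ke.
by case: eqP => // ->; rewrite ke.
Qed.
Lemma mix_near k x y z d : near_mx x z d -> near_mx y z d -> near_mx (mix k x y) z d.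
Proof. by move=> h1 h2 i j; rewrite mixE; case: ifP. Qed.
Lemma pol_mixr g k x : pol g -> pol (fun c : V => g (mix k x c)).
Proof.
move=> G a b; have [q Hq] := G (mix k x a) (mix k 0 b); exists q => t.
rewrite -Hq; congr g; apply/matrixP => i j; rewrite [RHS]mxE [X in _ = _ + X]mxE !mixE.
by case: ifP; rewrite !mxE ?mulr0 ?addr0.
Qed.
Lemma pol_mixl g k c : pol g -> pol (fun x : V => g (mix k x c)).
Proof.
move=> G a b; have [q Hq] := G (mix k a c) (mix k b 0); exists q => t.
rewrite -Hq; congr g; apply/matrixP => i j; rewrite [RHS]mxE [X in _ = _ + X]mxE !mixE.
by case: ifP; rewrite !mxE ?mulr0 ?addr0.
Qed.

Definition generic_pair x c := forall k : 'I_N.+1, U (mix k x c).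

Lemma gpU x c : generic_pair x c -> U x.
Proof. by move=> /(_ ord0); rewrite mix0. Qed.

(** All steps of finitely many passages are nonzero polynomial conditions on the
    intermediate target c, since they hold for c = p.1. *)
Lemma generic_pairs (s : seq (V * V)) : (forall p, p \in s -> generic_pair p.1 p.2) ->
  exists c, forall p, p \in s -> forall k : 'I_N.+1, generic_pair (mix k p.1 c) p.2.
Proof.
move=> H.
pose I := ('I_(size s) * 'I_N.+1 * 'I_N.+1 * K)%type.
pose g (i : I) c := let p := nth (0, 0) s i.1.1.1 in f i.2 (mix i.1.1.2 (mix i.1.2 p.1 c) p.2).
have [|c _ Hc] := @pol_dense R n m I g 0 1 ltr01.
  by move=> [[[a b] d] J]; apply: (pol_mixr (g := fun y => f J (mix _ y _))); apply: pol_mixl.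
exists c => p ps k l J.
have ip : (index p s < size s)%N by rewrite index_mem.
have := Hc (Ordinal ip, l, k, J); rewrite /g /= nth_index //; apply.
by exists p.1; rewrite mix_id; apply: H.
Qed.

Lemma generic_ex (xs : seq V) : (forall x, x \in xs -> U x) ->
  exists c, forall x, x \in xs -> generic_pair x c.
Proof.
move=> H; have [|c Hc] := @generic_pairs [seq (x, x) | x <- xs].
  by move=> _ /mapP[x xs1 ->] k /=; rewrite mix_id; apply: H.
exists c => x xxs k.
by have := Hc (x, x) (map_f _ xxs) k ord0; rewrite mix0.
Qed.

Definition ptrans x c : Q := \sum_(k < N) trans (mix k x c) (ek k) (crd c (ek k)).

(** The ladder between the passages from x and from [upd x e v] to c: each rung
    changes e, each cell is a commuting square, and the ladder closes up when the
    entry e itself is changed. *)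
Lemma ptrans_step x e v c : generic_pair x c -> generic_pair (upd x e v) c ->
  ptrans x c - ptrans (upd x e v) c = trans x e v.
Proof.
move=> gx gy; set y := upd x e v in gy *.
pose j := index e es.
have jN : (j < N)%N by rewrite index_mem mem_enum.
pose D k := if (k <= j)%N then trans (mix k x c) e v else 0.
rewrite /ptrans -sumrB.
have -> : trans x e v = - (D N - D 0).
  by rewrite /D leqNgt jN mix0 /=; zmod.
rewrite -telescope_sumr // -sumrN big_mkord; apply: eq_bigr => k _.
have kN := ltn_ord k.
have gxk : U (mix k x c) := gx (widen_ord (leqnSn N) k).
have gyk : U (mix k y c) := gy (widen_ord (leqnSn N) k).
have gxS : U (mix k.+1 x c) := gx (lift ord0 k).
have gyS : U (mix k.+1 y c) := gy (lift ord0 k).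
rewrite /D mix_upd -/j in gyk *; rewrite (mixS _ _ kN) mix_upd -/j in gyS.
rewrite (mixS _ _ kN) in gxS *.
case: (ltngtP k j) => kj.
- rewrite (ltnW kj) in gyk gyS *.
  have ne : e != ek k.
    by apply/eqP => ee; move: kj; rewrite /j ee /ek index_uniq ?enum_uniq // ltnn.
  have := trans_square ne gxk gyk gxS gyS => E.
  by zmod_from (esym E).
- by zmod.
- have ee : ek j = e by rewrite /ek nth_index // mem_enum.
  by rewrite kj ?leqnn ?ltnn /= ee trans_same; zmod.
Qed.

(** By [ptrans_step] the difference is unchanged when x changes in one entry, hence
    along a whole passage from x to c''. *)
Lemma ptrans_chain x c c' c'' :
  (forall k : 'I_N.+1, generic_pair (mix k x c'') c) ->
  (forall k : 'I_N.+1, generic_pair (mix k x c'') c') ->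
  ptrans x c - ptrans x c' = ptrans c'' c - ptrans c'' c'.
Proof.
move=> H H'; rewrite -[in LHS](mix0 x c'') -[in RHS](mixN x c'').
have : (N <= N)%N by [].
elim: {-2}N => // k IH kN; rewrite IH; last exact: ltnW.
have g0 : generic_pair (mix k x c'') c := H (widen_ord (leqnSn N) (Ordinal kN)).
have g1 : generic_pair (mix k.+1 x c'') c := H (lift ord0 (Ordinal kN)).
have g0' : generic_pair (mix k x c'') c' := H' (widen_ord (leqnSn N) (Ordinal kN)).
have g1' : generic_pair (mix k.+1 x c'') c' := H' (lift ord0 (Ordinal kN)).
rewrite (mixS _ _ kN) in g1 g1' *.
have E := ptrans_step g0 g1; have E' := ptrans_step g0' g1'.
rewrite -E' in E; by zmod_from E.
Qed.

Lemma ptrans_indep x y c c' : generic_pair x c -> generic_pair x c' ->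
  generic_pair y c -> generic_pair y c' ->
  ptrans x c - ptrans x c' = ptrans y c - ptrans y c'.
Proof.
move=> xc xc' yc yc'.
have [|c'' H] := @generic_pairs [:: (x, c); (x, c'); (y, c); (y, c')].
  by move=> p; rewrite !inE => /or4P[] /eqP ->.
have h1 := H (x, c); have h2 := H (x, c'); have h3 := H (y, c); have h4 := H (y, c').
rewrite !inE !eqxx ?orbT /= in h1 h2 h3 h4.
by rewrite (ptrans_chain (h1 _) (h2 _)) // (ptrans_chain (h3 _) (h4 _)).
Qed.

(** H is minus the transport from x to a generic c, normalized so as not to depend
    on c. Near x, a segment is replaced by the polygon that changes one entry at a
    time within a box. *)
Lemma global_potential : exists H : V -> Q, forall x, U x ->
  exists2 d : R, 0 < d & forall y y', near_mx y x d -> near_mx y' x d -> H y' - H y = w y y'.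
Proof.
have [[x0 Ux0]|nU] := pselect (exists x, U x); last first.
  by exists (fun=> 0) => x Ux; case: nU; exists x.
have exc x : exists c, U x -> generic_pair x c /\ generic_pair x0 c.
  have [Ux|nUx] := pselect (U x); last by exists 0.
  have [|c Hc] := @generic_ex [:: x; x0].
    by move=> y; rewrite !inE => /orP[] /eqP ->.
  by exists c => _; split; apply: Hc; rewrite !inE eqxx ?orbT.
have [cc Hcc] := choice exc.
pose H x := ptrans x0 (cc x) - ptrans x (cc x).
have HE x c : generic_pair x c -> generic_pair x0 c -> H x = ptrans x0 c - ptrans x c.
  move=> xc x0c; have [h1 h2] := Hcc x (gpU xc).
  by have E := ptrans_indep h1 xc h2 x0c; rewrite /H; zmod_from (esym E).
have Hstep x e v : U x -> U (upd x e v) -> H (upd x e v) - H x = trans x e v.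
  move=> Ux Uy; have [|c Hc] := @generic_ex [:: x; upd x e v; x0].
    by move=> y; rewrite !inE => /or3P[] /eqP ->.
  have h1 := Hc x; have h2 := Hc (upd x e v); have h3 := Hc x0.
  rewrite !inE !eqxx ?orbT /= in h1 h2 h3.
  have E := ptrans_step (h1 isT) (h2 isT).
  rewrite !(HE _ c) ?(h1 isT) ?(h2 isT) ?(h3 isT); [|exact: h1|exact: h3|exact: h2|exact: h3].
  by zmod_from E.
exists H => x Ux; have [d d0 Hd] := open_U Ux; exists d => // y y' yx y'x.
have tri_in a b c : near_mx a x d -> near_mx b x d -> near_mx c x d ->
    w a b + w b c = w a c.
  by move=> ha hb hc; apply: w_tri => s t s0 t0 st; apply: Hd; apply: near_tri.
suff : H (mix N y y') - H y = w y (mix N y y') by rewrite mixN.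
have : (N <= N)%N by [].
elim: {-2}N => [_|k IH kN].
  rewrite mix0; have E := tri_in _ _ _ yx yx yx; zmod_from (esym E).
have n1 : near_mx (mix k y y') x d by apply: mix_near.
have n2 : near_mx (mix k.+1 y y') x d by apply: mix_near.
have E1 := tri_in _ _ _ yx n1 n2.
have E2 := IH (ltnW kN).
have U1 := Hd _ n1; have U2 := Hd _ n2.
have E3 : H (mix k.+1 y y') - H (mix k y y') = w (mix k y y') (mix k.+1 y y').
  rewrite (mixS _ _ kN) in U2 n2 *; rewrite Hstep //.
  have := @trans_seg (mix k y y') (ek k) (crd (mix k y y') (ek k)) (crd y' (ek k)) U1.
  rewrite trans_self subr0 upd_crd; apply => t t01.
  apply: Hd; rewrite -linM_upd upd_crd => i j.
  rewrite linME.
  have := @nrm_convex R (x i j) (mix k y y' i j) (upd (mix k y y') (ek k) (crd y' (ek k)) i j)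
    (mix k y y' i j) t 0 d.
  rewrite rc0 mul0r !addr0 => K1; apply: K1 => //; first [exact: n1|exact: n2|lra].
have F := f_equal2 +%R E2 E3.
by zmod_from2 F E1.
Qed.
End Potential.

(** * Continuity of complex and matrix valued maps *)
Section Continuity.
Variables (R : realType).
Local Notation C := (Cplx R).

Lemma cvg_nrm (T : Type) (F : set_system T) (FF : Filter F) (g : T -> C) (l : C) :
  (g @ F --> l) <-> (forall e : R, 0 < e -> \forall t \near F, nrm (g t - l) < e).
Proof.
split=> [/cvgrPdist_lt H e e0|H].
  have e0' : 0 < rc e by rewrite -[_ < _]/(ltc _ _) /ltc /= eqxx.
  by apply: filterS (H (rc e) e0') => t; rewrite distrC nrm_ltE.
apply/cvgrPdist_lt => e e0.
have eE : e = rc (re e).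
  by apply: C_eq => //; rewrite im_rc; move: e0; rewrite ltcE => /andP[/eqP].
have re0 : 0 < re e by move: e0; rewrite ltcE => /andP[].
apply: filterS (H _ re0) => t; by rewrite eE distrC nrm_ltE.
Qed.

Lemma contC_nrm (T : topologicalType) (g : T -> C) : continuous g <->
  forall t (e : R), 0 < e -> \forall t' \near t, nrm (g t' - g t) < e.
Proof.
split=> [H t|H t]; first by apply/cvg_nrm; exact: H.
apply/cvg_nrm; exact: H.
Qed.

Lemma cont_rc : continuous (@rc R).
Proof.
apply/contC_nrm => t e e0; near=> t'; rewrite -rcB nrm_rc distrC.
near: t'; exact: (@cvgr_dist_lt _ _ _ _ _ id t cvg_id).
Unshelve. all: by end_near. Qed.

Section Comb.
Variable T : topologicalType.
Implicit Types g h : T -> C.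
Lemma contCc (c : C) : continuous (fun _ : T => c). Proof. by move=> t; apply: cvg_cst. Qed.
Lemma contCD g h : continuous g -> continuous h -> continuous (fun t => g t + h t).
Proof. by move=> G H t; apply: cvgD; [exact: G|exact: H]. Qed.
Lemma contCN g : continuous g -> continuous (fun t => - g t).
Proof. by move=> G t; apply: cvgN; exact: G. Qed.
Lemma contCB g h : continuous g -> continuous h -> continuous (fun t => g t - h t).
Proof. by move=> G H t; apply: cvgB; [exact: G|exact: H]. Qed.
Lemma contCM g h : continuous g -> continuous h -> continuous (fun t => g t * h t).
Proof. by move=> G H t; apply: cvgM; [exact: G|exact: H]. Qed.
Lemma contCV g : (forall t, g t != 0) -> continuous g -> continuous (fun t => (g t)^-1).
Proof. by move=> g0 G t; apply: cvgV => //; exact: G. Qed.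
Lemma contC_rc (h : T -> R) : continuous h -> continuous (fun t => rc (h t)).
Proof. by move=> H t; apply: continuous_comp; [exact: H|exact: cont_rc]. Qed.
Lemma contC_complex (a b : T -> R) : continuous a -> continuous b ->
  continuous (fun t => (a t +i* b t)%C : C).
Proof.
move=> A B; rewrite (_ : (fun _ => _) = fun t => rc (a t) + ii R * rc (b t)).
  by apply: contCD; [|apply: contCM; [exact: contCc|]]; exact: contC_rc.
by apply/funext => t; apply: C_eq; rewrite !reimE /re /im /=; ring.
Qed.
End Comb.

(** The retraction of the line onto the unit interval: it makes paths total
    functions of a real variable, continuous everywhere. *)
Definition clamp (t : R) : R := Num.max 0 (Num.min t 1).
Lemma clamp01 t : 0 <= clamp t <= 1.
Proof. by rewrite /clamp le_max lexx /= ge_max ler01 ge_min lexx orbT. Qed.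
Lemma clamp_id t : 0 <= t <= 1 -> clamp t = t.
Proof. by move=> /andP[t0 t1]; rewrite /clamp min_l // max_r. Qed.
Lemma cont_clamp : continuous clamp.
Proof.
move=> t; apply: (@continuous_max R R (fun=> 0) (fun u => Num.min u 1) t); first exact: cvg_cst.
by apply: (@continuous_min R R id (fun=> 1) t); [exact: cvg_id|exact: cvg_cst].
Qed.

Lemma cont_comp (T T' T'' : topologicalType) (g : T -> T') (h : T' -> T'') :
  continuous g -> continuous h -> continuous (fun t => h (g t)).
Proof. by move=> G H t; apply: continuous_comp; [exact: G|exact: H]. Qed.

Lemma cont_clamp_fst : continuous (fun p : R * R => clamp p.1).
Proof. by apply: (@cont_comp _ _ _ fst); [move=> p; exact: cvg_fst|exact: cont_clamp]. Qed.
Lemma cont_clamp_snd : continuous (fun p : R * R => clamp p.2).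
Proof. by apply: (@cont_comp _ _ _ snd); [move=> p; exact: cvg_snd|exact: cont_clamp]. Qed.
Lemma cont_circle : continuous (@circle R).
Proof.
have c2 : continuous (fun u : R => 2 * pi * u : R).
  by move=> u; apply: cvgM; [exact: cvg_cst|exact: cvg_id].
by apply: contC_complex; apply: (cont_comp c2); [exact: continuous_cos|exact: continuous_sin].
Qed.

Lemma nrm_circle u : nrm (circle u : C) = 1.
Proof. by rewrite /nrm /= cos2Dsin2 sqrtr1. Qed.
Lemma circle_neq0 u : circle u != 0 :> C.
Proof. by rewrite -nrm_gt0 nrm_circle. Qed.
Lemma circle0 : circle 0 = 1 :> C.
Proof. by apply: C_eq; rewrite /re /im /= mulr0 ?cos0 ?sin0. Qed.
Lemma circleD u v : circle (u + v) = circle u * circle v :> C.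
Proof.
by apply: C_eq; rewrite !reimE /re /im /= mulrDr ?cosD ?sinD // addrC.
Qed.
Lemma circle_quarter : circle 4^-1 = ii R.
Proof.
have E : 2 * pi * 4^-1 = pi / 2 :> R by field.
by apply: C_eq; rewrite /re /im /= E ?cos_pihalf ?sin_pihalf.
Qed.
Lemma circle_half : circle (1/2) = -1 :> C.
Proof. by rewrite (_ : 1 / 2 = 4^-1 + 4^-1) ?circleD ?circle_quarter ?ii2 //; field. Qed.
Lemma circle_3quarter : circle (3/4) = - ii R :> C.
Proof.
rewrite (_ : 3 / 4 = 1 / 2 + 4^-1); last by field.
by rewrite circleD circle_half circle_quarter mulN1r.
Qed.
Lemma circle1 : circle 1 = 1 :> C.
Proof.
rewrite [in LHS](_ : 1 = 1 / 2 + 1 / 2 :> R); last by field.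
by rewrite circleD circle_half mulrNN mulr1.
Qed.
(** This keeps the straight homotopy from a quarter circle to its chord away
    from 0. *)
Lemma circle_first_quadrant (u : R) : 0 <= u <= 1 -> 0 < re (circle (u / 4)) + im (circle (u / 4)).
Proof.
move=> u01; rewrite /re /im /=.
have p0 : 0 < pi :> R := pi_gt0 R.
have E : 2 * pi * (u / 4) = pi * u / 2 by field.
rewrite E.
have h1 : 0 <= pi * u / 2 by rewrite divr_ge0 // mulr_ge0; lra.
have h2 : pi * u / 2 <= pi / 2 by have : 0 <= pi * (1 - u) :> R; [rewrite mulr_ge0; lra|lra].
have c0 : 0 <= cos (pi * u / 2) by apply: cos_ge0_pihalf; lra.
have s0 : 0 <= sin (pi * u / 2) by apply: sin_ge0_pi; lra.
rewrite lt_neqAle addr_ge0 // andbT eq_sym paddr_eq0 //.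
apply/negP => /andP[/eqP c /eqP s]; have := cos2Dsin2 (pi * u / 2).
by rewrite c s expr0n addr0 => /eqP; rewrite eq_sym oner_eq0.
Qed.

End Continuity.

Section MatrixContinuity.
Variables (R : realType) (n m : nat).
Local Notation C := (Cplx R).
Local Notation V := 'M[C]_(n, m).
Local Notation E := ('I_n * 'I_m)%type.

Definition contM (T : topologicalType) (g : T -> V) := forall i j, continuous (fun t => g t i j).

Lemma contM_near (T : topologicalType) (g : T -> V) : contM g ->
  forall t (e : R), 0 < e -> \forall t' \near t, near_mx (g t') (g t) e.
Proof.
move=> G t e e0.
have : \forall t' \near t, forall k : E, nrm (g t' k.1 k.2 - g t k.1 k.2) < e.
  by apply: filter_forall => k; apply: ((contC_nrm _).1 (G k.1 k.2)).
by apply: filterS => t' H i j; exact: (H (i, j)).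
Qed.

Definition contF (g : V -> C) := forall x (e : R), 0 < e ->
  exists2 d : R, 0 < d & forall y, near_mx y x d -> nrm (g y - g x) < e.

Lemma contF_comp (T : topologicalType) (g : V -> C) (y : T -> V) :
  contF g -> contM y -> continuous (fun t => g (y t)).
Proof.
move=> G Y; apply/contC_nrm => t e e0; have [d d0 Hd] := G (y t) e e0.
by apply: filterS (contM_near Y t d0) => t'; apply: Hd.
Qed.

Lemma contM_cont01 (g : R -> V) : contM g -> cont01 g.
Proof.
move=> G t t01 e e0; have := contM_near G t e0.
move=> /nbhs_ballP [d d0 H]; exists d => // t' _ tt; apply: H.
by rewrite /ball /= distrC.
Qed.

Lemma contM_upd (T : topologicalType) (g : T -> V) (e : E) (v : T -> C) :
  contM g -> continuous v -> contM (fun t => upd (g t) e (v t)).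
Proof.
move=> G H i j; rewrite (_ : (fun _ => _) = fun t => if (i, j) == e then v t else g t i j).
  by case: eqP => _; [exact: H|exact: G].
by apply/funext => t; rewrite updE.
Qed.

Lemma contM_crd (T : topologicalType) (g : T -> V) (e : E) :
  contM g -> continuous (fun t => crd (g t) e).
Proof. by move=> G; exact: G. Qed.

Lemma contM_linM (T : topologicalType) (g h : T -> V) (s : T -> R) :
  contM g -> contM h -> continuous s -> contM (fun t => linM (g t) (h t) (s t)).
Proof.
move=> G H S i j; rewrite (_ : (fun _ => _) = fun t => g t i j + rc (s t) * (h t i j - g t i j)).
  by apply: contCD; [exact: G|apply: contCM; [exact: contC_rc|apply: contCB; [exact: H|exact: G]]].
by apply/funext => t; rewrite linME.
Qed.

Lemma contM_comp (T T' : topologicalType) (g : T' -> V) (h : T -> T') :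
  contM g -> continuous h -> contM (fun t => g (h t)).
Proof. by move=> G H i j; exact: (cont_comp H (G i j)). Qed.

Lemma contM_cst (T : topologicalType) (x : V) : contM (fun _ : T => x).
Proof. by move=> i j; exact: contCc. Qed.

End MatrixContinuity.

(** * Homotopy invariance, and classes of small circles *)
Section ClassFunction.
Variables (R : realType) (Q : zmodType) (n m : nat) (K : finType).
Local Notation C := (Cplx R).
Local Notation V := 'M[C]_(n, m).
Variable f : K -> V -> C.
Local Notation U := (Ucomp f).
Implicit Types (x y z : V) (e : 'I_n * 'I_m) (J I : K).

Hypothesis f_cont : forall J, contF (f J).
Hypothesis f_aff : forall J x e v, f J (upd x e v) = icept f J e x + v * slope f J e x.
Hypothesis f_pol : forall J, pol (f J).

Definition seg2 (a b : R * R) (t : R) : R * R :=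
  (a.1 + t * (b.1 - a.1), a.2 + t * (b.2 - a.2)).

Variable cls : (R -> V) -> Q.
(** cls is the class of a path parametrized by the unit interval; it is additive
    on the three sides of a continuous triangle in U. *)
Hypothesis cls_ext : forall g h : R -> V, (forall t : R, 0 <= t <= 1 -> g t = h t) -> cls g = cls h.
Hypothesis cls_tri : forall F : R * R -> V, contM F -> (forall p, U (F p)) ->
  forall a b c, cls (F \o seg2 a b) + cls (F \o seg2 b c) = cls (F \o seg2 a c).

Lemma cls_const x : U x -> cls (fun=> x) = 0.
Proof.
move=> Ux; have := @cls_tri (fun=> x) (@contM_cst _ _ _ _ x) (fun=> Ux) 0 0 0.
by move/eqP; rewrite -subr_eq0 addrK => /eqP.
Qed.

Lemma cls_cat (g : R -> V) : contM g -> (forall t, U (g t)) -> forall a b c : R,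
  cls (fun t => g (a + t * (b - a))) + cls (fun t => g (b + t * (c - b))) =
  cls (fun t => g (a + t * (c - a))).
Proof.
move=> G Ug a b c.
have F : contM (fun p : R * R => g p.1).
  by apply: contM_comp => // p; exact: cvg_fst.
exact: (cls_tri F (fun p => Ug p.1) (a, 0) (b, 0) (c, 0)).
Qed.

(** Cut the square along its diagonal. *)
Lemma cls_square (F : R -> R -> V) :
  contM (fun p : R * R => F (clamp p.1) (clamp p.2)) ->
  (forall s u, 0 <= s <= 1 -> 0 <= u <= 1 -> U (F s u)) ->
  cls (F 0) + cls (F^~ 1) = cls (F^~ 0) + cls (F 1).
Proof.
move=> Fc UF.
pose G p := F (clamp p.1) (clamp p.2).
have UG p : U (G p) by apply: UF; apply: clamp01.
have c0 : clamp 0 = 0 :> R by rewrite clamp_id // lexx ler01.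
have c1 : clamp 1 = 1 :> R by rewrite clamp_id // lexx ler01.
have := cls_tri Fc UG (0, 0) (0, 1) (1, 1); rewrite -(cls_tri Fc UG (0, 0) (1, 0) (1, 1)).
have side (g : R -> V) a b : (forall t : R, 0 <= t <= 1 -> G (seg2 a b t) = g t) ->
    cls (G \o seg2 a b) = cls g by move=> H; apply: cls_ext.
rewrite (side (F 0)); last first.
  by move=> t t01; rewrite /G /seg2 /= !subrr mulr0 add0r c0 subr0 add0r mulr1 clamp_id.
rewrite (side (F^~ 1)); last first.
  by move=> t t01; rewrite /G /seg2 /= subrr subr0 mulr0 add0r addr0 c1 mulr1 clamp_id.
rewrite (side (F^~ 0)); last first.
  by move=> t t01; rewrite /G /seg2 /= subrr subr0 mulr0 add0r addr0 c0 mulr1 clamp_id.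
rewrite (side (F 1)) // => t t01.
by rewrite /G /seg2 /= subrr subr0 mulr0 addr0 c1 add0r mulr1 clamp_id.
Qed.

Lemma cls_free (F : R -> R -> V) :
  contM (fun p : R * R => F (clamp p.1) (clamp p.2)) ->
  (forall s u, 0 <= s <= 1 -> 0 <= u <= 1 -> U (F s u)) ->
  (forall s, F s 0 = F s 1) -> cls (F 0) = cls (F 1).
Proof.
move=> Fc UF F01; have := cls_square Fc UF.
have -> : F^~ 0 = F^~ 1 by apply/funext => s; exact: F01.
by move=> E; zmod_from E.
Qed.

Definition wseg x y : Q := cls (linM x y).

(** The parameter plane is retracted onto the standard triangle by [tt], because
    cls_tri asks for a map that is defined, with values in U, on the whole plane. *)
Lemma wseg_tri x y z :
  (forall s t : R, 0 <= s -> 0 <= t -> s + t <= 1 -> U (triM x y z s t)) ->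
  wseg x y + wseg y z = wseg x z.
Proof.
move=> H; pose tt (p : R * R) := Num.min (clamp p.2) (1 - clamp p.1).
pose F (p : R * R) := triM x y z (clamp p.1) (tt p).
have Fc : contM F.
  have c1 := @cont_clamp_fst R.
  have c2 := @cont_clamp_snd R.
  have ct : continuous tt.
    move=> p; apply: (@continuous_min R _ (fun p => clamp p.2) (fun p => 1 - clamp p.1) p).
      exact: c2.
    by apply: cvgB; [exact: cvg_cst|exact: c1].
  move=> i j.
  rewrite (_ : (fun _ => _) = fun p => x i j + rc (clamp p.1) * (y i j - x i j)
     + rc (tt p) * (z i j - x i j)); last by apply/funext => p; rewrite /F triME.
  apply: contCD; [apply: contCD|]; first exact: contCc.
    by apply: contCM; [exact: contC_rc|exact: contCc].
  by apply: contCM; [exact: contC_rc|exact: contCc].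
have UF p : U (F p).
  have /andP[h1 h2] := clamp01 p.1; have /andP[h3 h4] := clamp01 p.2.
  by apply: H; rewrite /tt ?le_min ?h1 ?h3 ?subr_ge0 //= -lerBrDl ge_min lexx orbT.
have E := cls_tri Fc UF (0, 0) (1, 0) (0, 1).
have c0 : clamp 0 = 0 :> R by rewrite clamp_id // lexx ler01.
have c1 : clamp 1 = 1 :> R by rewrite clamp_id // lexx ler01.
have e1 : cls (F \o seg2 (0, 0) (1, 0)) = wseg x y.
  apply: cls_ext => t t01; apply/matrixP => i j.
  rewrite /F /seg2 /tt /= triME linME /tri_pt /lin !subr0 mulr1 mulr0 !add0r c0 clamp_id //.
  by rewrite min_l ?rc0 ?mul0r ?addr0 // subr_ge0; case/andP: t01.
have e2 : cls (F \o seg2 (1, 0) (0, 1)) = wseg y z.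
  apply: cls_ext => t t01; apply/matrixP => i j.
  rewrite /F /seg2 /tt /= triME linME /tri_pt /lin !subr0 sub0r mulr1 mulrN1 !add0r.
  rewrite !clamp_id //; last by lra.
  by rewrite opprB addrCA subrr addr0 minxx rcB rc1; ring.
have e3 : cls (F \o seg2 (0, 0) (0, 1)) = wseg x z.
  apply: cls_ext => t t01; apply/matrixP => i j.
  rewrite /F /seg2 /tt /= triME linME /tri_pt /lin !subr0 mulr1 mulr0 !add0r c0 clamp_id //.
  by rewrite subr0 min_l ?rc0 ?mul0r ?addr0 //; case/andP: t01.
by rewrite -e1 -e2 -e3.
Qed.

Definition circ z e (d : C) : Q := cls (fun u => upd z e (crd z e + d * circle u)).

Lemma contM_circ z e (d : C) : contM (fun u : R => upd z e (crd z e + d * circle u)).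
Proof.
apply: contM_upd; first exact: contM_cst.
by apply: contCD; [exact: contCc|apply: contCM; [exact: contCc|exact: cont_circle]].
Qed.

(** A quarter of a circle is homotopic to its chord. *)
Lemma circ_quarter z e (d : C) (a : R) : d != 0 ->
  (forall v, v != 0 -> nrm v <= nrm d -> U (upd z e (crd z e + v))) ->
  cls (fun t => upd z e (crd z e + d * circle (a + t * 4^-1))) =
  wseg (upd z e (crd z e + d * circle a)) (upd z e (crd z e + d * (circle a * ii R))).
Proof.
move=> d0 Ud.
pose v (s t : R) : C := rc (1 - s) * circle (t / 4) + rc s * (rc (1 - t) + rc t * ii R).
pose F s t := upd z e (crd z e + d * circle a * v s t).
have Fc : contM (fun p : R * R => F (clamp p.1) (clamp p.2)).
  have c1 := @cont_clamp_fst R.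
  have c2 := @cont_clamp_snd R.
  apply: contM_upd; first exact: contM_cst.
  apply: contCD; first exact: contCc.
  apply: contCM; first exact: contCc.
  apply: contCD.
    apply: contCM; first by apply: contC_rc => p; apply: cvgB; [exact: cvg_cst|exact: c1].
    apply: (cont_comp _ (@cont_circle R)) => p.
    by apply: cvgM; [exact: c2|exact: cvg_cst].
  apply: contCM; first exact: contC_rc.
  apply: contCD; first by apply: contC_rc => p; apply: cvgB; [exact: cvg_cst|exact: c2].
  by apply: contCM; [exact: contC_rc|exact: contCc].
have UF s t : 0 <= s <= 1 -> 0 <= t <= 1 -> U (F s t).
  move=> s01 t01; apply: Ud.
    rewrite !mulf_neq0 ?circle_neq0 //; apply/eqP => E.
    have : 0 < re (v s t) + im (v s t); last by rewrite E !reimE addr0 ltxx.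
    have := circle_first_quadrant t01; rewrite /v !reimE => cp.
    have [->|s1] := eqVneq s 1; first lra.
    have : 0 < (1 - s) * (re (circle (t / 4)) + im (circle (t / 4))).
      by rewrite mulr_gt0 // subr_gt0 lt_neqAle s1; lra.
    lra.
  rewrite !nrmM nrm_circle mulr1 ler_piMr ?nrm_ge0 //.
  apply: le_trans (nrmD _ _) _; rewrite !nrmM nrm_circle mulr1.
  rewrite !nrm_rc !ger0_norm; [|lra|lra].
  have : nrm (rc (1 - t) + rc t * ii R) <= 1.
    apply: le_trans (nrmD _ _) _; rewrite nrmM nrm_ii !nrm_rc !ger0_norm; lra.
  move=> h; have : s * nrm (rc (1 - t) + rc t * ii R) <= s by rewrite ler_piMr //; lra.
  lra.
have E := cls_square Fc UF.
have U0 : U (upd z e (crd z e + d * circle a)).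
  by apply: Ud; rewrite ?mulf_neq0 ?circle_neq0 // nrmM nrm_circle mulr1.
have U1 : U (upd z e (crd z e + d * (circle a * ii R))).
  apply: Ud; last by rewrite !nrmM nrm_circle nrm_ii !mulr1.
  by rewrite !mulf_neq0 ?circle_neq0 // -nrm_gt0 nrm_ii.
have e1 : cls (F^~ 1) = 0.
  rewrite -(cls_const U1); apply: cls_ext => s _; rewrite /F /v; congr (upd _ _ (_ + _)).
  by rewrite mul1r circle_quarter !rcB rc1; ring.
have e2 : cls (F^~ 0) = 0.
  rewrite -(cls_const U0); apply: cls_ext => s _; rewrite /F /v; congr (upd _ _ (_ + _)).
  by rewrite mul0r circle0 !rcB rc0 rc1; ring.
have e3 : cls (F 0) = cls (fun t => upd z e (crd z e + d * circle (a + t * 4^-1))).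
  apply: cls_ext => t _; rewrite /F /v; congr (upd _ _ (_ + _)).
  by rewrite circleD !rcB rc0 rc1; ring.
have e4 : cls (F 1) = wseg (upd z e (crd z e + d * circle a)) (upd z e (crd z e + d * (circle a * ii R))).
  apply: cls_ext => t _; rewrite linM_upd; congr (upd _ _ _).
  by rewrite /lin /v !rcB rc1; ring.
by rewrite e1 e2 e3 e4 addr0 add0r in E.
Qed.

Lemma circ_diamond z e (d : C) : d != 0 ->
  (forall v, v != 0 -> nrm v <= nrm d -> U (upd z e (crd z e + v))) ->
  circ z e d = diamond wseg z e d.
Proof.
move=> d0 Ud.
pose g (u : R) := upd z e (crd z e + d * circle u).
have Ug u : U (g u).
  by apply: Ud; rewrite ?mulf_neq0 ?circle_neq0 // nrmM nrm_circle mulr1.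
have gc : contM g := @contM_circ z e d.
have q a b : b - a = 4^-1 -> cls (fun t => g (a + t * (b - a))) =
   wseg (g a) (upd z e (crd z e + d * (circle a * ii R))).
  by move=> ->; apply: circ_quarter.
have Q0 := q 0 4^-1 ltac:(by rewrite subr0).
have Q1 := q 4^-1 (1/2) ltac:(by field).
have Q2 := q (1/2) (3/4) ltac:(by field).
have Q3 := q (3/4) 1 ltac:(by field).
have E1 := cls_cat gc Ug 0 4^-1 (1/2).
have E2 := cls_cat gc Ug 0 (1/2) (3/4).
have E3 := cls_cat gc Ug 0 (3/4) 1.
have -> : circ z e d = cls (fun t => g (0 + t * (1 - 0))).
  by apply: cls_ext => t _; rewrite /g add0r subr0 mulr1.
rewrite -E3 -E2 -E1 Q0 Q1 Q2 Q3 /diamond /g circle0 circle_quarter circle_half circle_3quarter.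
by rewrite mulr1 mul1r ii2 mulN1r mulrN1 mulrN mulNr ii2 opprK mulr1.
Qed.

(** z is a point of exactly one hypersurface, and the line of the entry e is
    transverse to it there. *)
Definition regular J e z := [/\ f J z = 0, slope f J e z != 0 & forall I, I != J -> f I z != 0].
(** Circles with arbitrarily small radii d suffice: circles about a regular
    point can be compared only for small d, with a bound that depends on it. *)
Definition triv z e := forall eps : R, 0 < eps -> exists2 d : C, 0 < nrm d < eps & circ z e d = 0.

Lemma regular_near J e z : regular J e z -> exists2 r : R, 0 < r &
  forall v, v != 0 -> nrm v < r -> U (upd z e (crd z e + v)).
Proof.
move=> [fz pz fI]; have [d d0 Hd] := @open_fam _ _ _ _ _ f_cont (predC1 J) z fI.
exists d => // v v0 vd I; have [->|IJ] := eqVneq I J.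
  by rewrite f_aff mulrDl addrA -(f_crd f_aff) fz add0r mulf_neq0.
apply: (Hd _ _ I IJ).
have := @upd_near _ _ _ z z e (crd z e + v) (crd z e) d (near_refl _ d0).
by rewrite upd_crd addrAC subrr add0r; apply.
Qed.

Lemma triv_diamond J e z : regular J e z -> triv z e -> forall eps : R, 0 < eps ->
  exists2 d : C, 0 < nrm d < eps & diamond wseg z e d = 0.
Proof.
move=> /regular_near [r r0 Hr] T eps eps0.
have [|d /andP[d0 dm] Hd] := T (Num.min eps r); first by rewrite lt_min eps0.
move: dm; rewrite lt_min => /andP[de dr]; exists d; first by rewrite d0.
rewrite -circ_diamond //; first by rewrite -nrm_gt0.
by move=> v v0 vd; apply: Hr => //; apply: le_lt_trans dr.
Qed.

(** The torus swept out by the circles is a free homotopy, and it stays in U for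
    small d, uniformly along the path. *)
Lemma regular_path J e (g : R -> V) : contM g -> (forall t, regular J e (g t)) ->
  exists2 r : R, 0 < r & forall d : C, 0 < nrm d < r -> circ (g 0) e d = circ (g 1) e d.
Proof.
move=> gc reg.
have O := @open_fam _ _ _ _ _ f_cont (predC1 J).
have [|r r0 Hr] := tube O (contM_cont01 gc).
  by move=> t _; have [_ _] := reg t.
exists r => // d /andP[d0 dr].
pose F (s u : R) := upd (g s) e (crd (g s) e + d * circle u).
apply: (@cls_free F).
- have c1 := @cont_clamp_fst R.
  have c2 := @cont_clamp_snd R.
  have gs : contM (fun p : R * R => g (clamp p.1)) := contM_comp gc c1.
  apply: contM_upd; first exact: gs.
  apply: contCD; first exact: contM_crd.
  by apply: contCM; [exact: contCc|exact: (cont_comp c2 (@cont_circle R))].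
- move=> s u s01 u01 I; have [fg pg _] := reg s.
  have [->|IJ] := eqVneq I J.
    rewrite f_aff mulrDl addrA -(f_crd f_aff) fg add0r !mulf_neq0 ?circle_neq0 //.
    by rewrite -nrm_gt0.
  apply: (Hr s s01 _ _ I IJ).
  have := @upd_near _ _ _ (g s) (g s) e (crd (g s) e + d * circle u) (crd (g s) e) r (near_refl _ r0).
  by rewrite upd_crd addrAC subrr add0r nrmM nrm_circle mulr1; apply.
- by move=> s; rewrite /F circle0 circle1.
Qed.

Lemma poly_roots (q : {poly C}) : q != 0 -> exists S : seq C, forall t, root q t -> t \in S.
Proof.
have [k] := ubnP (size q); elim: k q => // k IH q qk q0.
have [[a qa]|nr] := pselect (exists a, root q a); last first.
  by exists [::] => t qt; case: nr; exists t.
have /factor_theorem [r qr] := qa.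
have r0 : r != 0 by apply: contraNneq q0 => r0; rewrite qr r0 mul0r.
have [|S HS] := IH r _ r0.
  by move: qk; rewrite qr size_Mmonic ?monicXsubC // size_XsubC addn2 /= ltnS.
exists (a :: S) => t; rewrite qr rootM root_XsubC inE => /orP[/HS ->|->//].
by rewrite orbT.
Qed.

Lemma rslt_root J I e x v : f J (upd x e v) = 0 ->
  rslt f J I e x = slope f J e x * f I (upd x e v).
Proof.
rewrite !f_aff => H; rewrite /rslt.
have -> : icept f J e x = - (v * slope f J e x) by apply/eqP; rewrite -addr_eq0 H.
by ring.
Qed.

(** Interpolate the other entries linearly, with a complex parameter, and solve
    f J = 0 for the entry e. The parameters for which this is impossible, or for
    which another hypersurface is met, are zeros of a nonzero polynomial q; avoid
    them by a detour. *)
Lemma transport J e z z' : regular J e z -> regular J e z' ->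
  exists2 r : R, 0 < r & forall d : C, 0 < nrm d < r -> circ z e d = circ z' e d.
Proof.
move=> [fz pz oz] [fz' pz' oz'].
(* the conditions that the solution exists, and that it is regular *)
pose g (I : K) x := if I == J then slope f J e x else rslt f J I e x.
have gpol I : pol (g I) by rewrite /g; case: eqP => _; [exact: pol_slope|exact: pol_rslt].
have gz I : g I z != 0.
  rewrite /g; case: (eqVneq I J) => [//|IJ].
  by rewrite (@rslt_root J I e z (crd z e)) ?upd_crd // mulf_neq0 ?oz.
have gz' I : g I z' != 0.
  rewrite /g; case: (eqVneq I J) => [//|IJ].
  by rewrite (@rslt_root J I e z' (crd z' e)) ?upd_crd // mulf_neq0 ?oz'.
have [q [q0 q1 Hq]] : exists q : {poly C}, [/\ q.[0] != 0, q.[1] != 0 &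
    forall t, q.[t] != 0 -> forall I, g I (z + t *: (z' - z)) != 0].
  suff [q [q0 q1 Hq]] : exists q : {poly C}, [/\ q.[0] != 0, q.[1] != 0 &
    forall t, q.[t] != 0 -> forall I, I \in enum K -> g I (z + t *: (z' - z)) != 0].
    by exists q; split=> // t qt I; apply: Hq; rewrite ?mem_enum.
  elim: (enum K) => [|I s [q [q0 q1 Hq]]].
    by exists 1; rewrite !hornerC oner_eq0; split.
  have [r Hr] := gpol I z (z' - z).
  exists (q * r); rewrite !hornerM; split.
  - by rewrite mulf_neq0 // -Hr scale0r addr0.
  - by rewrite mulf_neq0 // -Hr scale1r addrC subrK.
  - move=> t; rewrite hornerM mulf_eq0 negb_or => /andP[qt rt] I'.
    by rewrite inE => /orP[/eqP ->|]; [rewrite Hr|exact: Hq].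
have [|S HS] := @poly_roots q.
  by apply: contraNneq q0 => ->; rewrite horner0.
pose S' := [seq t <- S | root q t].
have S'P t : t \notin S' -> q.[t] != 0.
  by apply: contra => /eqP qt; rewrite mem_filter /root qt eqxx /= HS // /root qt.
have [||p [_ s1 s2]] := @detour R S' 0 1 1 _ _ ltr01.
- by rewrite mem_filter negb_and /root q0.
- by rewrite mem_filter negb_and /root q1.
pose y (l : C) := z + l *: (z' - z).
pose zeta l := upd (y l) e (- icept f J e (y l) / slope f J e (y l)).
have reg l : q.[l] != 0 -> regular J e (zeta l).
  move=> ql; have gl := Hq l ql.
  have pl : slope f J e (y l) != 0 by have := gl J; rewrite /g eqxx.
  have fl : f J (zeta l) = 0 by rewrite f_aff divfK // subrr.
  split=> //; first by rewrite slope_upd.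
  move=> I IJ; have := gl I; rewrite /g (negbTE IJ) (@rslt_root J I e (y l) _ fl).
  by apply: contraNneq => ->; rewrite mulr0.
have zeta0 : zeta 0 = z.
  rewrite /zeta /y scale0r addr0 -[RHS](upd_crd z e); congr (upd _ _ _).
  have -> : icept f J e z = - (crd z e * slope f J e z).
    by apply/eqP; rewrite -addr_eq0 -(f_crd f_aff) fz.
  by rewrite opprK mulfK.
have zeta1 : zeta 1 = z'.
  rewrite /zeta /y scale1r [z + _]addrC subrK -[RHS](upd_crd z' e); congr (upd _ _ _).
  have -> : icept f J e z' = - (crd z' e * slope f J e z').
    by apply/eqP; rewrite -addr_eq0 -(f_crd f_aff) fz'.
  by rewrite opprK mulfK.
have half a b : (forall t : R, 0 <= t <= 1 -> lin a b t \notin S') ->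
    exists2 r : R, 0 < r & forall d : C, 0 < nrm d < r -> circ (zeta a) e d = circ (zeta b) e d.
  move=> ab; pose l t := lin a b (clamp t).
  have lc : continuous l.
    apply: contCD; first exact: contCc.
    by apply: contCM; [apply: contC_rc; exact: cont_clamp|exact: contCc].
  have ql t : q.[l t] != 0 by apply: S'P; apply: ab; apply: clamp01.
  have [||r r0 Hr] := @regular_path J e (fun t => zeta (l t)).
  - have yc : contM (fun t => y (l t)).
      move=> i j; rewrite (_ : (fun _ => _) = fun t => z i j + l t * (z' i j - z i j)).
        by apply: contCD; [exact: contCc|apply: contCM; [exact: lc|exact: contCc]].
      by apply/funext => t; rewrite /y !mxE.
    have fc v : continuous (fun t => f J (upd (y (l t)) e v)).
      by apply: (contF_comp (f_cont J)); apply: contM_upd; [exact: yc|exact: contCc].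
    apply: contM_upd; first exact: yc.
    apply: contCM; first by apply: contCN; exact: fc.
    apply: contCV; first by move=> t; have := Hq _ (ql t) J; rewrite /g eqxx.
    by apply: contCB; exact: fc.
  - by move=> t; apply: reg.
  have l0 : l 0 = a by rewrite /l clamp_id ?lexx ?ler01 // lin0.
  have l1 : l 1 = b by rewrite /l clamp_id ?lexx ?ler01 // lin1.
  by exists r; [exact: r0|move=> d dr; have := Hr d dr; rewrite l0 l1; apply].
have [r r0 Hr] := half 0 p s1; have [r' r'0 Hr'] := half p 1 s2.
exists (Num.min r r'); first by rewrite lt_min r0.
move=> d; rewrite lt_min => /and3P[d0 dr dr'].
have dr1 : 0 < nrm d < r by rewrite d0.
have dr2 : 0 < nrm d < r' by rewrite d0.
have E1 := Hr d dr1; have E2 := Hr' d dr2.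
by rewrite zeta0 in E1; rewrite zeta1 in E2; exact: (etrans E1 E2).
Qed.

Lemma contF_slope J e : contF (slope f J e).
Proof.
move=> x eps eps0; have e2 : 0 < eps / 2 by lra.
have [d1 d10 H1] := f_cont J (upd x e 1) e2.
have [d2 d20 H2] := f_cont J (upd x e 0) e2.
exists (Num.min d1 d2); first by rewrite lt_min d10.
move=> y yx.
have y1 : near_mx y x d1 by apply: near_le yx; rewrite ge_min lexx.
have y2 : near_mx y x d2 by apply: near_le yx; rewrite ge_min lexx orbT.
have h1 := H1 _ (upd_near_v e 1 d10 y1); have h2 := H2 _ (upd_near_v e 0 d20 y2).
rewrite /slope (_ : _ - _ = (f J (upd y e 1) - f J (upd x e 1)) +
  - (f J (upd y e 0) - f J (upd x e 0))); last by ring.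
by apply: le_lt_trans (nrmD _ _) _; rewrite nrmN; lra.
Qed.

(** On the loop u -> A (c * circle u), the function f J equals k * c * circle u up
    to an error small against c. The homotopy moves all entries but e linearly to
    those of z, and the value D of f J linearly to k * c * circle u; the entry e is
    determined by D. As D stays nonzero and small, the loop stays close to z and
    off the hypersurface of J, and the other f I stay away from zero. *)
Lemma transverse_circ J e z (A : C -> V) (k : C) (r0 : R) : regular J e z -> k != 0 ->
  0 < r0 ->
  (forall c : C, nrm c < r0 -> contM (fun u : R => A (c * circle u))) ->
  (forall eps : R, 0 < eps -> exists2 d : R, 0 < d & forall c : C, nrm c < d -> near_mx (A c) z eps) ->
  (forall eps : R, 0 < eps -> exists2 d : R, 0 < d &
     forall c : C, 0 < nrm c < d -> nrm (f J (A c) / c - k) < eps) ->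
  exists2 r : R, 0 < r & forall c : C, 0 < nrm c < r ->
    cls (fun u => A (c * circle u)) = circ z e (k * c / slope f J e z).
Proof.
move=> [fz pz oz] k0 r00 Ac Az Ak.
set p := slope f J e z in pz *.
have np : 0 < nrm p by rewrite nrm_gt0.
have nk : 0 < nrm k by rewrite nrm_gt0.
have [e0 e00 He0] := @open_fam _ _ _ _ _ f_cont (predC1 J) z oz.
have slope_cont := contF_slope J e.
have [d1 d10 Hd1] := slope_cont z (nrm p / 2) ltac:(lra).
have slope_big x : near_mx x z d1 -> nrm p / 2 < nrm (slope f J e x).
  move=> /Hd1; rewrite -/p => h; have := nrm_distr p (slope f J e x) 0.
  by rewrite !subr0 (nrmBC p); lra.
have m0 : 0 < e0 * nrm p / 4 by rewrite divr_gt0 // mulr_gt0.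
have [d2 d20 Hd2] := f_cont J z m0.
pose eps := Num.min e0 (Num.min d1 d2).
have eps0 : 0 < eps by rewrite !lt_min e00 d10.
have [b1 b10 Hb1] := Az eps eps0.
have [b2 b20 Hb2] := Ak (nrm k / 2) ltac:(lra).
pose b3 := e0 * nrm p / 4 / (2 * nrm k).
have b30 : 0 < b3 by rewrite divr_gt0 // mulr_gt0.
exists (Num.min r0 (Num.min b1 (Num.min b2 b3))); first by rewrite !lt_min r00 b10 b20 b30.
move=> c; rewrite !lt_min => /andP[c0 /and4P[cr0 cb1 cb2 cb3]].
pose Y s u := linM (A (c * circle u)) z s.
pose D s u := rc (1 - s) * f J (A (c * circle u)) + rc s * (k * (c * circle u)).
pose F s u := upd (Y s u) e ((D s u - icept f J e (Y s u)) / slope f J e (Y s u)).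
have Ynear s u : 0 <= s <= 1 -> near_mx (Y s u) z eps.
  move=> s01 i j; rewrite /Y linME.
  have := @nrm_convex R (z i j) (A (c * circle u) i j) (z i j) (z i j) s 0 eps.
  rewrite rc0 mul0r !addr0 subrr nrm0 => H; apply: H => //; try lra.
  by apply: Hb1; rewrite nrmM nrm_circle mulr1.
have Dbound s u : 0 <= s <= 1 -> D s u != 0 /\ nrm (D s u) < e0 * nrm p / 4.
  move=> s01; pose t := c * circle u.
  have nt : nrm t = nrm c by rewrite nrmM nrm_circle mulr1.
  have t0 : t != 0 by rewrite -nrm_gt0 nt.
  have h := Hb2 t; rewrite nt c0 cb2 in h; move: (h isT) => {}h.
  pose eta := f J (A t) / t - k.
  have DE : D s u = t * (k + rc (1 - s) * eta).
    have fE : f J (A t) = t * (k + eta) by rewrite /eta addrC subrK mulrC divfK.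
    by rewrite /D -/t fE rcB rc1; ring.
  have ne : nrm (rc (1 - s) * eta) <= nrm k / 2.
    rewrite nrmM nrm_rc ger0_norm; last lra.
    rewrite -/eta in h; have := nrm_ge0 eta => e_ge.
    by have : (1 - s) * nrm eta <= nrm eta; [rewrite ler_piMl //; lra|lra].
  split.
    rewrite DE mulf_neq0 //; apply/eqP => Z.
    have : nrm k = nrm (rc (1 - s) * eta) by rewrite -nrmN; congr nrm; apply/eqP; rewrite eq_sym -addr_eq0 addrC Z.
    lra.
  rewrite DE nrmM nt.
  have h1 : nrm (k + rc (1 - s) * eta) <= 2 * nrm k by rewrite (le_trans (nrmD _ _)) //; lra.
  apply: (@le_lt_trans _ _ (nrm c * (2 * nrm k))); first by rewrite ler_wpM2l ?nrm_ge0.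
  by move: cb3; rewrite /b3 ltr_pdivlMr // mulr_gt0.
have slopeY s u : 0 <= s <= 1 -> nrm p / 2 < nrm (slope f J e (Y s u)).
  by move=> s01; apply: slope_big; apply: near_le (Ynear s u s01); rewrite /eps !ge_min lexx orbT.
have slopeY0 s u : 0 <= s <= 1 -> slope f J e (Y s u) != 0.
  by move=> s01; rewrite -nrm_gt0; have := slopeY s u s01; lra.
have UF s u : 0 <= s <= 1 -> U (F s u).
  move=> s01 I; have [D0 Db] := Dbound s u s01.
  have sY := slopeY0 s u s01.
  have [->|IJ] := eqVneq I J.
    by rewrite f_aff divfK // addrCA subrr addr0.
  apply: (He0 _ _ I IJ).
  have N1 := Ynear s u s01.
  have := @upd_near _ _ _ (Y s u) z e ((D s u - icept f J e (Y s u)) / slope f J e (Y s u)) (crd z e) e0.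
  rewrite upd_crd; apply; first by apply: near_le N1; rewrite /eps ge_min lexx.
  pose Y' := upd (Y s u) e (crd z e).
  have -> : (D s u - icept f J e (Y s u)) / slope f J e (Y s u) - crd z e =
     (D s u - f J Y') / slope f J e (Y s u) by rewrite f_aff; field.
  rewrite nrmM nrmV ltr_pdivrMr; last by rewrite nrm_gt0.
  have h1 : nrm (f J Y') < e0 * nrm p / 4.
    rewrite -[f J Y']subr0 -fz; apply: Hd2.
    rewrite -(upd_crd z e); apply: upd_near_v => //; apply: near_le N1.
    by rewrite /eps !ge_min lexx !orbT.
  have h2 := nrmD (D s u) (- f J Y'); rewrite nrmN in h2.
  have h3 : e0 * (nrm p / 2) < e0 * nrm (slope f J e (Y s u)) by rewrite ltr_pM2l // slopeY.
  lra.
have Fc : contM (fun q : R * R => F (clamp q.1) (clamp q.2)).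
  have c1 := @cont_clamp_fst R.
  have c2 := @cont_clamp_snd R.
  have Ac2 : contM (fun q : R * R => A (c * circle (clamp q.2))).
    exact: (contM_comp (Ac c cr0) c2).
  have Yc : contM (fun q : R * R => Y (clamp q.1) (clamp q.2)).
    by apply: contM_linM; [exact: Ac2|exact: contM_cst|exact: c1].
  have c1' : continuous (fun q : R * R => 1 - clamp q.1).
    by move=> q; apply: cvgB; [exact: cvg_cst|exact: c1].
  have fY : continuous (fun q : R * R => icept f J e (Y (clamp q.1) (clamp q.2))).
    by apply: (contF_comp (f_cont J)); apply: contM_upd; [exact: Yc|exact: contCc].
  have sY : continuous (fun q : R * R => slope f J e (Y (clamp q.1) (clamp q.2))).
    exact: (contF_comp slope_cont Yc).
  have Dc : continuous (fun q : R * R => D (clamp q.1) (clamp q.2)).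
    apply: contCD; apply: contCM.
    - by apply: contC_rc; exact: c1'.
    - exact: (contF_comp (f_cont J) Ac2).
    - by apply: contC_rc; exact: c1.
    apply: contCM; first exact: contCc.
    by apply: contCM; [exact: contCc|exact: (cont_comp c2 (@cont_circle R))].
  apply: contM_upd; first exact: Yc.
  apply: contCM; first by apply: contCB; [exact: Dc|exact: fY].
  by apply: contCV; [move=> q; apply: slopeY0; apply: clamp01|exact: sY].
have h0 := @cls_free F Fc (fun s u s01 _ => UF s u s01).
have F0 : F 0 = (fun u => A (c * circle u)).
  apply/funext => u; rewrite /F /Y /D linM0 subr0 rc1 rc0 mul1r mul0r addr0.
  rewrite -[RHS](upd_crd _ e); congr (upd _ _ _).
  have s0 := slopeY0 0 u; rewrite /Y linM0 lexx ler01 in s0.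
  move: (A (c * circle u)) (s0 isT) => x x0.
  by rewrite (f_crd f_aff J e x) [icept f J e x + _]addrC addrK mulfK.
have F1 : cls (F 1) = circ z e (k * c / p).
  apply: cls_ext => u _; rewrite /F /Y /D linM1 subrr rc1 rc0 mul1r mul0r add0r.
  congr (upd _ _ _).
  have -> : icept f J e z = - (crd z e * p).
    by apply/eqP; rewrite -addr_eq0 -(f_crd f_aff) fz.
  by rewrite -/p; field.
rewrite -F1 -F0; apply: h0 => s.
by rewrite /F /Y /D circle0 circle1.
Qed.

Lemma triv_transport J e z z' : regular J e z -> regular J e z' -> triv z e -> triv z' e.
Proof.
move=> rz rz' T eps eps0; have [r r0 Hr] := transport rz rz'.
have [|d /andP[d0 dm] Hd] := T (Num.min eps r); first by rewrite lt_min eps0.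
move: dm; rewrite lt_min => /andP[de dr].
by exists d; rewrite ?d0 // -Hr ?d0.
Qed.

(** A circle in the direction e' is a small loop transverse to the hypersurface,
    so it is homotopic to one in the direction e. *)
Lemma triv_direction J e e' z : regular J e z -> regular J e' z -> triv z e' -> triv z e.
Proof.
move=> rz rz' T eps eps0.
have [fz pz oz] := rz; have [_ pz' _] := rz'.
pose A (c : C) := upd z e' (crd z e' + c).
have fA c : f J (A c) = c * slope f J e' z.
  by rewrite f_aff mulrDl addrA -(f_crd f_aff) fz add0r.
have [|||r r0 Hr] := @transverse_circ J e z A (slope f J e' z) 1 rz pz' ltr01.
- by move=> c _; apply: contM_circ.
- move=> d d0; exists d => // c cd.
  have := @upd_near _ _ _ z z e' (crd z e' + c) (crd z e') d (near_refl _ d0).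
  by rewrite upd_crd addrAC subrr add0r; apply.
- move=> d d0; exists 1 => // c /andP[c0 _].
  by rewrite fA mulrAC mulfV ?mul1r ?subrr ?nrm0 // -nrm_gt0.
pose q := nrm (slope f J e' z) / nrm (slope f J e z).
have q0 : 0 < q by rewrite divr_gt0 // nrm_gt0.
have [|d /andP[d0 dm] Hd] := T (Num.min r (eps / q)).
  by rewrite lt_min r0 divr_gt0.
move: dm; rewrite lt_min => /andP[dr de].
exists (slope f J e' z * d / slope f J e z).
  rewrite !nrmM nrmV mulrAC -/q mulr_gt0 //=.
  by rewrite mulrC -ltr_pdivlMr.
by rewrite -Hr ?d0 //.
Qed.
End ClassFunction.

(** * Holomorphic transverse discs *)
Section PuncturedLimits.
Variable R : realType.
Local Notation C := (Cplx R).

Lemma near_dnbhs0 (P : C -> Prop) :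
  (\forall c \near 0^', P c) <-> exists2 d : R, 0 < d & forall c, 0 < nrm c < d -> P c.
Proof.
split.
  move=> /nbhs_ballP [e e0 H].
  have eE : e = rc (re e).
    by apply: C_eq => //; rewrite im_rc; move: e0; rewrite /= ltcE => /andP[/eqP].
  exists (re e); first by move: e0; rewrite /= ltcE => /andP[].
  move=> c /andP[c0 ce]; apply: H; last by rewrite -nrm_gt0.
  by rewrite /ball /= sub0r normrN eE nrm_ltE.
move=> [d d0 H]; apply/nbhs_ballP.
exists (rc d); first by rewrite /= ltcE /= eqxx.
move=> c; rewrite /ball /= sub0r normrN nrm_ltE => cd c0.
by apply: H; rewrite nrm_gt0 c0.
Qed.

Lemma cvg_dnbhs0 (g : C -> C) (l : C) : (g @ 0^' --> l) <->
  forall e : R, 0 < e -> exists2 d : R, 0 < d & forall c, 0 < nrm c < d -> nrm (g c - l) < e.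
Proof.
split=> [/cvg_nrm H e e0|H]; first by apply/near_dnbhs0; apply: H.
by apply/cvg_nrm => e e0; apply/near_dnbhs0; apply: H.
Qed.

Lemma cvg_sumC (I : Type) (s : seq I) (F : set_system C) (FF : Filter F)
    (g : I -> C -> C) (l : I -> C) : (forall i, g i @ F --> l i) ->
  (fun c => \sum_(i <- s) g i c) @ F --> \sum_(i <- s) l i.
Proof.
move=> H; elim: s => [|i s IH].
  rewrite big_nil (_ : (fun _ => _) = fun=> 0); first exact: cvg_cst.
  by apply/funext => c; rewrite big_nil.
rewrite big_cons (_ : (fun _ => _) = fun c => g i c + \sum_(k <- s) g k c).
  by apply: cvgD; [exact: H|exact: IH].
by apply/funext => c; rewrite big_cons.
Qed.

Lemma derivable_quot (g : C -> C) : derivable (g : C -> C^o) 0 1 ->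
  exists l : C, (fun c => (g c - g 0) / c) @ 0^' --> l.
Proof.
move=> /cvg_ex [l H]; exists l; apply: cvg_trans H.
apply: near_eq_cvg; apply: filterE => c /=.
by rewrite addr0 [_ *: 1]mulr1 mulrC.
Qed.

Lemma derive1_quot (g : C -> C) (l : C) : (fun c => (g c - g 0) / c) @ 0^' --> l ->
  derive1 (g : C -> C^o) 0 = l.
Proof.
move=> H; apply: cvg_lim; first exact: norm_hausdorff.
apply: cvg_trans H; apply: near_eq_cvg; apply: filterE => c /=.
by rewrite addr0 mulrC.
Qed.

End PuncturedLimits.

Section Disc.
Variables (R : realType) (Q : zmodType) (n m : nat) (K : finType).
Local Notation C := (Cplx R).
Local Notation V := 'M[C]_(n, m).
Variable f : K -> V -> C.
Local Notation U := (Ucomp f).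
Implicit Types (x y z : V) (e : 'I_n * 'I_m) (J I : K).

Hypothesis f_cont : forall J, contF (f J).
Hypothesis f_aff : forall J x e v, f J (upd x e v) = icept f J e x + v * slope f J e x.
Hypothesis f_pol : forall J, pol (f J).
Variable e0 : 'I_n * 'I_m.
Local Notation N := (size (enum {: 'I_n * 'I_m})).

(** The increment of f J, summed over the changes of single entries, is exact since
    f J is affine in each of them. It replaces the chain rule in several
    variables. *)
Lemma f_telescope J x y :
  f J y - f J x = \sum_(k < N) slope f J (ek e0 k) (mix k x y) * (crd y (ek e0 k) - crd x (ek e0 k)).
Proof.
have step k : (k < N)%N -> f J (mix k.+1 x y) - f J (mix k x y) =
    slope f J (ek e0 k) (mix k x y) * (crd y (ek e0 k) - crd x (ek e0 k)).
  move=> kN; rewrite (mixS e0 _ _ kN) f_aff (f_crd f_aff J (ek e0 k) (mix k x y)).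
  have -> : crd (mix k x y) (ek e0 k) = crd x (ek e0 k); last by ring.
  rewrite /crd mixE -surjective_pairing /ek index_uniq ?enum_uniq // ltnn //.
rewrite -{1}(mixN x y) -{2}(mix0 x y) -(telescope_sumr (fun k => f J (mix k x y)) (leq0n N)) big_mkord.
by apply: eq_bigr => k _; exact: step.
Qed.

Section At0.
Variable A : C -> V.
Hypothesis A_deriv : forall i j, derivable (fun t : C => A t i j : C^o) 0 1.

Lemma disc_near (eps : R) : 0 < eps -> exists2 d : R, 0 < d &
  forall c : C, nrm c < d -> near_mx (A c) (A 0) eps.
Proof.
move=> eps0.
suff [d d0 Hd] : exists2 d : R, 0 < d & forall k : 'I_n * 'I_m, forall c : C, nrm c < d ->
    nrm (A c k.1 k.2 - A 0 k.1 k.2) < eps.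
  by exists d => // c cd i j; exact: (Hd (i, j)).
apply: fin_min => [k d d' dd H c cd|[i j] /=]; first by apply: H; apply: lt_le_trans dd.
have [l /cvg_dnbhs0 H] := derivable_quot (@A_deriv i j).
have [d d0 Hd] := H 1 ltr01.
have n0 : 0 < nrm l + 1 by have := nrm_ge0 l; lra.
exists (Num.min d (eps / (nrm l + 1))); first by rewrite lt_min d0 divr_gt0.
move=> c; rewrite lt_min ltr_pdivlMr // => /andP[cd ce].
have [->|c0] := eqVneq c 0; first by rewrite subrr nrm0.
have := Hd c; rewrite nrm_gt0 c0 cd => /(_ isT) h.
have := nrm_distr ((A c i j - A 0 i j) / c) l 0; rewrite !subr0 => h'.
have -> : A c i j - A 0 i j = c * ((A c i j - A 0 i j) / c) by rewrite mulrC divfK.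
rewrite nrmM; apply: le_lt_trans ce; rewrite ler_wpM2l ?nrm_ge0 //; lra.
Qed.

Lemma disc_quot J : exists D : 'I_n * 'I_m -> C,
  (fun c => (f J (A c) - f J (A 0)) / c) @ 0^' -->
  \sum_(k < N) slope f J (ek e0 k) (A 0) * D (ek e0 k).
Proof.
have ex (k : 'I_n * 'I_m) : exists l : C,
    (fun c => (A c k.1 k.2 - A 0 k.1 k.2) / c) @ 0^' --> l.
  exact: derivable_quot (@A_deriv k.1 k.2).
have [D HD] := choice ex; exists D.
rewrite (_ : (fun c => _) = fun c => \sum_(k < N) slope f J (ek e0 k) (mix k (A 0) (A c)) *
   ((crd (A c) (ek e0 k) - crd (A 0) (ek e0 k)) / c)); last first.
  apply/funext => c; rewrite f_telescope mulr_suml; apply: eq_bigr => k _.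
  by rewrite mulrA.
apply: cvg_sumC => k; apply: cvgM; last exact: HD.
apply/cvg_dnbhs0 => eps eps0.
have [d d0 Hd] := contF_slope f_cont J (ek e0 k) (A 0) eps0.
have [d' d'0 Hd'] := disc_near d0.
exists d' => // c /andP[_ cd]; apply: Hd.
by apply: mix_near; [exact: near_refl|exact: Hd'].
Qed.

(** The derivative of f J along the disc is a combination of the slopes, so one of
    them is nonzero if it is. *)
Lemma disc_derive J : f J (A 0) = 0 ->
  let k := derive1 (fun c : C => f J (A c) : C^o) 0 in
  (forall eps : R, 0 < eps -> exists2 d : R, 0 < d &
     forall c : C, 0 < nrm c < d -> nrm (f J (A c) / c - k) < eps) /\
  (k != 0 -> exists e, slope f J e (A 0) != 0).
Proof.
move=> fA; have [D HD] := disc_quot J.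
rewrite (derive1_quot HD); split.
  move=> eps eps0; have [d d0 Hd] := (cvg_dnbhs0 _ _).1 HD eps eps0.
  by exists d => // c /Hd; rewrite fA subr0.
apply: contraNP => nz; apply/eqP; apply: big1 => k _.
have -> : slope f J (ek e0 k) (A 0) = 0; last by rewrite mul0r.
by apply/eqP; apply: contraPT nz => sz; apply; exists (ek e0 k).
Qed.
End At0.

Definition closed_disc : set C := [set t | `|t| <= 1].

Lemma disc_comp (A : C -> V) (T : topologicalType) (h : T -> C) :
  (forall i j, {within closed_disc, continuous (fun t => A t i j)}) ->
  continuous h -> (forall t, nrm (h t) <= 1) -> contM (fun t => A (h t)).
Proof.
move=> Ac hc h1 i j t.
have inD t' : closed_disc (h t') by rewrite /closed_disc /= -rc1 nrm_leE.
have H := (subspace_continuousP _ _).1 (Ac i j) (h t) (inD t).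
apply: cvg_trans H => W /= HW.
have := hc t; move=> /(_ _ HW) /=; rewrite /nbhs /=.
by apply: filterS => t' /(_ (inD t')).
Qed.

Variable cls : (R -> V) -> Q.
Hypothesis cls_ext : forall g h : R -> V, (forall t : R, 0 <= t <= 1 -> g t = h t) -> cls g = cls h.
Hypothesis cls_tri : forall F : R * R -> V, contM F -> (forall p, U (F p)) ->
  forall a b c, cls (F \o seg2 a b) + cls (F \o seg2 b c) = cls (F \o seg2 a c).

(** The boundary circle of the disc is freely homotopic, through the concentric
    circles, to small transverse loops at its centre. *)
Lemma disc_triv J (A : C -> V) :
  (forall i j, {within closed_disc, continuous (fun t => A t i j)}) ->
  (forall i j, derivable (fun t : C => A t i j : C^o) 0 1) ->
  derive1 (fun c : C => f J (A c) : C^o) 0 != 0 ->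
  f J (A 0) = 0 -> (forall I, I != J -> f I (A 0) != 0) ->
  (forall t, 0 < nrm t <= 1 -> U (A t)) ->
  cls (fun u => A (circle u)) = 0 ->
  exists2 e, regular f J e (A 0) & triv cls (A 0) e.
Proof.
move=> Ac Ad k0 fA fI UA A1.
have [Hk He] := disc_derive Ad fA.
set k := derive1 _ _ in k0 Hk He; have [e pe] := He k0.
have reg : regular f J e (A 0) by split.
exists e => // eps eps0.
have [|||r r0 Hr] := @transverse_circ R Q n m K f f_cont f_aff cls cls_ext cls_tri J e (A 0) A k 1 reg k0 ltr01.
- move=> c c1; apply: disc_comp => //.
    by apply: contCM; [exact: contCc|exact: cont_circle].
  by move=> t; rewrite nrmM nrm_circle mulr1 ltW.
- by move=> d d0; exact: disc_near.
- exact: Hk.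
pose q := nrm k / nrm (slope f J e (A 0)).
have q0 : 0 < q by rewrite divr_gt0 // nrm_gt0.
pose rho := Num.min 1 (Num.min r (eps / q)) / 2.
have m0 : 0 < Num.min 1 (Num.min r (eps / q)) by rewrite !lt_min ltr01 r0 divr_gt0.
have rho0 : 0 < rho by rewrite /rho; lra.
have rho_lt : rho < Num.min 1 (Num.min r (eps / q)) by rewrite /rho; lra.
move: rho_lt; rewrite !lt_min => /and3P[rho1 rhor rhoe].
have nrho : nrm (rc rho) = rho by rewrite nrm_rc ger0_norm // ltW.
exists (k * rc rho / slope f J e (A 0)).
  rewrite !nrmM nrmV mulrAC -/q nrho mulr_gt0 //=.
  by rewrite mulrC -ltr_pdivlMr.
rewrite -Hr ?nrho ?rho0 // -A1.
pose F (s u : R) := A (rc (s + (1 - s) * rho) * circle u).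
have rs (s : R) : 0 <= s <= 1 -> 0 < s + (1 - s) * rho <= 1.
  move=> s01; have [->|s0] := eqVneq s 0; first by rewrite subr0 mul1r add0r rho0 ltW.
  have h : 0 <= (1 - s) * rho <= 1 - s by rewrite mulr_ge0 ?ler_piMr //; lra.
  have s0' : 0 < s by rewrite lt_neqAle eq_sym s0; lra.
  lra.
have F0 : F 0 = fun u => A (rc rho * circle u).
  by apply/funext => u; rewrite /F subr0 mul1r add0r.
have F1 : F 1 = fun u => A (circle u).
  by apply/funext => u; rewrite /F subrr mul0r addr0 rc1 mul1r.
rewrite -F0 -F1; apply: (cls_free cls_ext cls_tri).
- apply: disc_comp => //.
    apply: contCM.
      apply: contC_rc => p; apply: cvgD.
        exact: cont_clamp_fst.
      apply: cvgM; last exact: cvg_cst.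
      apply: cvgB; first exact: cvg_cst.
      exact: cont_clamp_fst.
    apply: (cont_comp _ (@cont_circle R)).
    exact: cont_clamp_snd.
  move=> p; rewrite nrmM nrm_circle mulr1 nrm_rc.
  by have := rs _ (clamp01 p.1) => /andP[a b]; rewrite ger0_norm // ltW.
- move=> s u s01 u01; apply: UA; rewrite nrmM nrm_circle mulr1 nrm_rc.
  by have := rs _ s01 => /andP[a b]; rewrite gtr0_norm // a.
- by move=> s; rewrite /F circle0 circle1.
Qed.

(** These are the three facts about the family f from which a potential follows.
    link connects the coordinate directions to each other, and base provides
    one trivial circle per hypersurface. *)
Hypothesis gen_rslt : forall J I e, J != I -> (exists x, slope f J e x != 0) ->
  exists x, rslt f J I e x != 0.
Hypothesis link : forall J e e', (exists x, slope f J e x != 0) ->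
  (exists x, slope f J e' x != 0) ->
  exists x, [/\ f J x = 0, slope f J e x != 0 & slope f J e' x != 0].
Hypothesis base : forall J, exists e z, regular f J e z /\ triv cls z e.

Lemma slope_aff J e e' x v : e != e' -> slope f J e' (upd x e v) =
  slope f J e' (upd x e 0) + v * (slope f J e' (upd x e 1) - slope f J e' (upd x e 0)).
Proof.
move=> ee.
have sl u : slope f J e' (upd x e u) = icept f J e (upd x e' 1) + u * slope f J e (upd x e' 1)
    - (icept f J e (upd x e' 0) + u * slope f J e (upd x e' 0)).
  by rewrite {1}/slope !(updC _ _ _ ee) !f_aff.
by rewrite !sl; ring.
Qed.

(** Points with nonzero slopes in both directions exist by link; genericity on the
    hypersurface is obtained by varying the other entries and solving f J = 0 for
    the entry e. *)
Lemma regular_link J e e' : (exists x, slope f J e x != 0) -> (exists x, slope f J e' x != 0) ->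
  exists2 z, regular f J e z & regular f J e' z.
Proof.
move=> se se'; have [x0 [fx0 sx0 sx0']] := link se se'.
pose root x := - icept f J e x / slope f J e x.
(* h is the slope in e' at the solution, up to a nonzero factor *)
pose h x := slope f J e x * slope f J e' (upd x e 0) -
  icept f J e x * (slope f J e' (upd x e 1) - slope f J e' (upd x e 0)).
have hE x : slope f J e x != 0 -> e != e' -> h x = slope f J e x * slope f J e' (upd x e (root x)).
  by move=> sx ee; rewrite slope_aff // /h /root; field.
have hpol : pol h.
  have ps v : pol (fun x => slope f J e' (upd x e v)).
    by apply: pol_upd; exact: pol_slope.
  apply: pol_sub; apply: pol_mul; [exact: pol_slope|exact: ps|exact: pol_icept|].
  by apply: pol_sub; exact: ps.
pose g (i : option K) x := if i is Some L then rslt f J L e x else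
  slope f J e x * (if e == e' then 1 else h x).
have gpol i : pol (g i).
  case: i => [I|]; first exact: pol_rslt.
  apply: pol_mul; first exact: pol_slope.
  by case: (e == e') => //; move=> a b; exists 1 => t; rewrite hornerC.
have [x _ Hx] := @pol_dense R n m (option K) g 0 1 ltr01 gpol.
have := Hx None; rewrite /g mulf_eq0 negb_or => gN.
have {gN} /andP[sx hx] : (slope f J e x != 0) && ((if e == e' then 1 else h x) != 0).
  apply: gN; exists x0; rewrite mulf_neq0 //; case: (eqVneq e e') => [_|ee]; first exact: oner_neq0.
  rewrite hE // mulf_neq0 //; have -> : root x0 = crd x0 e; last by rewrite upd_crd.
  rewrite /root; have -> : icept f J e x0 = - (crd x0 e * slope f J e x0).
    by apply/eqP; rewrite -addr_eq0 -(f_crd f_aff) fx0.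
  by rewrite opprK mulfK.
have fz : f J (upd x e (root x)) = 0 by rewrite f_aff divfK // subrr.
have fI I : I != J -> f I (upd x e (root x)) != 0.
  move=> IJ; have := Hx (Some I); rewrite /g (rslt_root f_aff _ fz) => H.
  have : slope f J e x * f I (upd x e (root x)) != 0.
    by apply: H; apply: gen_rslt; rewrite 1?eq_sym.
  by apply: contraNneq => ->; rewrite mulr0.
exists (upd x e (root x)); split=> //; first by rewrite slope_upd.
move: hx; case: (eqVneq e e') => [<- _|ee hx]; first by rewrite slope_upd.
by move: hx; rewrite hE // mulf_eq0 negb_or => /andP[].
Qed.

Lemma cls_potential : exists H : V -> Q, forall x, U x ->
  exists2 d : R, 0 < d & forall y y', near_mx y x d -> near_mx y' x d ->
    H y' - H y = wseg cls y y'.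
Proof.
apply: (global_potential f_cont f_aff f_pol (wseg_tri cls_ext cls_tri)) => //.
move=> J e z fz pz oz eps eps0.
have reg : regular f J e z by split.
have [e1 [z1 [reg1 T1]]] := base J.
have [||z2 reg2 reg2'] := @regular_link J e1 e.
- by exists z1; case: reg1.
- by exists z.
have T2 := triv_transport f_cont f_aff f_pol cls_ext cls_tri reg1 reg2 T1.
have T3 := triv_direction f_cont f_aff cls_ext cls_tri reg2' reg2 T2.
have T4 := triv_transport f_cont f_aff f_pol cls_ext cls_tri reg2' reg T3.
exact: (triv_diamond f_cont f_aff cls_ext cls_tri reg T4).
Qed.

End Disc.

(** * Minors of arrangement matrices *)
Section PolynomialFunctions.
Variables (R : realType) (n m : nat).
Local Notation C := (Cplx R).
Local Notation V := 'M[C]_(n, m).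
Implicit Types g h : V -> C.

Lemma pol_cst (c : C) : pol (fun _ : V => c).
Proof. by move=> a b; exists c%:P => t; rewrite hornerC. Qed.
Lemma pol_crd i j : pol (fun x : V => x i j).
Proof.
move=> a b; exists ((a i j)%:P + (b i j) *: 'X) => t.
by rewrite !hornerE mxE [(t *: b) i j]mxE mulrC.
Qed.
Lemma pol_add g h : pol g -> pol h -> pol (fun x => g x + h x).
Proof.
move=> G H a b; have [q Hq] := G a b; have [r Hr] := H a b.
by exists (q + r) => t; rewrite hornerD Hq Hr.
Qed.

Lemma contF_cst (c : C) : contF (fun _ : V => c).
Proof. by move=> x e e0; exists 1 => // y _; rewrite subrr nrm0. Qed.
Lemma contF_crd i j : contF (fun x : V => x i j).
Proof. by move=> x e e0; exists e => // y; apply. Qed.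
Lemma contF_add g h : contF g -> contF h -> contF (fun x => g x + h x).
Proof.
move=> G H x e e0; have e2 : 0 < e / 2 by lra.
have [d d0 Hd] := G x _ e2; have [d' d'0 Hd'] := H x _ e2.
exists (Num.min d d'); first by rewrite lt_min d0.
move=> y yx.
have h1 := Hd y (near_le (ltac:(by rewrite ge_min lexx) : Num.min d d' <= d) yx).
have h2 := Hd' y (near_le (ltac:(by rewrite ge_min lexx orbT) : Num.min d d' <= d') yx).
rewrite opprD addrACA; apply: le_lt_trans (nrmD _ _) _; lra.
Qed.
Lemma contF_mul g h : contF g -> contF h -> contF (fun x => g x * h x).
Proof.
move=> G H x e e0.
pose N := nrm (g x) + nrm (h x) + 1.
have g0 := nrm_ge0 (g x); have h0 := nrm_ge0 (h x).
have N0 : 0 < N by rewrite /N; lra.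
pose eta := Num.min 1 (e / (2 * N)).
have eta0 : 0 < eta by rewrite lt_min ltr01 divr_gt0 // mulr_gt0.
have [d d0 Hd] := G x _ eta0; have [d' d'0 Hd'] := H x _ eta0.
exists (Num.min d d'); first by rewrite lt_min d0.
move=> y yx.
have h1 := Hd y (near_le (ltac:(by rewrite ge_min lexx) : Num.min d d' <= d) yx).
have h2 := Hd' y (near_le (ltac:(by rewrite ge_min lexx orbT) : Num.min d d' <= d') yx).
have eta1 : eta <= 1 by rewrite /eta ge_min lexx.
have eta2 : eta * (2 * N) <= e by rewrite -ler_pdivlMr ?mulr_gt0 // /eta ge_min lexx orbT.
have -> : g y * h y - g x * h x = (g y - g x) * (h y - h x) + (g y - g x) * h x
  + g x * (h y - h x) by ring.
apply: le_lt_trans (nrmD _ _) _; rewrite nrmM.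
apply: (@le_lt_trans _ _ (nrm (g y - g x) * nrm (h y - h x) + nrm (g y - g x) * nrm (h x)
  + nrm (g x) * nrm (h y - h x))).
  by rewrite lerD2r (le_trans (nrmD _ _)) // !nrmM.
have k1 := nrm_ge0 (g y - g x); have k2 := nrm_ge0 (h y - h x).
have b1 : nrm (g y - g x) * nrm (h y - h x) <= eta * 1.
  by apply: ler_pM => //; lra.
have b2 : nrm (g y - g x) * nrm (h x) <= eta * nrm (h x) by rewrite ler_wpM2r //; lra.
have b3 : nrm (g x) * nrm (h y - h x) <= nrm (g x) * eta by rewrite ler_wpM2l //; lra.
have e3 : eta * N < e by have : 0 < eta * N; [rewrite mulr_gt0|lra].
by rewrite /N in e3; lra.
Qed.

(** The Leibniz formula, for any class of functions closed under sums and
    products. *)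
Lemma det_closed (P : (V -> C) -> Prop) k (M : V -> 'M[C]_k) :
  (forall c : C, P (fun=> c)) -> (forall g h, P g -> P h -> P (fun x => g x + h x)) ->
  (forall g h, P g -> P h -> P (fun x => g x * h x)) ->
  (forall i j, P (fun x => M x i j)) -> P (fun x => \det (M x)).
Proof.
move=> Pc PD PM H; rewrite /determinant.
elim: (index_enum _) => [|s r IH].
  rewrite (_ : (fun _ => _) = fun=> 0); first exact: Pc.
  by apply/funext => x; rewrite big_nil.
rewrite (_ : (fun _ => _) = fun x => (-1) ^+ s * (\prod_i M x i (s i)) +
   \sum_(s <- r) (-1) ^+ s * \prod_i M x i (s i)); last first.
  by apply/funext => x; rewrite big_cons.
apply: PD; last exact: IH.
apply: (PM (fun=> _)); first exact: Pc.
elim: (index_enum _) => [|i t IHt].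
  rewrite (_ : (fun _ => _) = fun=> 1); first exact: Pc.
  by apply/funext => x; rewrite big_nil.
rewrite (_ : (fun _ => _) = fun x => M x i (s i) * \prod_(i <- t) M x i (s i)).
  by apply: PM; [exact: H|exact: IHt].
by apply/funext => x; rewrite big_cons.
Qed.

End PolynomialFunctions.

Section Minors.
Variables (R : realType) (n l : nat).
Local Notation C := (Cplx R).
Local Notation V := 'M[C]_(n, l.+1).
Implicit Types (x y z : V) (e : 'I_n * 'I_l.+1) (i : 'I_n).

Definition minor_index : finType := {J : {set 'I_n.+1} | #|J| == l.+1}.
Definition minor (J : minor_index) x : C := Delta (val J) x.
Implicit Types J I : minor_index.

Local Notation arr := arrangement_matrix.

Lemma arr_lift x i j : arr x (lift ord_max i) j = x i j.
Proof. by rewrite mxE liftK. Qed.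
Lemma arr_max x j : arr x ord_max j = (j == ord0)%:R.
Proof. by rewrite mxE unlift_none. Qed.

Definition sel J (k : 'I_l.+1) : 'I_n.+1 := nth ord0 (enum (val J)) k.

Lemma size_sel J : size (enum (val J)) = l.+1.
Proof. by rewrite -cardE; apply/eqP; exact: (valP J). Qed.
Lemma sel_in J k : sel J k \in val J.
Proof. by rewrite -mem_enum mem_nth // size_sel. Qed.
Lemma sel_inj J : injective (sel J).
Proof.
move=> a b /eqP; rewrite nth_uniq ?size_sel ?enum_uniq //.
by move=> /eqP /val_inj.
Qed.
Lemma sel_surj J r : r \in val J -> exists k, sel J k = r.
Proof.
move=> rJ; have rs : (index r (enum (val J)) < l.+1)%N by move: rJ; rewrite -mem_enum -index_mem size_sel.
by exists (Ordinal rs); rewrite /sel nth_index // mem_enum.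
Qed.

Lemma minorE J x : minor J x = \det (rowsub (sel J) (arr x)).
Proof. by []. Qed.

(** Reordering the selected rows only changes the sign. *)
Lemma det_rowsub_neq0 (M : 'M[C]_(n.+1, l.+1)) J (phi : 'I_l.+1 -> 'I_n.+1) :
  injective phi -> (forall k, phi k \in val J) ->
  (\det (rowsub phi M) != 0) = (\det (rowsub (sel J) M) != 0).
Proof.
move=> phi_inj phiJ.
have ex k : exists k', sel J k' = phi k by apply: sel_surj.
have [s Hs] := choice ex.
have s_inj : injective s by move=> a b E; apply: phi_inj; rewrite -!Hs E.
have -> : rowsub phi M = row_perm (perm s_inj) (rowsub (sel J) M).
  by apply/matrixP => a b; rewrite !mxE permE Hs.
by rewrite row_permE det_mulmx det_perm mulf_eq0 negb_or signr_eq0.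
Qed.

Lemma minor_closed (P : (V -> C) -> Prop) J :
  (forall c : C, P (fun=> c)) -> (forall g h, P g -> P h -> P (fun x => g x + h x)) ->
  (forall g h, P g -> P h -> P (fun x => g x * h x)) ->
  (forall i j, P (fun x : V => x i j)) -> P (minor J).
Proof.
move=> Pc PD PM H; apply: (det_closed Pc PD PM) => a b.
rewrite (_ : (fun _ => _) = fun x => arr x (sel J a) b); last first.
  by apply/funext => x; rewrite mxE.
have [i|] := unliftP ord_max (sel J a) => ->.
  rewrite (_ : (fun _ => _) = fun x : V => x i b); first exact: H.
  by apply/funext => x; rewrite arr_lift.
rewrite (_ : (fun _ => _) = fun x : V => (b == ord0)%:R); first exact: Pc.
by apply/funext => x; rewrite arr_max.
Qed.

Lemma contF_minor J : contF (minor J).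
Proof.
apply: (@minor_closed (@contF R n l.+1)); [exact: contF_cst|exact: contF_add|exact: contF_mul|exact: contF_crd].
Qed.

Lemma pol_minor J : pol (minor J).
Proof. by apply: (@minor_closed (@pol R n l.+1)); [exact: pol_cst|exact: pol_add|exact: pol_mul|exact: pol_crd]. Qed.

Definition setrow x i (r : 'rV[C]_l.+1) : V := \matrix_(a, b) (if a == i then r 0 b else x a b).

Lemma setrowE x i r a b : setrow x i r a b = if a == i then r 0 b else x a b.
Proof. by rewrite mxE. Qed.

Lemma minor_multilinear J i x y z (b c : C) : lift ord_max i \in val J ->
  (forall j, x i j = b * y i j + c * z i j) ->
  (forall i' j, i' != i -> y i' j = x i' j /\ z i' j = x i' j) ->
  minor J x = b * minor J y + c * minor J z.
Proof.
move=> /sel_surj [k0 k0E] H1 H2; rewrite !minorE.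
have other (w : V) : (forall i' j, i' != i -> w i' j = x i' j) ->
    row' k0 (rowsub (sel J) (arr w)) = row' k0 (rowsub (sel J) (arr x)).
  move=> H; apply/matrixP => a j; rewrite !mxE; case: unliftP => // i' E.
  rewrite H //; apply/eqP => ii; have /sel_inj/eqP : sel J (lift k0 a) = sel J k0.
    by rewrite k0E E ii.
  by rewrite eq_sym (negbTE (neq_lift _ _)).
apply: (determinant_multilinear (i0 := k0)).
- by apply/rowP => j; rewrite !mxE k0E liftK; exact: H1.
- by apply: other => i' j ii; case: (H2 i' j ii).
- by apply: other => i' j ii; case: (H2 i' j ii).
Qed.

Lemma minor_notin J i x y : lift ord_max i \notin val J ->
  (forall i' j, i' != i -> y i' j = x i' j) -> minor J y = minor J x.
Proof.
move=> iJ H; rewrite !minorE; congr (\det _); apply/matrixP => a b; rewrite !mxE.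
case: unliftP => // i' E; rewrite H //; apply/eqP => ii.
by case/negP: iJ; rewrite -ii -E sel_in.
Qed.

Lemma minor_aff J x e (v : C) :
  minor J (upd x e v) = icept minor J e x + v * slope minor J e x.
Proof.
rewrite /icept /slope.
have [iJ|iJ] := boolP (lift ord_max e.1 \in val J); last first.
  have E u u' : minor J (upd x e u) = minor J (upd x e u').
    apply: (minor_notin iJ) => i' j ii; rewrite !updE.
    by case: eqP => // E; move: ii; rewrite -E eqxx.
  by rewrite (E v 0) (E 1 0) subrr mulr0 addr0.
rewrite (@minor_multilinear J e.1 (upd x e v) (upd x e 0) (upd x e 1) (1 - v) v) //.
- by ring.
- by move=> j; rewrite !updE; case: eqP => _; ring.
- move=> i' j ii; rewrite !updE; case: eqP => // E.
  by move: ii; rewrite -E eqxx.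
Qed.

Lemma slope_notin J x e : lift ord_max e.1 \notin val J -> slope minor J e x = 0.
Proof.
move=> iJ; rewrite /slope (minor_notin (x := upd x e 0) iJ) ?subrr //.
by move=> i' j ii; rewrite !updE; case: eqP => // E; move: ii; rewrite -E eqxx.
Qed.

Lemma slope_setrow J x e : lift ord_max e.1 \in val J ->
  slope minor J e x = minor J (setrow x e.1 (delta_mx 0 e.2)).
Proof.
move=> iJ; rewrite /slope.
rewrite (@minor_multilinear J e.1 (upd x e 1) (upd x e 0) (setrow x e.1 (delta_mx 0 e.2)) 1 1) //.
- by rewrite !mul1r addrAC subrr add0r.
- move=> j; rewrite !updE mxE eqxx mxE !mul1r eqxx /=.
  case: e {iJ} => i k /=; rewrite xpair_eqE eqxx /= eq_sym.
  by case: eqP; rewrite ?add0r ?addr0.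
- move=> i' j ii; rewrite !updE mxE (negbTE ii).
  by case: eqP => // E; move: ii; rewrite -E eqxx.
Qed.

Lemma setrow_same x i r r' : setrow (setrow x i r) i r' = setrow x i r'.
Proof. by apply/matrixP => a b; rewrite !mxE; case: eqP. Qed.

Lemma slope_row_indep J x e r : lift ord_max e.1 \in val J ->
  slope minor J e (setrow x e.1 r) = slope minor J e x.
Proof. by move=> iJ; rewrite !slope_setrow // setrow_same. Qed.

Lemma minor_setrow0 J x i : lift ord_max i \in val J -> minor J (setrow x i 0) = 0.
Proof.
move=> iJ; rewrite (@minor_multilinear J i _ x x 0 0) ?mul0r ?addr0 //.
- by move=> j; rewrite setrowE eqxx mxE !mul0r addr0.
- by move=> i' j ii; rewrite setrowE (negbTE ii).
Qed.

Lemma arr_setrow x i r a j : arr (setrow x i r) a j =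
  if a == lift ord_max i then r 0 j else arr x a j.
Proof.
rewrite [LHS]mxE; case: unliftP => [i'|] -> /=.
  by rewrite (inj_eq lift_inj) arr_lift mxE.
by rewrite arr_max (negbTE (neq_lift _ _)).
Qed.

Lemma minor_repeat J x i k : lift ord_max i \in val J -> k \in val J -> k != lift ord_max i ->
  minor J (setrow x i (row k (arr x))) = 0.
Proof.
move=> /sel_surj [a aE] /sel_surj [b bE] ki; rewrite minorE.
apply: (determinant_alternate (i1 := a) (i2 := b)).
  by apply: contraNneq ki => ab; rewrite -bE -ab aE.
by move=> j; rewrite [LHS]mxE [RHS]mxE !arr_setrow aE bE eqxx (negbTE ki) mxE.
Qed.

(** Up to sign this is another minor of x, with k in place of the row i. *)
Lemma minor_exchange I x i k : (forall J, minor J x != 0) -> lift ord_max i \in val I ->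
  k \notin val I -> minor I (setrow x i (row k (arr x))) != 0.
Proof.
move=> Ux iI kI.
have cardI' : #|k |: (val I :\ lift ord_max i)| == l.+1.
  have := cardsD1 (lift ord_max i) (val I); rewrite iI (eqP (valP I)) add1n => -[E].
  by rewrite cardsU1 !inE (negbTE kI) andbF add1n eqSS; apply/eqP; exact: (esym E).
pose I' : minor_index := exist (fun J : {set 'I_n.+1} => #|J| == l.+1) _ cardI'.
pose phi a := if sel I a == lift ord_max i then k else sel I a.
have -> : minor I (setrow x i (row k (arr x))) = \det (rowsub phi (arr x)).
  rewrite minorE; congr (\det _); apply/matrixP => a b.
  by rewrite [LHS]mxE [RHS]mxE arr_setrow /phi; case: eqP => // _; rewrite mxE.
rewrite (@det_rowsub_neq0 _ I') ?Ux //.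
  move=> a b; rewrite /phi; case: eqP => [ea|na]; case: eqP => [eb|nb].
  - by move=> _; apply: (@sel_inj I); rewrite ea eb.
  - by move=> E; case/negP: kI; rewrite E sel_in.
  - by move=> E; case/negP: kI; rewrite -E sel_in.
  - exact: sel_inj.
move=> a; rewrite /phi; case: eqP => [_|/eqP na]; apply/setU1P; [by left|right].
by apply/setD1P; split=> //; exact: sel_in.
Qed.

Lemma minor_swap J x i i' : lift ord_max i \in val J -> lift ord_max i' \in val J ->
  minor J x != 0 -> minor J (xrow i i' x) != 0.
Proof.
move=> iJ i'J mx; pose t := tperm (lift ord_max i) (lift ord_max i').
have -> : minor J (xrow i i' x) = \det (rowsub (fun a => t (sel J a)) (arr x)).
  rewrite minorE; congr (\det _); apply/matrixP => a b; rewrite [LHS]mxE [RHS]mxE.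
  rewrite [LHS]mxE; case: unliftP => [i''|] E.
    rewrite E mxE.
    have -> : t (lift ord_max i'') = lift ord_max (tperm i i' i'').
      by rewrite /t inj_tperm //; exact: lift_inj.
    by rewrite arr_lift.
  by rewrite E /t tpermD ?arr_max // eq_sym neq_lift.
rewrite (@det_rowsub_neq0 _ J (fun a => t (sel J a))) //.
  by move=> a b /perm_inj; exact: sel_inj.
move=> a; rewrite /t; case: tpermP => // _ _; exact: sel_in.
Qed.

Lemma slope_in J x e : slope minor J e x != 0 -> lift ord_max e.1 \in val J.
Proof. by apply: contraNT => /slope_notin ->. Qed.

(** It suffices to find a matrix where the minor J vanishes but the minor I does
    not, and where the slope of J is nonzero; the latter does not depend on the row
    of e. If I does not select this row, set the row to zero. Otherwise copy into
    it a row k in J but not in I, which makes two selected rows of J equal. *)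
Lemma minor_rslt J I e x0 : (forall J, minor J x0 != 0) -> J != I ->
  (exists x, slope minor J e x != 0) -> exists x, rslt minor J I e x != 0.
Proof.
move=> U0 JI [x1 sx1]; have iJ := slope_in sx1.
pose g (k : option minor_index) x := if k is Some L then minor L x else slope minor J e x.
have gpol k : pol (g k) by case: k => [L|]; [exact: pol_minor|exact: (pol_slope pol_minor)].
have [x _ Hx] := @pol_dense R n l.+1 (option minor_index) g 0 1 ltr01 gpol.
have sx : slope minor J e x != 0 by apply: (Hx None); exists x1.
have Ux L : minor L x != 0 by apply: (Hx (Some L)); exists x0; exact: U0.
suff [r f0 fI] : exists2 r, minor J (setrow x e.1 r) = 0 & minor I (setrow x e.1 r) != 0.
  exists (setrow x e.1 r); set z := setrow x e.1 r in f0 fI *.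
  have E := @rslt_root R n l.+1 minor_index minor minor_aff J I e z (crd z e).
  rewrite upd_crd in E; rewrite (E f0); apply: mulf_neq0; last exact: fI.
  by rewrite slope_row_indep; [exact: sx|exact: iJ].
have [iI|iI] := boolP (lift ord_max e.1 \in val I); last first.
  exists 0; first exact: minor_setrow0.
  rewrite (minor_notin (x := x) iI) // => i' j ii; by rewrite setrowE (negbTE ii).
have /subsetPn [k kJ kI] : ~~ (val J \subset val I).
  apply: contra JI => sJI; apply/eqP/val_inj/eqP.
  by rewrite eqEcard sJI (eqP (valP J)) (eqP (valP I)) leqnn.
exists (row k (arr x)); last exact: minor_exchange.
by apply: minor_repeat => //; apply: contraNneq kI => ->.
Qed.

(** The slope of a minor in e does not depend on the row e.1, so this row can be
    chosen to make the minor vanish: zero if e and e' are in the same row.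
    Otherwise it becomes a copy of the row e'.1; then the slopes at e' and at the
    entry e2 in row e.1 and column e'.2 agree up to sign. *)
Lemma minor_link J e e' : (exists x, slope minor J e x != 0) ->
  (exists x, slope minor J e' x != 0) ->
  exists x, [/\ minor J x = 0, slope minor J e x != 0 & slope minor J e' x != 0].
Proof.
move=> [x1 s1] [x2 s2]; have iJ := slope_in s1; have iJ' := slope_in s2.
have both e2 : (exists x, slope minor J e2 x != 0) ->
    exists x, slope minor J e x != 0 /\ slope minor J e2 x != 0.
  move=> [x3 s3].
  have [z] := pol_mul_neq0 (pol_slope pol_minor J e) (pol_slope pol_minor J e2) s1 s3.
  by rewrite mulf_eq0 negb_or => /andP[h1 h2]; exists z; split; [exact: h1|exact: h2].
have [ee|ee] := eqVneq e.1 e'.1.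
  have [x [sx sx']] := both e' (ex_intro _ x2 s2).
  exists (setrow x e.1 0); split; first exact: minor_setrow0.
    by rewrite slope_row_indep; [exact: sx|exact: iJ].
  by rewrite ee slope_row_indep; [exact: sx'|exact: iJ'].
pose e2 := (e.1, e'.2).
have xrowE (x : V) a b : xrow e.1 e'.1 x a b = x (tperm e.1 e'.1 a) b by rewrite mxE.
have swap_row x : slope minor J e' x != 0 -> slope minor J e2 (xrow e.1 e'.1 x) != 0.
  rewrite (slope_setrow _ iJ') (@slope_setrow J _ e2 iJ) => /(minor_swap iJ iJ').
  rewrite (_ : xrow _ _ _ = setrow (xrow e.1 e'.1 x) e2.1 (delta_mx 0 e2.2)) //.
  apply/matrixP => a b; rewrite xrowE !setrowE xrowE.
  have -> : (tperm e.1 e'.1 a == e'.1) = (a == e.1).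
    by rewrite -[X in _ == X](tpermL e.1 e'.1) (inj_eq perm_inj).
  by [].
have [|x [sx sx']] := both e2; first by exists (xrow e.1 e'.1 x2); exact: swap_row.
have e1 : lift ord_max e'.1 != lift ord_max e.1 :> 'I_n.+1.
  by rewrite (inj_eq lift_inj) eq_sym.
exists (setrow x e.1 (row (lift ord_max e'.1) (arr x))); split.
- exact: minor_repeat.
- by rewrite slope_row_indep; [exact: sx|exact: iJ].
- move: sx'; rewrite (@slope_setrow J _ e2 iJ) (slope_setrow _ iJ') => /(minor_swap iJ iJ').
  set y := setrow (setrow _ _ _) _ _.
  rewrite (_ : xrow _ _ _ = y) //.
  apply/matrixP => a b; rewrite /y xrowE !setrowE [row _ _ 0 b]mxE arr_lift /=.
  case: tpermP => [->|->|/eqP na /eqP nb].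
  + by rewrite eq_sym !(negbTE ee) eqxx.
  + by rewrite !eqxx.
  + by rewrite (negbTE na) (negbTE nb).
Qed.

End Minors.

Local Open Scope quotient_scope.

(** * Points of projective space and local lifts *)

Section ProjectivePoints.
Variables (R : realType) (n l : nat).
Local Notation C := (Cplx R).
Local Notation V := 'M[C]_(n, l.+1).
Local Notation nzv := (@nonzero_vectors R l).
Local Notation B := (@general_position R n l).

Lemma nzv_neq0 (u : nzv) : set_val u != 0.
Proof. exact: (set_valP u). Qed.

Definition nzv_of (v : 'rV[C]_l.+1) (v0 : v != 0) : nzv := exist _ v (mem_set v0).

Lemma const_neq0 : const_mx 1 != 0 :> 'rV[C]_l.+1.
Proof. by apply/eqP => /rowP /(_ ord0) /eqP; rewrite !mxE oner_eq0. Qed.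

Definition pt (v : 'rV[C]_l.+1) : CP R l :=
  \pi_(CP R l) (if pselect (v != 0) is left v0 then nzv_of v0 else nzv_of const_neq0).

Lemma pt_pi (u : nzv) : pt (set_val u) = \pi_(CP R l) u.
Proof.
rewrite /pt; case: pselect => [v0|[]]; last exact: nzv_neq0.
by congr (\pi_(CP R l) _); apply/val_inj.
Qed.

Lemma coords_pt (v : 'rV[C]_l.+1) : v != 0 -> homogeneous_coordinates (pt v) v.
Proof. by move=> v0; exists (nzv_of v0); split=> //; rewrite -pt_pi. Qed.

Lemma coords_eq_pt p (v : 'rV[C]_l.+1) : homogeneous_coordinates p v -> v != 0 /\ pt v = p.
Proof. by move=> [u [<- <-]]; rewrite pt_pi; split=> //; exact: nzv_neq0. Qed.

Lemma pt_scale (v : 'rV[C]_l.+1) (c : C) : v != 0 -> c != 0 -> pt (c *: v) = pt v.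
Proof.
move=> v0 c0; have cv0 : c *: v != 0 by rewrite scaler_eq0 negb_or c0.
rewrite -[v]/(set_val (nzv_of v0)) -[_ *: _]/(set_val (nzv_of cv0)) !pt_pi.
by apply/eqmodP; apply/asboolP; exists c.
Qed.

Lemma pt_eq (v v' : 'rV[C]_l.+1) : v != 0 -> v' != 0 -> pt v = pt v' ->
  exists2 c : C, c != 0 & v = c *: v'.
Proof.
move=> v0 v'0; rewrite -[v]/(set_val (nzv_of v0)) -[v']/(set_val (nzv_of v'0)) !pt_pi.
by move=> /eqmodP /asboolP.
Qed.

Lemma pt_cont (T : topologicalType) (g : T -> 'rV[C]_l.+1) :
  (forall j, continuous (fun t => g t 0 j)) -> (forall t, g t != 0) ->
  continuous (fun t => pt (g t)).
Proof.
move=> gc g0.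
pose h t := nzv_of (g0 t).
have -> : (fun t => pt (g t)) = (fun t => \pi_(CP R l) (h t)).
  by apply/funext => t; rewrite -pt_pi.
apply: (cont_comp _ (@pi_continuous _ _)).
apply/continuous_comp_initial => t U [P /= nP PU].
have : \forall t' \near t, forall k : 'I_1 * 'I_l.+1, P k.1 k.2 (g t' k.1 k.2).
  by apply: filter_forall => -[a j]; have := nP a j; rewrite /= ord1 => /gc.
by apply: filterS => t' H; apply: PU => a j; exact: (H (a, j)).
Qed.

(** The affine chart where the coordinate k does not vanish, and the
    representative which is 1 in this coordinate. *)
Definition in_chart (k : 'I_l.+1) (p : CP R l) : Prop := set_val (repr p) 0 k != 0.
Definition chart (k : 'I_l.+1) (p : CP R l) : 'rV[C]_l.+1 :=
  (set_val (repr p) 0 k)^-1 *: set_val (repr p).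

Lemma pt_repr p : pt (set_val (repr p)) = p.
Proof. by rewrite pt_pi reprK. Qed.

Lemma repr_pi (u : nzv) : exists2 c : C, c != 0 & set_val (repr (\pi_(CP R l) u)) = c *: set_val u.
Proof.
by apply: pt_eq; rewrite ?pt_repr ?pt_pi //; exact: nzv_neq0.
Qed.

Lemma chart_pi k (u : nzv) : in_chart k (\pi_(CP R l) u) <-> set_val u 0 k != 0.
Proof.
have [c c0 E] := repr_pi u; rewrite /in_chart E mxE mulf_eq0 negb_or c0.
by [].
Qed.

Lemma chart_piE k (u : nzv) j : set_val u 0 k != 0 ->
  chart k (\pi_(CP R l) u) 0 j = (set_val u 0 k)^-1 * set_val u 0 j.
Proof.
move=> uk; have [c c0 E] := repr_pi u; rewrite /chart E !mxE.
by field; rewrite uk.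
Qed.

Lemma pt_chart k p : in_chart k p -> chart k p != 0 /\ pt (chart k p) = p.
Proof.
move=> pk; have v0 := nzv_neq0 (repr p).
have k0 : (set_val (repr p) 0 k)^-1 != 0 by rewrite invr_eq0.
by rewrite /chart scaler_eq0 negb_or k0 v0 pt_scale // pt_repr.
Qed.

Lemma in_chart_ex p : exists k, in_chart k p.
Proof.
apply: contrapT => nk; have := nzv_neq0 (repr p); case/eqP.
apply/rowP => k; rewrite mxE; apply/eqP; apply: contrapT => /negP pk.
by apply: nk; exists k.
Qed.

Lemma nzv_coord_cont j : continuous (fun u : nzv => set_val u 0 j : C).
Proof.
move=> u; apply: (@continuous_comp _ _ _ (set_val : nzv -> _) (fun v : 'rV[C]_l.+1 => v 0 j)).
  exact: (@initial_continuous _ _ (set_val : nzv -> _) u).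
exact: coord_continuous.
Qed.

Lemma chart_open k j (W : set C) : open W ->
  open [set q : CP R l | in_chart k q /\ W (chart k q 0 j)].
Proof.
move=> oW'.
rewrite /open /= /quotient_open openE => u [/chart_pi uk W'u].
rewrite chart_piE // in W'u.
have c0 : nbhs u [set u' : nzv | set_val u' 0 k != 0].
  have nk : 0 < nrm (set_val u 0 k : C) by rewrite nrm_gt0.
  move: ((contC_nrm _).1 (@nzv_coord_cont k) u _ nk).
  apply: filterS => u' /=.
  by apply: contraTneq => ->; rewrite sub0r nrmN ltxx.
have c1 : nbhs u [set u' : nzv | W ((set_val u' 0 k)^-1 * set_val u' 0 j)].
  have : (fun u' : nzv => (set_val u' 0 k)^-1 * set_val u' 0 j : C) @ u --> (set_val u 0 k)^-1 * set_val u 0 j.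
    apply: cvgM; [exact: (nbhs_filter u)| |exact: nzv_coord_cont].
    exact: (@cvgV C nzv (nbhs u) (nbhs_filter u) (fun u' : nzv => set_val u' 0 k) _ uk (@nzv_coord_cont k u)).
  move=> H; have HW : nbhs ((set_val u 0 k)^-1 * set_val u 0 j : C) W.
    by apply: open_nbhs_nbhs.
  exact: (H W HW).
apply: filterS (filterI c0 c1) => u' [uk' Wu'].
by split; [exact/chart_pi|rewrite chart_piE].
Qed.

Lemma chart_cont k p j (W : set C) : in_chart k p -> nbhs (chart k p 0 j) W ->
  nbhs p [set q | in_chart k q /\ W (chart k q 0 j)].
Proof.
move=> pk; rewrite !nbhsE => -[W' [oW' W'p] W'W].
exists [set q | in_chart k q /\ W' (chart k q 0 j)].
  by split=> //; exact: chart_open.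
by move=> q [qk Wq]; split=> //; apply: W'W.
Qed.

Lemma in_chart_near k p : in_chart k p -> nbhs p [set q | in_chart k q].
Proof.
move=> pk; rewrite nbhsE; exists [set q | in_chart k q /\ setT (chart k q 0 k)].
  by split=> //; apply: chart_open; exact: openT.
by move=> q [].
Qed.

End ProjectivePoints.

Section ConfigurationSpace.
Variables (R : realType) (n l : nat).
Local Notation C := (Cplx R).
Local Notation V := 'M[C]_(n, l.+1).
Local Notation B := (@general_position R n l).
Local Notation U := (Ucomp (@minor R n l)).
Hypothesis hn : (l <= n)%N.
Implicit Types (x : V) (p : CPn R n l) (i : 'I_n).

Lemma cont_CPn (T : topologicalType) (g : T -> CPn R n l) :
  (forall i, continuous (fun t => g t i)) -> continuous g.
Proof.
move=> H t; apply/cvg_sup => i.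
apply: (@continuous_comp_initial (CPn R n l) T (CP R l) (fun f => f i) g).
exact: H.
Qed.

Lemma eval_CPn i : continuous (fun p : CPn R n l => p i).
Proof. exact: (@proj_continuous _ (fun=> CP R l) i). Qed.

Definition rowpts (x : V) : CPn R n l := fun i => pt (row i x).

(** Every row is selected by some minor. *)
Lemma row_neq0 x i : U x -> row i x != 0.
Proof.
move=> Ux.
have [J Jsub Jcard] : exists2 J : {set 'I_n.+1}, lift ord_max i \in J & (#|J| == l.+1)%N.
  have ln : (l.+1 <= n.+1)%N by [].
  pose phi (k : 'I_l.+1) : 'I_n.+1 := tperm ord0 (lift ord_max i) (widen_ord ln k).
  have phi_inj : injective phi by move=> a b /perm_inj /(congr1 val) /= /val_inj.
  exists [set phi k | k in 'I_l.+1]%SET; last by rewrite card_imset // card_ord.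
  apply/imsetP; exists ord0 => //; rewrite /phi (_ : widen_ord ln ord0 = ord0) ?tpermL //.
  exact/val_inj.
pose J' : minor_index n l := exist (fun J : {set 'I_n.+1} => #|J| == l.+1) J Jcard.
apply: contraNneq (Ux J') => r0.
have -> : x = setrow x i 0.
  apply/matrixP => a b; rewrite setrowE; case: eqP => // ->.
  by move/rowP: r0 => /(_ b); rewrite !mxE.
by apply/eqP; apply: minor_setrow0.
Qed.

Definition scale_rows (d : 'I_n -> C) x : V := \matrix_(i, j) (d i * x i j).

Lemma minor_scale J x (d : 'I_n -> C) : (forall i, d i != 0) ->
  exists2 c : C, c != 0 & minor J (scale_rows d x) = c * minor J x.
Proof.
move=> d0.
pose e (k : 'I_l.+1) : C := if unlift ord_max (sel J k) is Some i then d i else 1.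
exists (\prod_k e k).
  apply/prodf_neq0 => k _; rewrite /e.
  by case: unliftP => [i|] _ //; exact: oner_neq0.
rewrite !minorE.
have -> : rowsub (sel J) (arrangement_matrix (scale_rows d x)) =
   diag_mx (\row_k e k) *m rowsub (sel J) (arrangement_matrix x).
  apply/matrixP => a b; rewrite mul_diag_mx [LHS]mxE [RHS]mxE [rowsub _ _ a b]mxE.
  rewrite [(\row__ _) 0 a]mxE /e !mxE.
  by case: unliftP => [i|] _; rewrite ?mxE ?mul1r.
rewrite det_mulmx det_diag; congr (_ * _).
by apply: eq_bigr => k _; rewrite mxE.
Qed.

Lemma U_scale x (d : 'I_n -> C) : (forall i, d i != 0) -> U x -> U (scale_rows d x).
Proof.
by move=> d0 Ux J; have [c c0 ->] := minor_scale J x d0; rewrite mulf_neq0.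
Qed.

Lemma represents_rowpts x : U x -> represents x (rowpts x).
Proof. by move=> Ux i; apply: coords_pt; exact: row_neq0. Qed.

Lemma represents_eq x p : represents x p -> rowpts x = p.
Proof. by move=> H; apply/funext => i; case: (coords_eq_pt (H i)). Qed.

Lemma represents_scale (x x' : V) p : represents x p -> represents x' p ->
  exists2 d : 'I_n -> C, forall i, d i != 0 & x' = scale_rows d x.
Proof.
move=> H H'.
have ex i : exists c : C, c != 0 /\ row i x' = c *: row i x.
  have [v0 E] := coords_eq_pt (H i); have [v0' E'] := coords_eq_pt (H' i).
  have [|c c0 Ec] := @pt_eq R l (row i x') (row i x) v0' v0; first by rewrite E E'.
  by exists c.
have [d Hd] := choice ex; exists d; first by move=> i; case: (Hd i).
apply/matrixP => i j; rewrite mxE; have [_ /rowP /(_ j)] := Hd i.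
by rewrite !mxE.
Qed.

Lemma U_general_position x : U x -> B (rowpts x).
Proof.
move=> Ux [J /= Jcard [A HA DA]].
have [d d0 E] := represents_scale (represents_rowpts Ux) HA.
pose J' : minor_index n l := exist (fun J : {set 'I_n.+1} => #|J| == l.+1) J (introT eqP Jcard).
have := U_scale d0 Ux J'; rewrite -E => /negP; apply; apply/eqP; exact: DA.
Qed.

Lemma represents_U x p : B p -> represents x p -> U x.
Proof.
move=> Bp H J; apply/eqP => mJ; apply: Bp; exists (val J); first exact/eqP/(valP J).
by exists x.
Qed.

Lemma lift_point (b : B) : exists x, represents x (set_val b).
Proof.
have ex i : exists v, homogeneous_coordinates (set_val b i) v.
  by exists (set_val (repr (set_val b i))); exists (repr (set_val b i)); rewrite reprK.
have [v Hv] := choice ex; exists (\matrix_(i, j) v i 0 j) => i.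
rewrite (_ : row i _ = v i) //; apply/rowP => j; by rewrite !mxE.
Qed.

Variable y : B.

Definition projB (x : V) : B :=
  if pselect (B (rowpts x)) is left h then exist _ (rowpts x) (mem_set h) else y.

Lemma val_projB x : U x -> set_val (projB x) = rowpts x.
Proof.
by move=> /U_general_position h; rewrite /projB; case: pselect.
Qed.

Lemma projB_represents x (b : B) : represents x (set_val b) -> U x /\ projB x = b.
Proof.
move=> H; have Ux : U x by apply: represents_U H; exact: (set_valP b).
by split=> //; apply/val_inj; rewrite [LHS](val_projB Ux) (represents_eq H).
Qed.

Lemma cont_projB (T : topologicalType) (g : T -> V) : contM g -> (forall t, U (g t)) ->
  continuous (fun t => projB (g t)).
Proof.
move=> gc Ug; apply/continuous_comp_initial.
rewrite (_ : _ \o _ = fun t => rowpts (g t)); last first.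
  by apply/funext => t; exact: val_projB.
apply: cont_CPn => i; apply: pt_cont => [j|t]; last exact: row_neq0.
rewrite (_ : (fun _ => _) = fun t => g t i j); first exact: gc.
by apply/funext => t; rewrite mxE.
Qed.

(** Near t each coordinate stays in one affine chart. The lift is made total by
    stopping at the ends of a small interval around t. *)
Lemma local_lift (g : R -> B) (t : R) : continuous g -> exists2 e : R, 0 < e &
  exists h : R -> V, [/\ contM h, forall u, U (h u) &
    forall u, `|u - t| <= e -> represents (h u) (set_val (g u))].
Proof.
move=> gc.
pose G i (u : R) : CP R l := set_val (g u) i.
have Gc i : continuous (G i).
  apply: (@cont_comp _ _ _ (fun u => set_val (g u)) (fun p : CPn R n l => p i)).
    apply: (cont_comp gc); exact: (@initial_continuous _ _ (set_val : B -> _)).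
  exact: eval_CPn.
have [k Hk] := choice (fun i => in_chart_ex (G i t)).
pose s (u : R) : V := \matrix_(i, j) chart (k i) (G i u) 0 j.
have near_chart : \forall u \near t, forall i, in_chart (k i) (G i u).
  apply: (@filter_forall R 'I_n (fun i u => in_chart (k i) (G i u)) (nbhs t)) => i.
  have H2 := in_chart_near (Hk i).
  exact: (Gc i t _ H2).
move: near_chart => /nbhs_ballP [e e0 He].
pose cl (u : R) := t + Num.max (- (e / 2)) (Num.min (e / 2) (u - t)).
have clc : continuous cl.
  move=> u; apply: cvgD; first exact: cvg_cst.
  apply: (@continuous_max R R (fun=> - (e / 2)) (fun u => Num.min (e / 2) (u - t)) u); first exact: cvg_cst.
  apply: (@continuous_min R R (fun=> e / 2) (fun u => u - t) u); first exact: cvg_cst.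
  by apply: cvgB; [exact: cvg_id|exact: cvg_cst].
have e20 : 0 < e / 2 by move: e0 => /=; lra.
have cl_in u i : in_chart (k i) (G i (cl u)).
  apply: He; rewrite /ball /= /cl opprD addrA subrr sub0r normrN ltr_norml.
  rewrite lt_max gt_max gt_min; apply/andP; split.
    by apply/orP; left; move: e20; lra.
  by apply/andP; split; [move: e20; lra|apply/orP; left; move: e20; lra].
have rep u : represents (s (cl u)) (set_val (g (cl u))).
  move=> i; have [v0 E] := pt_chart (cl_in u i).
  rewrite (_ : row i _ = chart (k i) (G i (cl u))); last by apply/rowP => j; rewrite !mxE.
  by rewrite -[set_val (g (cl u)) i]E; apply: coords_pt.
exists (e / 2); first exact: e20.
exists (fun u => s (cl u)); split.
- move=> i j u W.
  rewrite /= {1}/s mxE => HW.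
  have H1 := @chart_cont R l (k i) (G i (cl u)) j W (cl_in u i) HW.
  have H2 : \forall u' \near u, in_chart (k i) (G i (cl u')) /\ W (chart (k i) (G i (cl u')) 0 j).
    exact: (cont_comp clc (Gc i) H1).
  rewrite /= nbhs_simpl /=; apply: filterS H2 => u' [_ Wu'] /=.
  by rewrite /s mxE.
- by move=> u; apply: represents_U (rep u); exact: (set_valP (g (cl u))).
- move=> u ut; have E : cl u = u.
    move: ut; rewrite ler_norml /cl => /andP[a b].
    by rewrite min_r // max_r // addrC subrK.
  have E2 : set_val (g u) = set_val (g (cl u)) by rewrite E.
  by rewrite E2; exact: (rep u).
Qed.

End ConfigurationSpace.

(** * Classes of paths in singular chains *)
Lemma freeg_additive_eq (K : choiceType) (A : zmodType) (f g : {freeg K / int} -> A) :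
  {morph f : x y / x - y} -> {morph g : x y / x - y} ->
  (forall x, f << x >> = g << x >>) -> f =1 g.
Proof.
move=> fB gB fg c.
pose f' : {additive _ -> _} := HB.pack f (GRing.isZmodMorphism.Build _ _ f fB).
pose g' : {additive _ -> _} := HB.pack g (GRing.isZmodMorphism.Build _ _ g gB).
rewrite -[f]/(f' : _ -> _) -[g]/(g' : _ -> _) -(freeg_sumE c) !raddf_sum.
apply: eq_bigr => x _.
by rewrite -[coeff x c]intz -freegU_mulz !raddfMz; congr (_ *~ _); exact: fg.
Qed.

Lemma cont_sumR (R : realType) (T : topologicalType) (I : Type) (s : seq I) (g : I -> T -> R) :
  (forall i, continuous (g i)) -> continuous (fun t => \sum_(i <- s) g i t).
Proof.
move=> gc; elim: s => [|i s IH] t.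
  rewrite (_ : (fun _ => _) = fun=> 0); first exact: cvg_cst.
  by apply/funext => u; rewrite big_nil.
rewrite (_ : (fun _ => _) = fun u => g i u + \sum_(j <- s) g j u).
  by apply: cvgD; [exact: gc|exact: IH].
by apply/funext => u; rewrite big_cons.
Qed.

Lemma cont_mulR (R : realType) (T : topologicalType) (g : T -> R) (c : R) :
  continuous g -> continuous (fun t => g t * c).
Proof. by move=> gc t; apply: cvgM; [exact: gc|exact: cvg_cst]. Qed.

Lemma cont_pair (T T1 T2 : topologicalType) (g : T -> T1) (h : T -> T2) :
  continuous g -> continuous h -> continuous (fun t => (g t, h t)).
Proof. by move=> gc hc t; apply: cvg_pair; [exact: gc|exact: hc]. Qed.

(** Chains are compared with paths on the real line through the last barycentric
    coordinate, the one used for loops. *)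
Section PathClass.
Variables (R : realType) (X : topologicalType).

(** Carries the continuity proof, so that a function can be declared a continuous
    map once and for all. *)
Definition mk_cts k (g : std_simplex R k -> X) (gc : continuous g) : std_simplex R k -> X :=
  let _ := gc in g.
HB.instance Definition _ k (g : std_simplex R k -> X) (gc : continuous g) :=
  @isContinuous.Build (std_simplex R k) X (mk_cts gc) gc.

Definition coord1 (t : std_simplex R 1) : R := set_val t 0 ord_max.

Lemma coord_simplex_cont k (j : 'I_k.+1) :
  continuous (fun t : std_simplex R k => set_val t 0 j : R).
Proof.
move=> t; apply: (@continuous_comp _ _ _ (set_val : std_simplex R k -> _)
  (fun v : 'rV[R]_k.+1 => v 0 j)); last exact: coord_continuous.
exact: (@initial_continuous _ _ (set_val : std_simplex R k -> _) t).
Qed.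

Lemma coord1_01 t : 0 <= coord1 t <= 1.
Proof. by have := set_mem (simplex1_coord t); rewrite /= in_itv. Qed.

Lemma coord1_compl (t : std_simplex R 1) : set_val t 0 ord0 = 1 - coord1 t.
Proof.
have [_] := set_valP t; rewrite !big_ord_recl big_ord0 addr0.
rewrite (_ : lift ord0 ord0 = ord_max); last exact/val_inj.
by rewrite /coord1 => <-; rewrite addrK.
Qed.

Lemma path_cont (g : R -> X) : continuous g ->
  continuous (fun t : std_simplex R 1 => g (coord1 t)).
Proof. by move=> gc; apply: (cont_comp _ gc); exact: coord_simplex_cont. Qed.

Definition path_simplex (g : R -> X) (gc : continuous g) : singular_simplex R X 1 :=
  mk_cts (path_cont gc).

Definition pclass (g : R -> X) : chain R X 1 :=
  if pselect (continuous g) is left gc then << path_simplex gc >> else 0.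

Lemma pclassE (g : R -> X) (gc : continuous g) : pclass g = << path_simplex gc >>.
Proof.
by rewrite /pclass; case: pselect => // gc'; rewrite (Prop_irrelevance gc gc').
Qed.

Lemma pclass_ext (g h : R -> X) : continuous g -> continuous h ->
  (forall t : R, 0 <= t <= 1 -> g t = h t) -> pclass g = pclass h.
Proof.
move=> gc hc gh; rewrite (pclassE gc) (pclassE hc); congr (<< _ >>).
by apply/continuousEP => t; apply: gh; exact: coord1_01.
Qed.

Definition aff_pt k (v : 'I_k.+1 -> R * R) (t : std_simplex R k) : R * R :=
  (\sum_j set_val t 0 j * (v j).1, \sum_j set_val t 0 j * (v j).2).

Lemma aff_pt_cont k (v : 'I_k.+1 -> R * R) : continuous (aff_pt v).
Proof.
apply: cont_pair; apply: cont_sumR => j;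
  by apply: cont_mulR; exact: coord_simplex_cont.
Qed.

Lemma aff_pt_face k (v : 'I_k.+2 -> R * R) i (t : std_simplex R k) :
  aff_pt v (face i t) = aff_pt (v \o lift i) t.
Proof.
suff S (c : 'I_k.+2 -> R) : \sum_j set_val (face i t) 0 j * c j =
    \sum_j set_val t 0 j * c (lift i j) by rewrite /aff_pt !S.
rewrite (bigD1 i) //= mxE unlift_none mul0r add0r.
rewrite (reindex_omap (lift i) (unlift i)) /=; last first.
  by move=> j ij; case: unliftP ij => [j' -> //|->]; rewrite eqxx.
apply: eq_big => j; first by rewrite liftK eqxx eq_sym neq_lift.
by move=> _; rewrite mxE liftK.
Qed.

Lemma aff_pt1 (v : 'I_2 -> R * R) (t : std_simplex R 1) :
  aff_pt v t = seg2 (v ord0) (v ord_max) (coord1 t).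
Proof.
rewrite /aff_pt /seg2 !big_ord_recl !big_ord0 !addr0 coord1_compl.
rewrite (_ : lift ord0 ord0 = ord_max); last exact/val_inj.
by rewrite -/(coord1 t); congr (_, _); ring.
Qed.

Lemma seg2_cont a b : continuous (@seg2 R a b).
Proof.
have ac (x d : R) : continuous (fun t : R => x + t * d).
  move=> t; apply: cvgD; first exact: cvg_cst.
  by apply: (@cont_mulR R R id d) => u; exact: cvg_id.
by apply: cont_pair; exact: ac.
Qed.

(** F composed with the affine map from the standard 2-simplex to the triangle
    a b c is a singular simplex with these three faces. *)
Lemma pclass_triangle (F : R * R -> X) : continuous F -> forall a b c : R * R,
  exists d : chain R X 2, boundary d =
    pclass (F \o seg2 b c) - pclass (F \o seg2 a c) + pclass (F \o seg2 a b).
Proof.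
move=> Fc a b c.
pose v (j : 'I_3) := nth c [:: a; b; c] j.
have tc : continuous (fun t : std_simplex R 2 => F (aff_pt v t)).
  by apply: (cont_comp _ Fc); exact: aff_pt_cont.
exists << (mk_cts tc : singular_simplex R X 2) >>.
rewrite /boundary liftU scale1r !big_ord_recl big_ord0 /= addr0.
have sc a' b' : continuous (F \o seg2 a' b') by apply: (cont_comp _ Fc); exact: seg2_cont.
have fE i a' b' : (v \o lift i) ord0 = a' -> (v \o lift i) ord_max = b' ->
    simplex_face (mk_cts tc : singular_simplex R X 2) i = path_simplex (sc a' b').
  move=> <- <-; apply/continuousEP => t; rewrite /= /mk_cts /path_simplex /mk_cts.
  by rewrite aff_pt_face aff_pt1.
rewrite (fE _ b c) // (fE _ a c) // (fE _ a b) // !(pclassE (sc _ _)).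
by rewrite expr0 expr1 -freegUN /bump /= addrA sqrrN expr1n.
Qed.

Variables (Q : zmodType) (q : {additive chain R X 1 -> Q}).
Hypothesis q_boundary : forall b : chain R X 2, q (boundary b) = 0.

Definition pcl (g : R -> X) : Q := q (pclass (g \o @clamp R)).

Lemma pcl_ext (g h : R -> X) : (forall t : R, 0 <= t <= 1 -> g t = h t) -> pcl g = pcl h.
Proof.
move=> gh; rewrite /pcl (_ : g \o _ = h \o @clamp R) //.
by apply/funext => t; apply: gh; exact: clamp01.
Qed.

Lemma pclE (g : R -> X) : continuous g -> pcl g = q (pclass g).
Proof.
move=> gc; rewrite /pcl; congr (q _); apply: pclass_ext => //.
  by apply: (cont_comp _ gc); exact: cont_clamp.
by move=> t t01 /=; rewrite clamp_id.
Qed.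

Lemma pcl_tri (F : R * R -> X) : continuous F -> forall a b c,
  pcl (F \o seg2 a b) + pcl (F \o seg2 b c) = pcl (F \o seg2 a c).
Proof.
move=> Fc a b c; have [d Hd] := pclass_triangle Fc a b c.
have sc a' b' : continuous (F \o seg2 a' b') by apply: (cont_comp _ Fc); exact: seg2_cont.
have := q_boundary d; rewrite Hd raddfD raddfB -!pclE // => E.
by zmod_from E.
Qed.

Lemma pcl_cat (g : R -> X) : continuous g -> forall a b c : R,
  pcl (fun t => g (a + t * (b - a))) + pcl (fun t => g (b + t * (c - b))) =
  pcl (fun t => g (a + t * (c - a))).
Proof.
move=> gc a b c; have Fc : continuous (fun p : R * R => g p.1).
  by apply: (cont_comp _ gc) => p; exact: cvg_fst.
exact: (pcl_tri Fc (a, 0) (b, 0) (c, 0)).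
Qed.

Lemma pcl_cst (x : X) : pcl (fun=> x) = 0.
Proof.
have xc : continuous (fun _ : R => x) by move=> t; exact: cvg_cst.
have E : pcl (fun=> x) + pcl (fun=> x) = pcl (fun=> x) := pcl_cat xc 0 0 0.
by zmod_from E.
Qed.

End PathClass.

(** * Potentials compute the classes of paths *)
Section PathPotential.
Variables (R : realType) (Q : zmodType) (n m : nat) (K : finType).
Local Notation C := (Cplx R).
Local Notation V := 'M[C]_(n, m).
Variable f : K -> V -> C.
Local Notation U := (Ucomp f).
Hypothesis f_cont : forall J, contF (f J).
Variable cls : (R -> V) -> Q.
Hypothesis cls_ext : forall g h : R -> V, (forall t : R, 0 <= t <= 1 -> g t = h t) -> cls g = cls h.
Hypothesis cls_tri : forall F : R * R -> V, contM F -> (forall p, U (F p)) ->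
  forall a b c, cls (F \o seg2 a b) + cls (F \o seg2 b c) = cls (F \o seg2 a c).
Variable H : V -> Q.
Hypothesis H_pot : forall x, U x ->
  exists2 d : R, 0 < d & forall y y', near_mx y x d -> near_mx y' x d ->
    H y' - H y = wseg cls y y'.

(** The straight-line homotopy to the chord stays in the box. *)
Lemma cls_chord (x : V) (d : R) (g : R -> V) : contM g ->
  (forall z, near_mx z x d -> U z) ->
  (forall t : R, 0 <= t <= 1 -> near_mx (g t) x d) -> cls g = wseg cls (g 0) (g 1).
Proof.
move=> gc Ud gd.
have c1 := @cont_clamp_fst R.
have c2 := @cont_clamp_snd R.
have i0 : 0 <= (0 : R) <= 1 by rewrite lexx ler01.
have i1 : 0 <= (1 : R) <= 1 by rewrite lexx ler01.
pose F (s u : R) := linM (g u) (linM (g 0) (g 1) u) s.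
have E : cls (F 0) + cls (F^~ 1) = cls (F^~ 0) + cls (F 1).
  apply: (@cls_square R Q n m K f cls cls_ext cls_tri F).
    apply: contM_linM; [exact: (contM_comp gc c2)| |exact: c1].
    by apply: contM_linM; [exact: contM_cst|exact: contM_cst|exact: c2].
  move=> s u s01 u01; apply: Ud; apply: near_lin; [exact: s01|exact: gd|].
  by apply: near_lin; [exact: u01|exact: gd|exact: gd].
have e1 : cls (F 0) = cls g by apply: cls_ext => t _; rewrite /F linM0.
have e2 : cls (F 1) = wseg cls (g 0) (g 1) by apply: cls_ext => t _; rewrite /F linM1.
have lin_cst (a : V) (t : R) : linM a a t = a.
  by apply/matrixP => i j; rewrite linME /lin subrr mulr0 addr0.
have e3 : cls (F^~ 1) = 0.
  rewrite -(cls_const cls_tri (Ud _ (gd 1 i1))); apply: cls_ext => t _.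
  by rewrite /F linM1 lin_cst.
have e4 : cls (F^~ 0) = 0.
  rewrite -(cls_const cls_tri (Ud _ (gd 0 i0))); apply: cls_ext => t _.
  by rewrite /F linM0 lin_cst.
have aux (a b c k a' k' : Q) : a + b = c + k -> b = 0 -> c = 0 -> a = a' -> k = k' -> a' = k'.
  by move=> + b0 c0 <- <-; rewrite b0 c0 addr0 add0r.
exact: (aux _ _ _ _ _ _ E e3 e4 e1 e2).
Qed.

(** The class of the initial piece of the path minus H is locally constant. *)
Lemma cls_path (g : R -> V) : contM g -> (forall t, U (g t)) -> cls g = H (g 1) - H (g 0).
Proof.
move=> gc Ug.
pose F (t : R) := cls (fun s => g (0 + s * (t - 0))) - H (g t).
have F01 : F 1 = F 0.
  apply: loc_const => t t01.
  have [d1 d10 Hd1] := H_pot (Ug t).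
  have [d2 d20 Hd2] := open_U f_cont (Ug t).
  have m0 : 0 < Num.min d1 d2 by rewrite lt_min d10.
  have := contM_near gc t m0 => /nbhs_ballP [e e0 He].
  exists e => // t' _ tt'.
  have near (s : R) : 0 <= s <= 1 -> near_mx (g (t + s * (t' - t))) (g t) (Num.min d1 d2).
    move=> s01; apply: He; rewrite /ball /= opprD addrA subrr sub0r normrN normrM.
    apply: le_lt_trans tt'; rewrite ler_piMl //.
    by case/andP: s01 => s0 s1; rewrite ger0_norm.
  have gc' : contM (fun s : R => g (t + s * (t' - t))).
    apply: (contM_comp gc) => s; apply: cvgD; first exact: cvg_cst.
    by apply: (@cont_mulR R R id (t' - t)) => u; exact: cvg_id.
  have E1 := cls_cat cls_tri gc Ug 0 t t'.
  have E2 : cls (fun s => g (t + s * (t' - t))) = H (g t') - H (g t).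
    rewrite (cls_chord (d := d2) gc' Hd2) => [|s s01]; last first.
      by apply: near_le (near s s01); rewrite ge_min lexx orbT.
    rewrite mul0r addr0 mul1r addrC subrK; symmetry; apply: Hd1; last first.
      have := near 1; rewrite mul1r addrC subrK => /(_ ltac:(by rewrite lexx ler01)).
      by apply: near_le; rewrite ge_min lexx.
    by apply: near_refl.
  rewrite /F; move: E1 E2.
  move: (cls (fun s => g (0 + s * (t - 0)))) (cls (fun s => g (0 + s * (t' - 0)))) => A1 A2.
  move: (cls _) (H _) (H _) => A3 h h' E1 E2.
  by zmod_from2 (esym E1) E2.
have : cls (fun s => g (0 + s * (1 - 0))) = cls g.
  by apply: cls_ext => t _; rewrite add0r subr0 mulr1.
have : cls (fun s => g (0 + s * (0 - 0))) = 0.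
  rewrite -(cls_const cls_tri (Ug 0)); apply: cls_ext => t _.
  by rewrite subrr mulr0 addr0.
move=> E0 E1; move: F01; rewrite /F E0 E1 => E.
by zmod_from E.
Qed.

End PathPotential.

(** * Descent to the configuration space *)
Section ConfigurationPotential.
Variables (R : realType) (n l : nat).
Local Notation C := (Cplx R).
Local Notation V := 'M[C]_(n, l.+1).
Local Notation B := (@general_position R n l).
Local Notation U := (Ucomp (@minor R n l)).
Hypotheses (hl : (1 <= l)%N) (hn : (l <= n)%N).
Variable y : B.
Variables (Q : zmodType) (q : {additive chain R B 1 -> Q}).
Hypothesis q_boundary : forall b : chain R B 2, q (boundary b) = 0.

Definition lift_class (g : R -> V) : Q := pcl q (fun t => projB y (g t)).

Lemma lift_class_ext (g h : R -> V) :
  (forall t : R, 0 <= t <= 1 -> g t = h t) -> lift_class g = lift_class h.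
Proof. by move=> gh; apply: pcl_ext => t t01; rewrite gh. Qed.

Lemma lift_class_tri (F : R * R -> V) : contM F -> (forall p, U (F p)) ->
  forall a b c, lift_class (F \o seg2 a b) + lift_class (F \o seg2 b c) =
    lift_class (F \o seg2 a c).
Proof.
move=> Fc UF a b c.
have Pc : continuous (fun p : R * R => projB y (F p)) := cont_projB hn Fc UF.
exact: (pcl_tri q_boundary Pc a b c).
Qed.

Hypothesis base : forall J, exists e z, regular (@minor R n l) J e z /\ triv lift_class z e.

Lemma lift_potential : exists H : V -> Q,
  forall g : R -> V, contM g -> (forall t, U (g t)) -> lift_class g = H (g 1) - H (g 0).
Proof.
have n0 : (0 < n)%N by apply: leq_trans hn.
have [x0 rep0] := lift_point y; have [U0 _] := projB_represents hn y rep0.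
have [H HP] := cls_potential (@contF_minor R n l) (@minor_aff R n l) (@pol_minor R n l)
  (Ordinal n0, ord0) lift_class_ext lift_class_tri
  (fun J I e JI => @minor_rslt R n l J I e x0 U0 JI) (@minor_link R n l) base.
by exists H; exact: (cls_path (@contF_minor R n l) lift_class_ext lift_class_tri HP).
Qed.

Lemma projB_scale (d : 'I_n -> C) (x : V) : (forall i, d i != 0) -> U x ->
  projB y (scale_rows d x) = projB y x.
Proof.
move=> d0 Ux; apply/val_inj; have Ud := U_scale d0 Ux.
rewrite [LHS](val_projB hn y Ud) [RHS](val_projB hn y Ux); apply/funext => i.
rewrite /rowpts (_ : row i _ = d i *: row i x); last by apply/rowP => j; rewrite !mxE.
by apply: pt_scale => //; exact: row_neq0.
Qed.

Variable H : V -> Q.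
Hypothesis H_path : forall g : R -> V, contM g -> (forall t, U (g t)) ->
  lift_class g = H (g 1) - H (g 0).

(** The path of rescaled matrices projects to a constant path. *)
Lemma H_scale_homotopy (c : 'I_n -> R -> C) (x : V) : U x -> (forall i, continuous (c i)) ->
  (forall i t, c i t != 0) -> H (scale_rows (c^~ 1) x) = H (scale_rows (c^~ 0) x).
Proof.
move=> Ux cc c0; pose g t := scale_rows (c^~ t) x.
have gc : contM g.
  move=> i j; rewrite (_ : (fun _ => _) = fun t => c i t * x i j).
    by apply: contCM; [exact: cc|exact: contCc].
  by apply/funext => t; rewrite mxE.
have E := H_path gc (fun t => U_scale (fun i => c0 i t) Ux).
have E0 : lift_class g = 0.
  rewrite /lift_class (_ : (fun t => _) = fun=> projB y x); first exact: pcl_cst.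
  by apply/funext => t; exact: (projB_scale (fun i => c0 i t) Ux).
by apply/eqP; rewrite -subr_eq0 -E0 E.
Qed.

(** Join 1 to each factor d i by a path of nonzero complex numbers with one
    corner p i, and scale along its two sides. *)
Lemma H_scale (d : 'I_n -> C) (x : V) : (forall i, d i != 0) -> U x ->
  H (scale_rows d x) = H x.
Proof.
move=> d0 Ux.
have ex i : exists p : C, (forall t, 0 <= t <= 1 -> lin 1 p t != 0) /\
    (forall t, 0 <= t <= 1 -> lin p (d i) t != 0).
  have [||p [_ h1 h2]] := @detour R [:: 0] 1 (d i) 1 _ _ ltr01.
  - by rewrite inE oner_neq0.
  - by rewrite inE.
  by exists p; split=> t /[dup] /h1 H1 /h2 H2; [move: H1|move: H2]; rewrite inE.
have [p Hp] := choice ex.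
have linc (a b : C) : continuous (fun t : R => lin a b (clamp t)).
  apply: contCD; first exact: contCc.
  by apply: contCM; [apply: contC_rc; exact: cont_clamp|exact: contCc].
have lin0 (a b : C) : lin a b (clamp 0) = a by rewrite clamp_id ?lexx ?ler01 // /lin rc0 mul0r addr0.
have lin1 (a b : C) : lin a b (clamp 1) = b by rewrite clamp_id ?lexx ?ler01 // /lin rc1 mul1r addrC subrK.
have scE (a b : 'I_n -> C) : a =1 b -> scale_rows a x = scale_rows b x by move=> /funext ->.
have E1 := @H_scale_homotopy (fun i t => lin 1 (p i) (clamp t)) x Ux (fun i => linc _ _)
  (fun i t => (Hp i).1 _ (clamp01 t)).
have E2 := @H_scale_homotopy (fun i t => lin (p i) (d i) (clamp t)) x Ux (fun i => linc _ _)
  (fun i t => (Hp i).2 _ (clamp01 t)).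
move: E1 E2; rewrite (scE _ p (fun i => lin1 _ _)) (scE _ (fun=> 1) (fun i => lin0 _ _)).
rewrite (scE _ d (fun i => lin1 _ _)) (scE _ p (fun i => lin0 _ _)) => E1 E2.
rewrite E2 E1; congr H; apply/matrixP => i j; by rewrite mxE mul1r.
Qed.

Definition point_potential (b : B) : Q := H (projT1 (cid (lift_point b))).

Lemma point_potentialE (b : B) (x : V) : represents x (set_val b) -> H x = point_potential b.
Proof.
rewrite /point_potential; case: cid => x' /= rep' rep.
have [d d0 ->] := represents_scale rep' rep.
by apply: H_scale => //; case: (projB_represents hn y rep').
Qed.

(** As in [cls_path], with H on local lifts; different lifts of a point have the
    same value of H. *)
Lemma pcl_potential (g : R -> B) : continuous g ->
  pcl q g = point_potential (g 1) - point_potential (g 0).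
Proof.
move=> gc.
pose F (t : R) := pcl q (fun s => g (0 + s * (t - 0))) - point_potential (g t).
have F01 : F 1 = F 0.
  apply: loc_const => t _; have [e e0 [h [hc Uh rep]]] := local_lift t gc.
  exists e => // t' _ tt'.
  have affc : continuous (fun s : R => t + s * (t' - t)).
    move=> s; apply: cvgD; first exact: cvg_cst.
    by apply: (@cont_mulR R R id (t' - t)) => u; exact: cvg_id.
  have near (s : R) : 0 <= s <= 1 -> `|t + s * (t' - t) - t| <= e.
    move=> /andP[s0 s1]; rewrite addrAC subrr add0r normrM ger0_norm //.
    by apply: le_trans (ltW tt'); rewrite ler_piMl.
  have E1 := pcl_cat q_boundary gc 0 t t'.
  have E2 : pcl q (fun s => g (t + s * (t' - t))) = point_potential (g t') - point_potential (g t).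
    have -> : pcl q (fun s => g (t + s * (t' - t))) = lift_class (fun s => h (t + s * (t' - t))).
      apply: pcl_ext => s s01.
      by have [_ ->] := projB_represents hn y (rep _ (near s s01)).
    rewrite (H_path (contM_comp hc affc) (fun s => Uh _)).
    rewrite mul0r addr0 mul1r [t + _]addrC subrK (point_potentialE (rep t' (ltW tt'))).
    by rewrite (@point_potentialE (g t)) //; apply: rep; rewrite subrr normr0 ltW.
  rewrite /F; move: E1 E2.
  move: (pcl q (fun s => g (0 + s * (t - 0)))) (pcl q (fun s => g (0 + s * (t' - 0)))) => A1 A2.
  move: (pcl q _) (point_potential _) (point_potential _) => A3 k k' E1 E2.
  by zmod_from2 (esym E1) E2.
have E1 : pcl q (fun s => g (0 + s * (1 - 0))) = pcl q g.
  by apply: pcl_ext => t _; rewrite add0r subr0 mulr1.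
have E0 : pcl q (fun s => g (0 + s * (0 - 0))) = 0.
  rewrite -(pcl_cst q_boundary (g 0)); apply: pcl_ext => t _.
  by rewrite subrr mulr0 addr0.
move: F01; rewrite /F E0 E1 => E.
by zmod_from E.
Qed.

End ConfigurationPotential.

(** * Singular chains and potentials *)
Section Edges.
Variables (R : realType) (X : topologicalType).

Definition edge_vec (t : R) : 'rV[R]_2 :=
  \row_j (if j == ord_max then clamp t else 1 - clamp t).

Lemma edge_vec_simplex t : edge_vec t \in std_simplex R 1.
Proof.
have /andP[t0 t1] := clamp01 t; apply/mem_set; split=> [j|].
  by rewrite mxE; case: eqP => _; rewrite ?subr_ge0.
rewrite !big_ord_recl big_ord0 addr0 !mxE.
rewrite (_ : (lift ord0 ord0 == ord_max) = true); last exact/eqP/val_inj.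
by rewrite /= subrK.
Qed.

Definition edge_point t : std_simplex R 1 := exist _ (edge_vec t) (edge_vec_simplex t).

Lemma edge_pointK (s : std_simplex R 1) : edge_point (coord1 s) = s.
Proof.
apply/val_inj/rowP => j; rewrite /= mxE (clamp_id (coord1_01 s)).
case: eqP => [->//|/eqP j1]; rewrite -coord1_compl; congr (set_val s 0 _).
by case: j j1 => -[|[|//]] // lt _; apply/val_inj.
Qed.

Lemma edge_point_cont : continuous edge_point.
Proof.
apply/continuous_comp_initial => t W [P /= nP PW].
have ec (j : 'I_2) : continuous (fun t => edge_vec t 0 j).
  have c := @cont_clamp R.
  rewrite (_ : (fun _ => _) = fun t => if j == ord_max then clamp t else 1 - clamp t).
    case: eqP => _; first exact: c.
    by move=> u; apply: cvgB; [exact: cvg_cst|exact: c].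
  by apply/funext => u; rewrite mxE.
have : \forall t' \near t, forall k : 'I_1 * 'I_2, P k.1 k.2 (edge_vec t' k.1 k.2).
  apply: (@filter_forall R _ (fun k t' => P k.1 k.2 (edge_vec t' k.1 k.2)) (nbhs t)).
  by move=> -[a j]; have := nP a j; rewrite /= ord1 => /ec.
rewrite /= nbhs_simpl /=; apply: filterS => t' Ht; apply: PW => a j; exact: (Ht (a, j)).
Qed.

Definition edge_path (s : singular_simplex R X 1) (t : R) : X := s (edge_point t).

Lemma edge_path_cont (s : singular_simplex R X 1) : continuous (edge_path s).
Proof. by apply: (cont_comp edge_point_cont); exact: cts_fun. Qed.

Lemma edge_pathE (s : singular_simplex R X 1) : path_simplex (@edge_path_cont s) = s.
Proof. by apply/continuousEP => t; rewrite /= /path_simplex /mk_cts /edge_path edge_pointK. Qed.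

Definition vertex : std_simplex R 0.
Proof.
exists (const_mx 1); apply/mem_set; split=> [i|]; first by rewrite mxE ler01.
by rewrite big_ord_recl big_ord0 addr0 mxE.
Defined.

Lemma boundary_edge (s : singular_simplex R X 1) :
  boundary << s >> = << simplex_face s ord0 >> - << simplex_face s ord_max >>.
Proof.
rewrite /boundary liftU scale1r 2!big_ord_recl big_ord0 addr0 expr0 expr1 -freegUN.
by congr (_ - << simplex_face s _ >>); apply/val_inj.
Qed.

Lemma face_vertex (s : singular_simplex R X 1) :
  simplex_face s ord0 vertex = edge_path s 1 /\ simplex_face s ord_max vertex = edge_path s 0.
Proof.
have c0 : clamp 0 = 0 :> R by rewrite clamp_id // lexx ler01.
have c1 : clamp 1 = 1 :> R by rewrite clamp_id // lexx ler01.
split; rewrite /simplex_face /= /edge_path; congr (s _); apply/val_inj/rowP => j; rewrite /= !mxE ?c0 ?c1.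
  case: unliftP => [k ->|->]; last by rewrite /= subrr.
  by rewrite mxE ord1.
case: unliftP => [k ->|->]; last by rewrite eqxx.
by rewrite mxE ord1 /= subr0.
Qed.

End Edges.

Section ChainPotential.
Variables (R : realType) (X : topologicalType) (Q : zmodType) (q : {additive chain R X 1 -> Q}).
Variable h : X -> Q.
Hypothesis h_path : forall g : R -> X, continuous g -> pcl q g = h (g 1) - h (g 0).

(** Q is regarded as a module over the integers in order to extend h linearly. *)
Definition vertex_potential (c : chain R X 0) : zmodule Q :=
  fglift (fun s : singular_simplex R X 0 => h (s (vertex R)) : zmodule Q) c.

Lemma vertex_potentialB c d : vertex_potential (c - d) = vertex_potential c - vertex_potential d.
Proof. exact: lift_is_additive. Qed.

(** Both sides are additive, and a singular 1-simplex is the path along its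
    edge. *)
Lemma chain_potential (c : chain R X 1) : q c = vertex_potential (boundary c).
Proof.
move: c; apply: freeg_additive_eq => [c d|c d|s].
- by rewrite raddfB.
- by rewrite boundaryB vertex_potentialB.
rewrite boundary_edge vertex_potentialB /vertex_potential !liftU !scale1r.
have [-> ->] := face_vertex s.
by rewrite -(h_path (@edge_path_cont R X s)) pclE ?(pclassE (@edge_path_cont R X s)) ?edge_pathE; last exact: edge_path_cont.
Qed.

Lemma cycle_potential (c : chain R X 1) : boundary c = 0 -> q c = 0.
Proof.
move=> c0; rewrite chain_potential c0 -[0](subrr (0 : chain R X 0)) vertex_potentialB.
by rewrite subrr.
Qed.

End ChainPotential.

(** * Meridians *)
Section IntervalPaths.
Variables (R : realType) (X : topologicalType).

Lemma clamp_in_interval (t : R) : clamp t \in [set` `[0%R : R, 1%R]].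
Proof. by apply/mem_set; rewrite /= in_itv; exact: clamp01. Qed.

Definition to_interval (t : R) : unit_interval R := exist _ (clamp t) (clamp_in_interval t).

Lemma to_intervalE (t : R) : 0 <= t <= 1 -> set_val (to_interval t) = t.
Proof. by move=> t01; rewrite -[LHS]/(clamp t) clamp_id. Qed.

Lemma to_interval_cont : continuous to_interval.
Proof. by apply/continuous_comp_initial; exact: cont_clamp. Qed.

Lemma loop_chain_pclass (x : X) (g : {path unit_interval R from x to x}) :
  loop_chain g = pclass (g \o to_interval).
Proof.
have gc : continuous (g \o to_interval) by apply: (cont_comp to_interval_cont); exact: cts_fun.
rewrite (pclassE gc); congr (<< _ >>); apply/continuousEP => t.
rewrite /= /path_simplex /mk_cts /=; congr (g _); apply/val_inj.
by rewrite /= clamp_id ?coord1_01.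
Qed.

Variables (Q : zmodType) (q : {additive chain R X 1 -> Q}).
Hypothesis q_boundary : forall b : chain R X 2, q (boundary b) = 0.

(** In the abelian group Q the tail p of the loop cancels against its reverse. *)
Lemma pcl_conjugate (g p m : R -> X) : continuous g -> continuous p -> pcl q g = 0 ->
  (forall t : R, 0 <= t <= 1 -> [/\ g (t / 3) = p t, g ((1 + t) / 3) = m t &
     g (1 - t / 3) = p t]) -> pcl q m = 0.
Proof.
move=> gc pc g0 Hg.
have E1 := pcl_cat q_boundary gc 0 (1 / 3) (2 / 3).
have E2 := pcl_cat q_boundary gc 0 (2 / 3) 1.
have E3 := pcl_cat q_boundary pc 0 1 0.
have e0 : pcl q (fun t => g (0 + t * (1 - 0))) = 0.
  by rewrite -g0; apply: pcl_ext => t _; congr g; ring.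
have e1 : pcl q (fun t => g (0 + t * (1 / 3 - 0))) = pcl q (fun t => p (0 + t * (1 - 0))).
  apply: pcl_ext => t t01; have [<- _ _] : [/\ g (t / 3) = p (0 + t * (1 - 0)), True & True].
    by split=> //; have [-> _ _] := Hg t t01; congr p; ring.
  by congr g; field.
have e2 : pcl q (fun t => g (1 / 3 + t * (2 / 3 - 1 / 3))) = pcl q m.
  apply: pcl_ext => t t01; have [_ <- _] := Hg t t01.
  by congr g; field.
have e3 : pcl q (fun t => g (2 / 3 + t * (1 - 2 / 3))) = pcl q (fun t => p (1 + t * (0 - 1))).
  apply: pcl_ext => t t01; have t01' : 0 <= 1 - t <= 1 by lra.
  have [_ _ E] := Hg (1 - t) t01'.
  by rewrite (_ : 1 + t * (0 - 1) = 1 - t) -?E; [congr g; field|ring].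
have e4 : pcl q (fun t => p (0 + t * (0 - 0))) = 0.
  rewrite -(pcl_cst q_boundary (p 0)); apply: pcl_ext => t _.
  by rewrite subrr mulr0 addr0.
move: E2; rewrite -E1 e0 e1 e2 e3; rewrite e4 in E3.
move: (pcl q _) (pcl q m) (pcl q _) E3 => P M P' E3 E2.
by zmod_from2 E2 (esym E3).
Qed.

End IntervalPaths.

Section MeridianBase.
Variables (R : realType) (n l : nat).
Local Notation C := (Cplx R).
Local Notation V := 'M[C]_(n, l.+1).
Local Notation B := (@general_position R n l).
Local Notation U := (Ucomp (@minor R n l)).
Hypotheses (hl : (1 <= l)%N) (hn : (l <= n)%N).
Variable y : B.
Variables (Q : zmodType) (q : {additive chain R B 1 -> Q}).
Hypothesis q_boundary : forall b : chain R B 2, q (boundary b) = 0.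

(** Two representatives differ by row scalings, which multiply minors by nonzero
    factors. *)
Lemma hypersurface_minor (J : minor_index n l) (A : V) p : represents A p ->
  hypersurface (val J) p <-> minor J A = 0.
Proof.
move=> rep; split=> [[A' rep' A'0]|A0]; last by exists A.
have [d d0 ->] := represents_scale rep' rep; have [c _ ->] := minor_scale J A' d0.
by rewrite /minor A'0 mulr0.
Qed.

(** A meridian that vanishes in Q makes the boundary circle of its disc vanish. *)
Lemma meridian_triv (J : minor_index n l) z (g : {path unit_interval R from y to y in B}) :
  meridian y (val J) z g -> q (loop_chain g) = 0 ->
  exists e x, regular (@minor R n l) J e x /\ triv (lift_class y q) x e.
Proof.
move=> [[Jz Iz] [disc [q0 [p [[disc0 discB [A [Arep Acont Ader Aneq]]] _ Hg]]]]] g0.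
have n0 : (0 < n)%N by apply: leq_trans hn.
have le1 (t : C) : (`|t| <= 1) = (nrm t <= 1) := @nrm_leE R t 1.
have lt0 (t : C) : (0 < `|t|) = (0 < nrm t) by rewrite !lt_def normr_ge0 nrm_ge0 !andbT normr_eq0 -nrm_eq0.
have A0 : represents (A 0) z by rewrite -disc0; apply: Arep; rewrite normr0 ler01.
have circle_in (u : R) : `|circle u : C| <= 1 by rewrite le1 nrm_circle.
pose gam (t : R) := g (to_interval t); pose pth (t : R) := p (to_interval t).
have gamc : continuous gam by apply: (cont_comp (@to_interval_cont R)); exact: cts_fun.
have pthc : continuous pth by apply: (cont_comp (@to_interval_cont R)); exact: cts_fun.
have gam0 : pcl q gam = 0 by rewrite pclE // -[gam]/(g \o @to_interval R) -loop_chain_pclass.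
have A_circ : lift_class y q (fun u => A (circle u)) = 0.
  apply: (pcl_conjugate q_boundary gamc pthc gam0) => t t01.
  have [H1 _ _] := Hg (to_interval (t / 3)) (to_interval t).
  have [_ H2 _] := Hg (to_interval ((1 + t) / 3)) (to_interval t).
  have [_ _ H3] := Hg (to_interval (1 - t / 3)) (to_interval t).
  have r1 : 0 <= t / 3 <= 1 by lra.
  have r2 : 0 <= (1 + t) / 3 <= 1 by lra.
  have r3 : 0 <= 1 - t / 3 <= 1 by lra.
  move: H1 H2 H3; rewrite !to_intervalE // => H1 H2 H3; split.
  - by apply: H1; field.
  - have E2 : set_val (gam ((1 + t) / 3)) = disc (circle t) by apply: H2; field.
    have rep : represents (A (circle t)) (set_val (gam ((1 + t) / 3))).
      by rewrite E2; exact: Arep.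
    by have [_ ->] := projB_represents hn y rep.
  - by apply: H3; field.
have Ader0 i j : derivable (fun t : C => A t i j : C^o) 0 1.
  by apply: Ader; rewrite normr0 ltr01.
have fJ : minor J (A 0) = 0 := (hypersurface_minor J A0).1 Jz.
have fI I : I != J -> minor I (A 0) != 0.
  move=> IJ; apply/eqP => /(hypersurface_minor I A0).2; apply: Iz; first exact/eqP/(valP I).
  by move=> /val_inj E; move: IJ; rewrite E eqxx.
have UA t : 0 < nrm t <= 1 -> U (A t).
  rewrite -lt0 -le1 => t01; apply: represents_U (discB t t01) (Arep t _).
  by case/andP: t01.
have [e reg T] := disc_triv (@contF_minor R n l) (@minor_aff R n l) (Ordinal n0, ord0)
  (@lift_class_ext R n l y Q q) (@lift_class_tri R n l hn y Q q q_boundary)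
  Acont Ader0 Aneq fJ fI UA A_circ.
by exists e, (A 0).
Qed.

End MeridianBase.

(** * The quotient by the given loops *)
Lemma boundary0 (R : realType) (X : topologicalType) k : boundary (0 : chain R X k.+1) = 0.
Proof. by rewrite -[X in boundary X](subrr 0) boundaryB subrr. Qed.

Section SpannedQuotient.
Variables (R : realType) (X : topologicalType) (I : finType) (P : pred I) (g : I -> chain R X 1).

Definition spanned (c : chain R X 1) : bool :=
  `[< exists (b : chain R X 2) (m : I -> int), c = boundary b + \sum_(i | P i) g i *~ m i >].

Lemma spanned_zmod_closed : zmod_closed (spanned : {pred _}).
Proof.
split=> [|c d].
  apply/asboolP; exists 0, (fun=> 0); rewrite boundary0 add0r.
  by rewrite big1 // => i _; rewrite mulr0z.
move=> /asboolP [a [m ->]] /asboolP [b [k ->]]; apply/asboolP.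
exists (a - b), (fun i => m i - k i); rewrite boundaryB.
under [X in _ = _ + X]eq_bigr do rewrite mulrzBr.
by rewrite sumrB opprD addrACA.
Qed.

HB.instance Definition _ := GRing.isZmodClosed.Build (chain R X 1) spanned spanned_zmod_closed.

Definition spanned_quot : zmodType :=
  Quotient.quot (GRing.ZmodClosed.clone (chain R X 1) spanned _).

Definition spanned_proj : {additive chain R X 1 -> spanned_quot} := \pi_spanned_quot.

Lemma spanned_proj0 c : spanned_proj c = 0 <-> spanned c.
Proof.
have -> : spanned c = (spanned_proj c == 0).
  have -> : (spanned_proj c == 0) = (spanned_proj c == spanned_proj 0) by rewrite raddf0.
  by rewrite -Quotient.idealrBE subr0.
by split=> /eqP.
Qed.

End SpannedQuotient.

(** The relation found for the representing cycle of h is one in homology. *)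
Lemma loop_classes_generate (R : realType) (X : topologicalType) (x : X) (I : finType)
    (P : pred I) (g : I -> {path unit_interval R from x to x}) :
  (forall c : chain R X 1, boundary c = 0 -> spanned P (fun i => loop_chain (g i)) c) ->
  generated_by P (fun i => loop_class (g i) : homology R X 1).
Proof.
move=> H h; pose c : Defs.cycle R X 1 := repr h.
have c0 : boundary (c : chain R X 1) = 0 by have := cycleP c => /eqP.
have /asboolP [b [m E]] := H _ c0; exists m.
pose L i : Defs.cycle R X 1 := Cycle (loop_chain_cycle (g i)).
have -> : \sum_(i | P i) (loop_class (g i) : homology R X 1) *~ m i =
   \pi_(homology R X 1) (\sum_(i | P i) L i *~ m i).
  rewrite raddf_sum; apply: eq_bigr => i _; by rewrite raddfMz.
rewrite -[h]reprK -/c; apply/eqP; rewrite -Quotient.idealrBE.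
apply/asboolP; exists b.
pose v : {additive Defs.cycle R X 1 -> chain R X 1} := \val.
rewrite -[RHS]/(v (c - _)) raddfB raddf_sum [v c]E.
by under [X in _ - X]eq_bigr do rewrite raddfMz; rewrite addrK.
Qed.

Theorem corollary5p2 (R : realType) (n l : nat) (hl : (1 <= l)%N)
    (hn : (l <= n)%N) (y : general_position R n l)
    (z : {set 'I_n.+1} -> CPn R n l)
    (Gamma : {set 'I_n.+1} ->
      {path (unit_interval R) from y to y in general_position R n l})
    (hGamma : forall J : {set 'I_n.+1},
      #|J| = l.+1 -> meridian y J (z J) (Gamma J)) :
  generated_by (fun J : {set 'I_n.+1} => #|J| == l.+1)
    (fun J => loop_class (Gamma J) : homology R (general_position R n l) 1).
Proof.
apply: loop_classes_generate => c c0.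
pose P := fun J : {set 'I_n.+1} => #|J| == l.+1.
pose q := spanned_proj P (fun J => loop_chain (Gamma J)).
have q_boundary b : q (boundary b) = 0.
  apply/spanned_proj0/asboolP; exists b, (fun=> 0).
  by rewrite big1 ?addr0 // => J _; rewrite mulr0z.
have q_loop J : P J -> q (loop_chain (Gamma J)) = 0.
  move=> PJ; apply/spanned_proj0/asboolP; exists 0, (fun I => (I == J)%:Z).
  rewrite boundary0 add0r (bigD1 J) //= eqxx mulr1z big1 ?addr0 //.
  by move=> I /andP[_ /negbTE ->]; rewrite mulr0z.
have base (J : minor_index n l) :
    exists e x, regular (@minor R n l) J e x /\ triv (lift_class y q) x e.
  by apply: (meridian_triv hl hn q_boundary (hGamma _ (eqP (valP J)))); apply: q_loop; exact: (valP J).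
have [H HP] := lift_potential hl hn q_boundary base.
apply/spanned_proj0; apply: (cycle_potential _ c0).
exact: (pcl_potential hn q_boundary HP).
Qed.
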